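(* The indirect covering subtree problem (defined in the context) on a tree with $n$ nodes can be solved in $O(n\log n)$ time. Consequently, the single maximum coverage location problem on a tree with $n$ nodes can also be solved in $O(n\log n)$ time.
   Context: Indirect covering subtree problem: the input is a tree $T=(V,E)$ with $n$ nodes, non-negative edge costs $c\colon E\to\mathbb{R}_{\ge 0}$ inducing the path distance $d\colon V\times V\to\mathbb{R}_{\ge 0}$, and for each node $u$ a non-negative penalty $\pi(u)$ and a radius $\rho(u)$. For a subtree $Y$ of $T$, its setup cost is $c(Y)=\sum_{e\in E(Y)}c(e)$; node $u$ imposes penalty $p(u,Y)=0$ if $d(u,Y)\le\rho(u)$ and $p(u,Y)=\pi(u)$ otherwise, where $d(u,Y)$ is the minimum distance from $u$ to a node of $Y$; and $p(Y)=\sum_{u\in V}p(u,Y)$. The goal is to find a subtree $Y$ of $T$ minimizing $c(Y)+p(Y)$. The single maximum coverage location problem is the variant in which $Y$ is required to be a single node (so the objective is to minimize $p(Y)=\sum_{u\in V}p(u,Y)$ over nodes $Y$). *)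

(* Defs.v *)
From HB Require Import structures.
From mathcomp Require Import all_boot all_order all_algebra.
From mathcomp Require Import reals.

Set Implicit Arguments.
Unset Strict Implicit.
Unset Printing Implicit Defensive.

Import Order.TTheory GRing.Theory Num.Theory.
Local Open Scope ring_scope.

Record instance (R : realType) (n : nat) := Instance {
  node_gt0 : (0 < n)%N;
  adj : rel 'I_n;
  adj_sym : symmetric adj;
  adj_irr : irreflexive adj;
  adj_connected : forall x y, connect adj x y;
  (* [:: x; y] is a ucycle as soon as x and y are adjacent *)
  adj_acyclic : forall p, ucycle adj p -> (size p <= 2)%N;
  (* only the values on adjacent pairs matter *)
  cost : 'I_n -> 'I_n -> R;
  cost_sym : forall x y, adj x y -> cost x y = cost y x;
  cost_ge0 : forall x y, adj x y -> 0 <= cost x y;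
  penalty : 'I_n -> R;
  penalty_ge0 : forall u, 0 <= penalty u;
  radius : 'I_n -> R }.

Section Problem.
Variables (R : realType) (n : nat) (I : instance R n).
Implicit Types (u v x y : 'I_n) (Y : {set 'I_n}).

Lemma simple_path_exists x y :
  exists p, [&& path (adj I) x p, last x p == y & uniq (x :: p)].
Proof.
have /connectP[p xp ->] := adj_connected I x y.
by case/shortenP: xp => p' xp' up' _; exists p'; rewrite xp' eqxx up'.
Qed.

(* The nodes following x on the unique simple path from x to y. *)
Definition tree_path x y : seq 'I_n := xchoose (simple_path_exists x y).

Definition dist x y : R :=
  \sum_(e <- zip (x :: tree_path x y) (tree_path x y)) cost I e.1 e.2.

(* A connected subgraph of a tree contains every edge of the tree between two
   of its nodes, so that a subtree is determined by its set of nodes. *)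
Definition subtree Y : Prop :=
  Y != set0 /\
  {in Y &, forall x y,
     connect [rel a b | [&& a \in Y, b \in Y & adj I a b]] x y}.

Definition setup_cost Y : R :=
  \sum_(x in Y) \sum_(y in Y | adj I x y && (x < y)%N) cost I x y.

(* The value 0 for Y = set0 is irrelevant. *)
Definition dist_set u Y : R :=
  if [pick y in Y] is Some y0 then
    \big[Num.min/dist u y0]_(y in Y) dist u y
  else 0.

Definition node_penalty u Y : R :=
  if dist_set u Y <= radius I u then 0 else penalty I u.

Definition total_penalty Y : R := \sum_u node_penalty u Y.

Definition objective Y : R := setup_cost Y + total_penalty Y.

Definition optimal_subtree Y : Prop :=
  subtree Y /\ forall Z, subtree Z -> objective Y <= objective Z.

Definition optimal_location v : Prop :=
  forall w, total_penalty [set v] <= total_penalty [set w].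

(* Each edge is listed once, in one of its two orientations. *)
Definition edge_list (es : seq ('I_n * 'I_n)) : Prop :=
  [/\ uniq es,
      {in es, forall e, adj I e.1 e.2} &
      forall x y, adj I x y -> ((x, y) \in es) (+) ((y, x) \in es)].

End Problem.

(* Real RAM with integer words. The memory consists of unbounded arrays of
   words and unbounded arrays of reals; a program is a finite piece of syntax,
   hence it uses finitely many arrays, and cell 0 of an array can serve as a
   register. Reals support exact field operations and comparisons; there is no
   conversion from reals to words. *)

Inductive wexp :=
  | WConst of nat
  | WGet of nat & wexp
  | WAdd of wexp & wexp
  | WSub of wexp & wexp
  | WMul of wexp & wexp
  | WDiv of wexp & wexp.

Inductive rexp :=
  | ROfWord of wexp
  | RGet of nat & wexp
  | RAdd of rexp & rexp
  | RSub of rexp & rexp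
  | RMul of rexp & rexp
  | RDiv of rexp & rexp.

Inductive test :=
  | TWle of wexp & wexp
  | TRle of rexp & rexp
  | TNot of test
  | TAnd of test & test.

Inductive cmd :=
  | CSkip
  | CWSet of nat & wexp & wexp
  | CRSet of nat & wexp & rexp
  | CSeq of cmd & cmd
  | CIf of test & cmd & cmd
  | CWhile of test & cmd.

(* The cost of an evaluation is the number of elementary operations in it. *)

Fixpoint wcost (e : wexp) : nat :=
  match e with
  | WConst _ => 1
  | WGet _ e1 => (wcost e1).+1
  | WAdd e1 e2 | WSub e1 e2 | WMul e1 e2 | WDiv e1 e2 =>
      (wcost e1 + wcost e2).+1
  end.

Fixpoint rcost (e : rexp) : nat :=
  match e with
  | ROfWord e1 | RGet _ e1 => (wcost e1).+1
  | RAdd e1 e2 | RSub e1 e2 | RMul e1 e2 | RDiv e1 e2 =>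
      (rcost e1 + rcost e2).+1
  end.

Fixpoint tcost (b : test) : nat :=
  match b with
  | TWle e1 e2 => (wcost e1 + wcost e2).+1
  | TRle e1 e2 => (rcost e1 + rcost e2).+1
  | TNot b1 => (tcost b1).+1
  | TAnd b1 b2 => (tcost b1 + tcost b2).+1
  end.

Section Semantics.
Variable R : realType.

Record state := State {
  wmem : nat -> nat -> nat;
  rmem : nat -> nat -> R }.

Definition upd (T : Type) (m : nat -> nat -> T) (a i : nat) (x : T) :
    nat -> nat -> T :=
  fun b j => if (b == a) && (j == i) then x else m b j.

(* Words are integers modulo W, so that no unbounded integer can be packed in
   a single cell. WSub is truncated and division by 0 yields 0. *)
Variable W : nat.

Fixpoint weval (s : state) (e : wexp) : nat :=
  match e with
  | WConst c => (c %% W)%N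
  | WGet a e1 => wmem s a (weval s e1)
  | WAdd e1 e2 => ((weval s e1 + weval s e2) %% W)%N
  | WSub e1 e2 => (weval s e1 - weval s e2)%N
  | WMul e1 e2 => ((weval s e1 * weval s e2) %% W)%N
  | WDiv e1 e2 => (weval s e1 %/ weval s e2)%N
  end.

Fixpoint reval (s : state) (e : rexp) : R :=
  match e with
  | ROfWord e1 => (weval s e1)%:R
  | RGet a e1 => rmem s a (weval s e1)
  | RAdd e1 e2 => reval s e1 + reval s e2
  | RSub e1 e2 => reval s e1 - reval s e2
  | RMul e1 e2 => reval s e1 * reval s e2
  | RDiv e1 e2 => reval s e1 / reval s e2
  end.

Fixpoint teval (s : state) (b : test) : bool :=
  match b with
  | TWle e1 e2 => (weval s e1 <= weval s e2)%N
  | TRle e1 e2 => reval s e1 <= reval s e2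
  | TNot b1 => ~~ teval s b1
  | TAnd b1 b2 => teval s b1 && teval s b2
  end.

(* exec c s t s': started in s, the program c halts in s' after t steps. *)
Inductive exec : cmd -> state -> nat -> state -> Prop :=
  | ExecSkip s : exec CSkip s 1 s
  | ExecWSet a e1 e2 s :
      exec (CWSet a e1 e2) s (wcost e1 + wcost e2).+1
        (State (upd (wmem s) a (weval s e1) (weval s e2)) (rmem s))
  | ExecRSet a e1 e2 s :
      exec (CRSet a e1 e2) s (wcost e1 + rcost e2).+1
        (State (wmem s) (upd (rmem s) a (weval s e1) (reval s e2)))
  | ExecSeq c1 c2 s1 s2 s3 t1 t2 :
      exec c1 s1 t1 s2 -> exec c2 s2 t2 s3 ->
      exec (CSeq c1 c2) s1 (t1 + t2)%N s3
  | ExecIf b c1 c2 s t s' :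
      exec (if teval s b then c1 else c2) s t s' ->
      exec (CIf b c1 c2) s (tcost b + t).+1 s'
  | ExecWhileFalse b c s :
      ~~ teval s b -> exec (CWhile b c) s (tcost b).+1 s
  | ExecWhileTrue b c s1 s2 s3 t1 t2 :
      teval s1 b -> exec c s1 t1 s2 -> exec (CWhile b c) s2 t2 s3 ->
      exec (CWhile b c) s1 (tcost b + t1 + t2).+1 s3.

End Semantics.

(* Word arrays: 0 holds n in its cell 0; 1 and 2 hold the end nodes of the
   edges. Real arrays: 0 holds the edge costs, 1 the penalties, 2 the radii.
   All other cells are 0. *)
Definition input (R : realType) (n : nat) (I : instance R n)
    (es : seq ('I_n * 'I_n)) : state R :=
  State
    (fun a i =>
       match a with
       | 0 => if i == 0%N then n else 0%N
       | 1 => nth 0%N [seq val e.1 | e <- es] i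
       | 2 => nth 0%N [seq val e.2 | e <- es] i
       | _ => 0%N
       end)
    (fun a i =>
       match a with
       | 0 => nth 0 [seq cost I e.1 e.2 | e <- es] i
       | 1 => nth 0 (codom (penalty I)) i
       | 2 => nth 0 (codom (radius I)) i
       | _ => 0
       end).

(* Output conventions, in word array 3: the characteristic vector of a set of
   nodes, respectively a node in cell 0. *)
Definition outputs_optimal_subtree (R : realType) (n : nat)
    (I : instance R n) (s : state R) : Prop :=
  optimal_subtree I [set v : 'I_n | wmem s 3 v != 0%N].

Definition outputs_optimal_location (R : realType) (n : nat)
    (I : instance R n) (s : state R) : Prop :=
  exists2 v : 'I_n, wmem s 3 0 = v & optimal_location I v.

(* c solves the problem specified by the output predicate on every instance,
   in worst-case time O(g n), on words of O(log n) bits: it is correct for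
   any word modulus W at least a fixed power of n + 2. *)
Definition solves_in_time (R : realType)
    (out : forall n, instance R n -> state R -> Prop)
    (c : cmd) (g : nat -> nat) : Prop :=
  exists k C n0 : nat,
    forall (n : nat) (I : instance R n) (es : seq ('I_n * 'I_n)) (W : nat),
      edge_list I es -> ((n + 2) ^ k <= W)%N ->
      exists (t : nat) (s : state R),
        [/\ exec W c (input I es) t s,
            out n I s &
            (n0 <= n)%N -> (t <= C * g n)%N].

(* trunc_log 2 n is the integer part of log_2 n, which is between half of
   log_2 n and log_2 n when n >= 2. *)
Definition nlogn (n : nat) : nat := (n * trunc_log 2 n)%N.

(* Main.v *)
Require Import Defs.
From HB Require Import structures.
From mathcomp Require Import all_boot all_order all_algebra.
From mathcomp Require Import reals boolp zify lra.

(* Write B(u) for the ball of radius rho(u) around u. A subtree Y meets B(u) in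
   a subtree, whose number of nodes exceeds its number of edges by one unless it
   is empty. Hence the penalty saved by Y is the sum over its nodes v of
   P(v) = sum of pi(u) for v in B(u), minus the sum over its edges e of
   Q(e) = sum of pi(u) for e inside B(u): given P and Q, the best subtree is a
   heaviest connected subgraph of a tree, found by dynamic programming, and the
   best location maximizes P.

   P and Q are computed by contracting the tree, made binary by dummy nodes, in
   O(log n) rounds. A round merges the pairs of a maximal matching between
   clusters, where a leaf may merge with its parent and an only child having at
   most one child with its parent; this removes a constant fraction of the
   clusters. Every cluster carries its items sorted by the distance to the
   upper and to the lower attachment point, both as covered points and, shifted
   by the radius, as customers. Merging two clusters merges these lists in linear
   time, and a simultaneous scan of a list of customers and one of points adds
   all contributions across the merged pair. *)

Set Implicit Arguments.
Unset Strict Implicit.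
Unset Printing Implicit Defensive.

Import Order.TTheory GRing.Theory Num.Theory.
Local Open Scope ring_scope.

(** * Hoare-style rules for programs with time bounds *)

Arguments upd T m a i x b j / : rename.

(** The two merging rules are chosen so that a merged cluster has at most one child. A cluster with
    two children is therefore still a single dummy, both children hang at the same point, and one
    lower key per item serves everything below its cluster. Upper keys are depths from the root and
    never change; a lower key changes only when a leaf is absorbed, and then it becomes the upper
    key minus a constant, so that a list already sorted can be reused. Nothing is ever sorted from
    scratch: the initial lists are singletons.

    Edges are items too: an edge item is within reach of a customer when both of its ends are, so
    that the same scans produce Q together with P.

    A round costs O(n) whatever the number of clusters left, and a potential of size O(log n) drops
    in every round. The input is a bare list of edges; the tree is rooted by peeling leaves, with
    the degree, the sum of the neighbour labels and the sum of the incident costs kept at each node,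
    so that no adjacency lists are built. *)

Fixpoint loopfree (c : cmd) : bool :=
  match c with
  | CSeq c1 c2 | CIf _ c1 c2 => loopfree c1 && loopfree c2
  | CWhile _ _ => false
  | _ => true
  end.

(** Worst-case time over both branches of each conditional. The value 0 on loops is a placeholder:
    the bound is used for loop-free code only. *)
Fixpoint ctime (c : cmd) : nat :=
  match c with
  | CSkip => 1
  | CWSet _ e1 e2 => (wcost e1 + wcost e2).+1
  | CRSet _ e1 e2 => (wcost e1 + rcost e2).+1
  | CSeq c1 c2 => ctime c1 + ctime c2
  | CIf b c1 c2 => (tcost b + maxn (ctime c1) (ctime c2)).+1
  | CWhile _ _ => 0
  end.

(** With [rmods], a syntactic bound on what a program may write; frame conditions are then decided
    by computation. *)
Fixpoint wmods (c : cmd) : seq nat :=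
  match c with
  | CWSet a _ _ => [:: a]
  | CSeq c1 c2 | CIf _ c1 c2 => wmods c1 ++ wmods c2
  | CWhile _ c1 => wmods c1
  | _ => [::]
  end.

Fixpoint rmods (c : cmd) : seq nat :=
  match c with
  | CRSet a _ _ => [:: a]
  | CSeq c1 c2 | CIf _ c1 c2 => rmods c1 ++ rmods c2
  | CWhile _ c1 => rmods c1
  | _ => [::]
  end.

Notation "'var' a" := (WGet a (WConst 0)) (at level 9, a at level 0).
Notation "a ';;' b" := (CSeq a b) (at level 90, right associativity).
Notation "a '<--' e" := (CWSet a (WConst 0) e) (at level 85, no associativity).

Definition TWlt (e1 e2 : wexp) : test := TNot (TWle e2 e1).
Definition TWeq (e1 e2 : wexp) : test := TAnd (TWle e1 e2) (TWle e2 e1).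

Definition For (v : nat) (e : wexp) (body : cmd) : cmd :=
  v <-- WConst 0 ;;
  CWhile (TWlt (var v) e) (body ;; v <-- WAdd (var v) (WConst 1)).

Section Runs.
Variables (R : realType) (W : nat).
Implicit Types (s : state R) (c : cmd) (Q : state R -> Prop).

Fixpoint sexec (c : cmd) (s : state R) : state R :=
  match c with
  | CSkip => s
  | CWSet a e1 e2 =>
      State (upd (wmem s) a (weval W s e1) (weval W s e2)) (rmem s)
  | CRSet a e1 e2 =>
      State (wmem s) (upd (rmem s) a (weval W s e1) (reval W s e2))
  | CSeq c1 c2 => sexec c2 (sexec c1 s)
  | CIf b c1 c2 => if teval W s b then sexec c1 s else sexec c2 s
  | CWhile _ _ => s
  end.

(** A total-correctness triple with a time budget. As the postcondition is an arbitrary predicate,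
    the run of a continuation can be nested in it. *)
Definition runs c s (T : nat) Q : Prop :=
  exists t s', [/\ exec W c s t s', (t <= T)%N & Q s'].

Lemma runs_loopfree c s Q : loopfree c -> Q (sexec c s) -> runs c s (ctime c) Q.
Proof.
move=> lf q; suff [t ex le_t] : exists2 t, exec W c s t (sexec c s) & (t <= ctime c)%N.
  by exists t, (sexec c s).
elim: c s lf {q} => [|a e1 e2|a e1 e2|c1 IH1 c2 IH2|b c1 IH1 c2 IH2|] //= s.
- by exists 1; [constructor|].
- by eexists; [constructor|].
- by eexists; [constructor|].
- case/andP=> /IH1-/(_ s)[t1 ex1 le1] /IH2-/(_ (sexec c1 s))[t2 ex2 le2].
  by exists (t1 + t2)%N; [econstructor; eauto|rewrite leq_add].
- case/andP=> /IH1-/(_ s)[t1 ex1 le1] /IH2-/(_ s)[t2 ex2 le2].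
  case E: (teval W s b); [exists (tcost b + t1).+1|exists (tcost b + t2).+1].
  + by constructor; rewrite E.
  + by rewrite ltnS leq_add2l leq_max le1.
  + by constructor; rewrite E.
  + by rewrite ltnS leq_add2l leq_max le2 orbT.
Qed.

Lemma runs_seq c1 c2 s T1 T2 Q :
  runs c1 s T1 (fun s' => runs c2 s' T2 Q) -> runs (c1 ;; c2) s (T1 + T2) Q.
Proof.
case=> t1 [s1 [ex1 le1 [t2 [s2 [ex2 le2 q]]]]].
exists (t1 + t2)%N, s2; split=> //; last by rewrite leq_add.
by econstructor; eauto.
Qed.

Lemma runs_if b c1 c2 s T1 T2 Q :
  (teval W s b -> runs c1 s T1 Q) -> (~~ teval W s b -> runs c2 s T2 Q) ->
  runs (CIf b c1 c2) s (tcost b + maxn T1 T2).+1 Q.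
Proof.
move=> h1 h2; case E: (teval W s b).
  have [t [s' [ex le_t q]]] := h1 E.
  exists (tcost b + t).+1, s'; split=> //; first by constructor; rewrite E.
  by rewrite ltnS leq_add2l leq_max le_t.
have [t [s' [ex le_t q]]] := h2 (negbT E).
exists (tcost b + t).+1, s'; split=> //; first by constructor; rewrite E.
by rewrite ltnS leq_add2l leq_max le_t orbT.
Qed.

Lemma runs_weaken c s T T' Q Q' :
  runs c s T Q -> (T <= T')%N -> (forall s', Q s' -> Q' s') -> runs c s T' Q'.
Proof.
case=> t [s' [ex le_t q]] le_T h; exists t, s'; split; auto.
exact: leq_trans le_t le_T.
Qed.

Lemma exec_wframe c s t s' a j :
  exec W c s t s' -> a \notin wmods c -> wmem s' a j = wmem s a j.
Proof.
elim=> {c s t s'} //=.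
- by move=> b e1 e2 s; rewrite inE => /negbTE ab; rewrite /upd ab.
- move=> c1 c2 s1 s2 s3 t1 t2 _ IH1 _ IH2; rewrite mem_cat negb_or.
  by case/andP=> /IH1 <- /IH2.
- move=> b c1 c2 s t s' _ IH; rewrite mem_cat negb_or => /andP[m1 m2].
  by apply: IH; case: ifP.
- by move=> b c s1 s2 s3 t1 t2 _ _ IH1 _ IH2 m; rewrite IH2 // IH1.
Qed.

Lemma exec_rframe c s t s' a j :
  exec W c s t s' -> a \notin rmods c -> rmem s' a j = rmem s a j.
Proof.
elim=> {c s t s'} //=.
- by move=> b e1 e2 s; rewrite inE => /negbTE ab; rewrite /upd ab.
- move=> c1 c2 s1 s2 s3 t1 t2 _ IH1 _ IH2; rewrite mem_cat negb_or.
  by case/andP=> /IH1 <- /IH2.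
- move=> b c1 c2 s t s' _ IH; rewrite mem_cat negb_or => /andP[m1 m2].
  by apply: IH; case: ifP.
- by move=> b c s1 s2 s3 t1 t2 _ _ IH1 _ IH2 m; rewrite IH2 // IH1.
Qed.

Definition same_off (ws rs : seq nat) s s' : Prop :=
  (forall a j, a \notin ws -> wmem s' a j = wmem s a j) /\
  (forall a j, a \notin rs -> rmem s' a j = rmem s a j).

Lemma runs_frame c s T Q :
  runs c s T Q -> runs c s T (fun s' => Q s' /\ same_off (wmods c) (rmods c) s s').
Proof.
case=> t [s' [ex le_t q]]; exists t, s'; split=> //; split=> //.
by split=> a j; [apply: exec_wframe ex|apply: exec_rframe ex].
Qed.

(** The bound [e] is evaluated anew at each test, so the invariant has to fix its value. [N < W]
    keeps the counter from wrapping around, and the invariant must not depend on the counter cell,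
    which the loop changes behind its back. *)
Lemma runs_for v e N body s (T : nat -> nat) (Inv : nat -> state R -> Prop) :
    (N < W)%N -> v \notin wmods body ->
    (forall k s x, Inv k s -> Inv k (State (upd (wmem s) v 0 x) (rmem s))) ->
    (forall k s, (k <= N)%N -> Inv k s -> weval W s e = N) ->
    (forall k s, (k < N)%N -> wmem s v 0 = k -> Inv k s ->
       runs body s (T k) (Inv k.+1)) ->
    Inv 0%N s ->
  runs (For v e body) s
    (\sum_(k < N) T k + (N.+1) * (20 + wcost e)) (Inv N).
Proof.
move=> NW vb stab eN step I0.
pose s1 := State (upd (wmem s) v 0 0%N) (rmem s).
have ex1 : exec W (v <-- WConst 0) s 3 s1.
  have := ExecWSet W v (WConst 0) (WConst 0) s.
  by rewrite /= mod0n.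
have I1 : Inv 0%N s1 by apply: stab.
have v1 : wmem s1 v 0 = 0%N by rewrite /= /upd !eqxx.
(* Bounds the control cost of one iteration: the test and the increment take [wcost e + 11]
   steps. *)
pose ov := (12 + wcost e)%N.
pose loop := CWhile (TWlt (var v) e) (body ;; v <-- WAdd (var v) (WConst 1)).
suff H : forall m k s2, (k + m = N)%N -> wmem s2 v 0 = k -> Inv k s2 ->
    exists t s', [/\ exec W loop s2 t s',
      (t <= \sum_(k <= j < N) T j + m.+1 * ov)%N & Inv N s'].
  have [t [s' [ex le_t q]]] := H N 0%N s1 (add0n _) v1 I1.
  exists (3 + t)%N, s'; split=> //; first by apply: ExecSeq ex1 ex.
  rewrite big_mkord in le_t.
  apply: leq_trans (_ : 3 + (\sum_(i < N) T i + N.+1 * ov) <= _)%N.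
    by rewrite leq_add2l.
  rewrite addnCA leq_add2l /ov mulnDr mulnDr; nia.
elim=> [|m IH] k s2 km vk Ik.
  have kN : k = N by lia.
  rewrite kN in vk Ik *; exists (tcost (TWlt (var v) e)).+1, s2; split=> //.
  - by apply: ExecWhileFalse; rewrite /= mod0n vk (eN N) // leqnn.
  - by rewrite big_geq // /= /ov; lia.
have kN : (k < N)%N by lia.
have [t1 [s3 [ex3 le3 I3]]] := step k s2 kN vk Ik.
have v3 : wmem s3 v 0 = k by rewrite (exec_wframe 0 ex3 vb).
pose s4 := State (upd (wmem s3) v 0 k.+1) (rmem s3).
have ex4 : exec W (v <-- WAdd (var v) (WConst 1)) s3 6 s4.
  have := ExecWSet W v (WConst 0) (WAdd (var v) (WConst 1)) s3.
  rewrite /= mod0n v3 modnDmr modn_small; last by lia.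
  by rewrite (addn1 k).
have v4 : wmem s4 v 0 = k.+1 by rewrite /= /upd !eqxx.
have I4 : Inv k.+1 s4 by apply: stab.
have [t5 [s5 [ex5 le5 I5]]] := IH k.+1 s4 ltac:(lia) v4 I4.
exists (tcost (TWlt (var v) e) + (t1 + 6) + t5).+1, s5; split=> //.
- apply: (ExecWhileTrue (s2 := s4)) ex5; last by apply: ExecSeq ex3 ex4.
  by rewrite /= mod0n vk (eN k) // ?(ltnW kN) // -ltnNge.
- have ->: tcost (TWlt (var v) e) = (wcost e + 4)%N by rewrite /=; lia.
  rewrite big_ltn // (mulSn m.+1); move: le3 le5.
  by move: (\sum_(_ <= _ < _) _)%N (m.+1 * ov)%N => X Y; rewrite /ov; lia.
Qed.

Lemma runs_for_lf v e N body s (Inv : nat -> state R -> Prop) :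
    (N < W)%N -> loopfree body -> v \notin wmods body ->
    (forall k s x, Inv k s -> Inv k (State (upd (wmem s) v 0 x) (rmem s))) ->
    (forall k s, (k <= N)%N -> Inv k s -> weval W s e = N) ->
    (forall k s, (k < N)%N -> wmem s v 0 = k -> Inv k s -> Inv k.+1 (sexec body s)) ->
    Inv 0%N s ->
  runs (For v e body) s (N.+1 * (20 + wcost e + ctime body)) (Inv N).
Proof.
move=> NW lf vb stab eN step I0.
have := @runs_for v e N body s (fun=> ctime body) Inv NW vb stab eN.
move=> /(_ _ I0) H; apply: runs_weaken (H _) _ _ => //.
  by move=> k s' kN vk Ik; apply: runs_loopfree lf _; apply: step.
by rewrite sum_nat_const card_ord; nia.
Qed.

(* psi bounds the number of remaining iterations. *)
Lemma runs_while b body T (psi : nat -> nat) (Inv : nat -> state R -> Prop) m s :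
    (forall m s, Inv m s -> teval W s b = (1 < m)%N) ->
    (forall m s, Inv m s -> (1 < m)%N ->
       runs body s T (fun s' => exists2 m', (psi m' < psi m)%N & Inv m' s')) ->
    Inv m s ->
  runs (CWhile b body) s ((psi m).+1 * (tcost b + T).+1)
    (fun s' => exists2 m', (m' <= 1)%N & Inv m' s').
Proof.
move=> test step; elim: {m}(psi m) {-2}m s (leqnn (psi m)) => [|k IH] m s le_k Im.
  case: (ltnP 1 m) => [m1|m1].
    by have [t [s' [_ _ [m' lt_m' _]]]] := step m s Im m1; lia.
  exists (tcost b).+1, s; split; [|lia|by exists m].
  by apply: ExecWhileFalse; rewrite (test m) // -leqNgt.
case: (ltnP 1 m) => [m1|m1]; last first.
  exists (tcost b).+1, s; split; [|nia|by exists m].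
  by apply: ExecWhileFalse; rewrite (test m) // -leqNgt.
have [t [s1 [ex1 le1 [m' lt_m' I1]]]] := step m s Im m1.
have [t2 [s2 [ex2 le2 q]]] := IH m' s1 ltac:(lia) I1.
exists (tcost b + t + t2).+1, s2; split=> //; last by nia.
by apply: ExecWhileTrue ex1 ex2; rewrite (test m).
Qed.

End Runs.

(** * Simultaneous scans of two sorted lists *)

(* Take the left head when the right list is exhausted, or when both are
   nonempty and the left key is at most the right one. *)
Definition take_left (lL lR : nat) (kL kR : wexp -> rexp) : test :=
  TNot (TAnd (TWlt (var 28) (var 30))
    (TNot (TAnd (TWlt (var 27) (var 29))
       (TRle (kL (WGet lL (var 27))) (kR (WGet lR (var 28))))))).

Definition zip_loop lL lR kL kR actL actR : cmd :=
  27 <-- var 37 ;; 28 <-- var 38 ;;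
  For 5 (var 32)
    (CIf (take_left lL lR kL kR)
       (actL ;; 27 <-- WAdd (var 27) (WConst 1))
       (actR ;; 28 <-- WAdd (var 28) (WConst 1))).

Definition merge_code lL lR out (key : wexp -> rexp) : cmd :=
  zip_loop lL lR key key
    (CWSet out (WAdd (var 26) (var 5)) (WGet lL (var 27)))
    (CWSet out (WAdd (var 26) (var 5)) (WGet lR (var 28))).

(** Real register 12 holds the total penalty of the customers scanned so far; when a point is
    reached, that total is added to its accumulator in real array 11. Ties go to the left list, that
    of the customers, so a customer exactly at its radius is counted. *)
Definition cross_code lC lP (kC kP : wexp -> rexp) : cmd :=
  CRSet 12 (WConst 0) (ROfWord (WConst 0)) ;;
  zip_loop lC lP kC kP
    (CRSet 12 (WConst 0)
       (RAdd (RGet 12 (WConst 0)) (RGet 9 (WGet lC (var 27)))))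
    (CRSet 11 (WGet lP (var 28))
       (RAdd (RGet 11 (WGet lP (var 28))) (RGet 12 (WConst 0)))).

Definition zip_time lL lR kL kR actL actR (N : nat) : nat :=
  (10 + N.+1 * (22 + ctime
    (CIf (take_left lL lR kL kR)
       (actL ;; 27 <-- WAdd (var 27) (WConst 1))
       (actR ;; 28 <-- WAdd (var 28) (WConst 1)))))%N.

Definition seg (f : nat -> nat) (a m : nat) : seq nat := [seq f j | j <- iota a m].

Lemma size_seg f a m : size (seg f a m) = m.
Proof. by rewrite size_map size_iota. Qed.

Lemma nth_seg f a m j : (j < m)%N -> nth 0%N (seg f a m) j = f (a + j)%N.
Proof. by move=> jm; rewrite (nth_map 0%N) ?size_iota // nth_iota. Qed.

Lemma drop_seg f a m j : (j < m)%N ->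
  drop j (seg f a m) = f (a + j)%N :: drop j.+1 (seg f a m).
Proof. by move=> jm; rewrite -(nth_seg _ _ jm) -drop_nth // size_seg. Qed.

Lemma eq_seg f g a m :
  (forall j, (a <= j < a + m)%N -> f j = g j) -> seg f a m = seg g a m.
Proof. by move=> fg; apply/eq_in_map => j; rewrite mem_iota; apply: fg. Qed.

Section Zip.
Variables (R : realType) (W : nat).
Implicit Types (s : state R).

Lemma same_off_trans ws rs s1 s2 s3 :
  same_off ws rs s1 s2 -> same_off ws rs s2 s3 -> same_off ws rs s1 s3.
Proof.
by move=> [w1 r1] [w2 r2]; split=> a j an; rewrite ?w2 ?r2 // ?w1 ?r1.
Qed.

Lemma same_off_sub ws rs ws' rs' s1 s2 :
  {subset ws <= ws'} -> {subset rs <= rs'} ->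
  same_off ws rs s1 s2 -> same_off ws' rs' s1 s2.
Proof.
move=> sw sr [w r]; split=> a j an.
  by apply: w; apply: contra an; apply: sw.
by apply: r; apply: contra an; apply: sr.
Qed.

Lemma same_off_upd ws rs c i x s : c \in ws ->
  same_off ws rs s (State (upd (wmem s) c i x) (rmem s)).
Proof.
move=> cin; split=> //= d j; rewrite /upd; case: eqP => //= -> /negP.
by rewrite cin.
Qed.

Lemma sexec_same c s : loopfree c -> same_off (wmods c) (rmods c) s (sexec W c s).
Proof.
move=> lf; have := @runs_loopfree R W c s (fun s' => s' = sexec W c s) lf erefl.
by case/runs_frame=> t [s' [_ _ [-> ?]]].
Qed.

(* Inv a b s : a left heads and b right heads have been taken. *)
Lemma zip_run lL lR kL kR actL actR (fL fR : nat -> R) ws rs s0 a0 na b0 nb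
    (Inv : nat -> nat -> state R -> Prop)
    (same := same_off ([:: 5; 27; 28]%N ++ ws) rs s0) :
    loopfree actL -> loopfree actR ->
    {subset wmods actL ++ wmods actR <= ws} ->
    {subset rmods actL ++ rmods actR <= rs} ->
    all (fun a => a \notin [:: 5; 27; 28; 29; 30; 32; 37; 38]%N) ws ->
    lL \notin [:: 5; 27; 28]%N ++ ws -> lR \notin [:: 5; 27; 28]%N ++ ws ->
    (a0 + na < W)%N -> (b0 + nb < W)%N -> (na + nb < W)%N ->
    (forall s e, same s -> reval W s (kL e) = fL (weval W s e)) ->
    (forall s e, same s -> reval W s (kR e) = fR (weval W s e)) ->
    [/\ wmem s0 37 0 = a0, wmem s0 38 0 = b0, wmem s0 29 0 = (a0 + na)%N,
        wmem s0 30 0 = (b0 + nb)%N & wmem s0 32 0 = (na + nb)%N] ->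
    (forall a b s s', same_off [:: 5; 27; 28]%N [::] s s' -> Inv a b s -> Inv a b s') ->
    Inv 0%N 0%N s0 ->
    (forall a b s, (a < na)%N -> (b <= nb)%N -> same s ->
       wmem s 27 0 = (a0 + a)%N -> wmem s 28 0 = (b0 + b)%N ->
       wmem s 5 0 = (a + b)%N ->
       ((b < nb)%N -> fL (wmem s0 lL (a0 + a)%N) <= fR (wmem s0 lR (b0 + b)%N)) ->
       Inv a b s -> Inv a.+1 b (sexec W actL s)) ->
    (forall a b s, (a <= na)%N -> (b < nb)%N -> same s ->
       wmem s 27 0 = (a0 + a)%N -> wmem s 28 0 = (b0 + b)%N ->
       wmem s 5 0 = (a + b)%N ->
       ((a < na)%N -> fR (wmem s0 lR (b0 + b)%N) < fL (wmem s0 lL (a0 + a)%N)) ->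
       Inv a b s -> Inv a b.+1 (sexec W actR s)) ->
  runs W (zip_loop lL lR kL kR actL actR) s0
    (zip_time lL lR kL kR actL actR (na + nb)) (Inv na nb).
Proof.
move=> lfL lfR wsS rsS wsok lLok lRok aW bW abW keyL keyR [e37 e38 e29 e30 e32].
move=> stabI I0 stepL stepR.
have W1 : (0 < W)%N by lia.
have wsN c : c \in [:: 5; 27; 28; 29; 30; 32; 37; 38]%N -> c \notin ws.
  by move=> cin; apply/negP => cws; have := allP wsok c cws; rewrite cin.
have mods act c : {subset wmods act <= ws} -> c \in [:: 5; 27; 28; 29; 30; 32; 37; 38]%N ->
    c \notin wmods act.
  by move=> sub cin; apply/negP => /sub cws; move: (wsN c cin); rewrite cws.
have wL : {subset wmods actL <= ws} by move=> x xin; apply: wsS; rewrite mem_cat xin.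
have wR : {subset wmods actR <= ws} by move=> x xin; apply: wsS; rewrite mem_cat xin orbT.
have rL : {subset rmods actL <= rs} by move=> x xin; apply: rsS; rewrite mem_cat xin.
have rR : {subset rmods actR <= rs} by move=> x xin; apply: rsS; rewrite mem_cat xin orbT.
have mem3 x : x \in [:: 5; 27; 28]%N -> x \in [:: 5; 27; 28]%N ++ ws.
  by rewrite mem_cat => ->.
have scal s c : same s -> c \in [:: 29; 30; 32]%N -> wmem s c 0 = wmem s0 c 0.
  move=> [sm _] cin; apply: sm; rewrite mem_cat negb_or wsN ?andbT.
    by move: cin; rewrite !inE => /or3P[]/eqP->.
  by move: cin; rewrite !inE => /or3P[]/eqP->.
pose J k s := [/\ same s & exists a b, [/\ (a + b = k)%N, (a <= na)%N, (b <= nb)%N &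
   [/\ wmem s 27 0 = (a0 + a)%N, wmem s 28 0 = (b0 + b)%N & Inv a b s]]].
pose s1 := sexec W (27 <-- var 37 ;; 28 <-- var 38) s0.
have s1E : s1 = State (upd (upd (wmem s0) 27 0 a0) 28 0 b0) (rmem s0).
  by rewrite /s1 /= !mod0n /upd /= e37 e38.
have same01 : same_off [:: 5; 27; 28]%N [::] s0 s1.
  rewrite s1E; split=> //= c j; rewrite /upd !inE.
  by case: (c =P 28) => [->|_] //=; case: (c =P 27) => [->|_].
have J1 : J 0%N s1.
  split; first by apply: same_off_sub same01 => // x /mem3.
  exists 0%N, 0%N; split=> //; rewrite !addn0; split; [by rewrite s1E|by rewrite s1E|].
  exact: stabI same01 I0.
have H := @runs_for_lf R W 5 (var 32) (na + nb) (CIf (take_left lL lR kL kR)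
   (actL ;; 27 <-- WAdd (var 27) (WConst 1))
   (actR ;; 28 <-- WAdd (var 28) (WConst 1))) s1 J abW _ _ _ _ _ J1.
apply: (@runs_weaken R W _ _ (4 + (4 + _))).
- apply: runs_seq; apply: (@runs_loopfree _ _ (27 <-- var 37)) => //.
  apply: runs_seq; apply: (@runs_loopfree _ _ (28 <-- var 38)) => //.
  rewrite -[sexec _ _ (sexec _ _ _)]/s1; apply: H.
  + by rewrite /= lfL lfR.
  + by rewrite /= !mem_cat !inE !negb_or !mods.
  + move=> k s x [sm [a [b [? ? ? [? ? Iab]]]]]; split.
      by apply: same_off_trans sm _; apply: same_off_upd; apply: mem3.
    exists a, b; split=> //; split=> //.
    by apply: stabI Iab; apply: same_off_upd.
  + by move=> k s _ [sm _]; rewrite /= mod0n scal.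
  + move=> k s kN s5 [sm [a [b [abk ale ble [s27 s28 Iab]]]]].
    have s29 : wmem s 29 0 = (a0 + na)%N by rewrite scal.
    have s30 : wmem s 30 0 = (b0 + nb)%N by rewrite scal.
    have rdL i : wmem s lL i = wmem s0 lL i by apply: sm.1.
    have rdR i : wmem s lR i = wmem s0 lR i by apply: sm.1.
    have tst : teval W s (take_left lL lR kL kR) = ~~ ((b < nb)%N && ~~ ((a < na)%N &&
        (fL (wmem s0 lL (a0 + a)%N) <= fR (wmem s0 lR (b0 + b)%N)))).
      rewrite /= (keyL s _ sm) (keyR s _ sm) /= !mod0n s27 s28 s29 s30 rdL rdR.
      by rewrite -!ltnNge !ltn_add2l.
    have sif t c1 c2 : sexec W (CIf t c1 c2) s =
      if teval W s t then sexec W c1 s else sexec W c2 s by [].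
    rewrite sif tst; case: ifP => /= cond.
      have aN : (a < na)%N.
        by move: cond; case: (ltnP b nb) => [bN|bN] /=; [case: (a < na)%N|clear -abk kN bN; lia].
      have smA := sexec_same s lfL.
      have sm' : same (sexec W actL s).
        apply: same_off_trans sm _; apply: same_off_sub smA => x; last by apply: rL.
        by move/wL; rewrite mem_cat orbC => ->.
      have e27 : wmem (sexec W actL s) 27 0 = (a0 + a)%N by rewrite smA.1 // mods.
      have e28 : wmem (sexec W actL s) 28 0 = (b0 + b)%N by rewrite smA.1 // mods.
      rewrite !mod0n e27 modnDmr modn_small; last by clear -aN aW; lia.
      split; first by apply: same_off_trans sm' _; apply: same_off_upd; apply: mem3.
      exists a.+1, b; split=> //; [by clear -abk; lia| split; [by rewrite /= /upd /= addn1 addnS|by []|]].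
      apply: (stabI _ _ (sexec W actL s)); first exact: same_off_upd.
      apply: stepL => //; first by rewrite s5.
      by move=> bN; move: cond; rewrite bN /= negbK aN.
    have bN : (b < nb)%N by move: cond; case: (b < nb)%N.
    have smA := sexec_same s lfR.
    have sm' : same (sexec W actR s).
      apply: same_off_trans sm _; apply: same_off_sub smA => x; last by apply: rR.
      by move/wR; rewrite mem_cat orbC => ->.
    have e27 : wmem (sexec W actR s) 27 0 = (a0 + a)%N by rewrite smA.1 // mods.
    have e28 : wmem (sexec W actR s) 28 0 = (b0 + b)%N by rewrite smA.1 // mods.
    rewrite !mod0n e28 modnDmr modn_small; last by clear -bN bW; lia.
    split; first by apply: same_off_trans sm' _; apply: same_off_upd; apply: mem3.
    exists a, b.+1; split=> //; [by clear -abk; lia| split; [by []|by rewrite /= /upd /= addn1 addnS|]].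
    apply: (stabI _ _ (sexec W actR s)); first exact: same_off_upd.
    apply: stepR => //; first by rewrite s5.
    by move=> aN; move: cond; rewrite bN aN /= negbK ltNge => ->.
- by rewrite /zip_time [wcost _]/=; move: (ctime _) => x; clear; lia.
- move=> s [_ [a [b [ab ale ble [_ _ Iab]]]]].
  by have [<- <-] : a = na /\ b = nb by clear -ab ale ble; lia.
Qed.

Definition keyle (f : nat -> R) : rel nat := fun i j => f i <= f j.

Lemma keyle_total f : total (keyle f).
Proof. by move=> i j; apply: le_total. Qed.

Lemma keyle_trans f : transitive (keyle f).
Proof. by move=> j i k; apply: le_trans. Qed.

(** The scan and [merge] both prefer the left head on ties. The invariant says that what remains of
    the result is the merge of what remains of the two lists. *)
Lemma merge_run lL lR out key (f : nat -> R) s0 a0 na b0 nb pos :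
    lL \notin [:: 5; 27; 28; out]%N -> lR \notin [:: 5; 27; 28; out]%N ->
    out \notin [:: 5; 27; 28; 29; 30; 32; 37; 38]%N -> out != 26%N ->
    (a0 + na < W)%N -> (b0 + nb < W)%N -> (pos + na + nb < W)%N ->
    (forall s e, same_off [:: 5; 27; 28; out]%N [::] s0 s ->
       reval W s (key e) = f (weval W s e)) ->
    [/\ wmem s0 37 0 = a0, wmem s0 38 0 = b0, wmem s0 29 0 = (a0 + na)%N,
        wmem s0 30 0 = (b0 + nb)%N & wmem s0 32 0 = (na + nb)%N] ->
    wmem s0 26 0 = pos ->
  runs W (merge_code lL lR out key) s0
    (zip_time lL lR key key
    (CWSet out (WAdd (var 26) (var 5)) (WGet lL (var 27)))
    (CWSet out (WAdd (var 26) (var 5)) (WGet lR (var 28))) (na + nb))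
    (fun s => seg (wmem s out) pos (na + nb) =
       merge (keyle f) (seg (wmem s0 lL) a0 na) (seg (wmem s0 lR) b0 nb) /\
       forall j, (j < pos)%N -> wmem s out j = wmem s0 out j).
Proof.
move=> lLb lRb ob o26 aW bW pW keyf regs e26.
set sL := seg _ a0 na; set sR := seg _ b0 nb; set M := merge _ sL sR.
have szM : size M = (na + nb)%N by rewrite size_merge size_cat !size_seg.
pose Inv a b s := [/\ drop (a + b) M = merge (keyle f) (drop a sL) (drop b sR),
  forall j, (j < a + b)%N -> wmem s out (pos + j) = nth 0%N M j,
  forall j, (j < pos)%N -> wmem s out j = wmem s0 out j & wmem s 26 0 = pos].
apply: (@runs_weaken _ _ _ _ _ _ (Inv na nb)) (leqnn _) _; last first.
  move=> s [_ h1 h2 _]; split=> //; apply: (@eq_from_nth _ 0%N).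
    by rewrite size_seg szM.
  by move=> j; rewrite size_seg => jb; rewrite nth_seg // h1.
have o5 : out \notin [:: 5; 27; 28]%N.
  by apply: contra ob; rewrite !inE => /or3P[] ->; rewrite ?orbT.
apply: (@zip_run _ _ _ _ _ _ f f [:: out] [::] s0 a0 na b0 nb) => //.
- by move=> x; rewrite !inE /= orbb.
- by rewrite /= ob.
- by clear -pW; lia.
- move=> a b s s' [sm _] [i1 i2 i3 i4]; split=> // [j jb|j jb|].
  + by rewrite sm ?i2.
  + by rewrite sm ?i3.
  + by rewrite sm ?i4.
- by split=> //; rewrite !drop0.
- move=> a b s aN bN sm s27 s28 s5 cmp [i1 i2 i3 i4].
  have rd i : wmem s lL i = wmem s0 lL i by apply: sm.1.
  rewrite /= !mod0n s27 rd i4 s5 modn_small; last by clear -aN bN pW; lia.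
  have sLE : drop a sL = wmem s0 lL (a0 + a) :: drop a.+1 sL by apply: drop_seg.
  have MD : drop (a + b) M = wmem s0 lL (a0 + a) :: merge (keyle f) (drop a.+1 sL) (drop b sR).
    rewrite i1 sLE; case: (ltnP b nb) => bn.
      by rewrite (drop_seg (wmem s0 lR) b0 bn) /= /keyle cmp.
    by rewrite (@drop_oversize _ b) ?size_seg //=; case: (drop _ _).
  split.
  + by rewrite addSn -[(a + b).+1]addn1 addnC -drop_drop MD /= drop0.
  + move=> j; rewrite addSn ltnS leq_eqVlt /= /upd eqxx eqn_add2l /=.
    case: eqP => [->|_] /=; last by apply: i2.
    by rewrite -[(a + b)%N in RHS]addn0 -nth_drop MD.
  + by move=> j jp; rewrite /= /upd eqxx /= ltn_eqF ?i3 //; clear -jp; lia.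
  + by rewrite /= /upd eq_sym (negbTE o26).
- move=> a b s aN bN sm s27 s28 s5 cmp [i1 i2 i3 i4].
  have rd i : wmem s lR i = wmem s0 lR i by apply: sm.1.
  rewrite /= !mod0n s28 rd i4 s5 modn_small; last by clear -aN bN pW; lia.
  have sRE : drop b sR = wmem s0 lR (b0 + b) :: drop b.+1 sR by apply: drop_seg.
  have MD : drop (a + b) M = wmem s0 lR (b0 + b) :: merge (keyle f) (drop a sL) (drop b.+1 sR).
    rewrite i1 sRE; case: (ltnP a na) => an.
      by rewrite (drop_seg (wmem s0 lL) a0 an) /= /keyle leNgt cmp.
    by rewrite (@drop_oversize _ a) ?size_seg.
  split.
  + by rewrite addnS -[(a + b).+1]addn1 addnC -drop_drop MD /= drop0.
  + move=> j; rewrite addnS ltnS leq_eqVlt /= /upd eqxx eqn_add2l /=.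
    case: eqP => [->|_] /=; last by apply: i2.
    by rewrite -[(a + b)%N in RHS]addn0 -nth_drop MD.
  + by move=> j jp; rewrite /= /upd eqxx /= ltn_eqF ?i3 //; clear -jp; lia.
  + by rewrite /= /upd eq_sym (negbTE o26).
Qed.

(** Both lists being sorted, the customers passed before a point are exactly those with a key at
    most its own, so the running total is the sum it must receive. Third clause of the invariant:
    customers already passed stay below all the points to come. *)
Lemma cross_run lC lP kC kP (fC fP : nat -> R) s0 a0 na b0 nb :
    lC \notin [:: 5; 27; 28]%N -> lP \notin [:: 5; 27; 28]%N ->
    (a0 + na < W)%N -> (b0 + nb < W)%N -> (na + nb < W)%N ->
    (forall s e, same_off [:: 5; 27; 28]%N [:: 12; 11]%N s0 s ->
       reval W s (kC e) = fC (weval W s e)) ->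
    (forall s e, same_off [:: 5; 27; 28]%N [:: 12; 11]%N s0 s ->
       reval W s (kP e) = fP (weval W s e)) ->
    [/\ wmem s0 37 0 = a0, wmem s0 38 0 = b0, wmem s0 29 0 = (a0 + na)%N,
        wmem s0 30 0 = (b0 + nb)%N & wmem s0 32 0 = (na + nb)%N] ->
    let sC := seg (wmem s0 lC) a0 na in let sP := seg (wmem s0 lP) b0 nb in
    sorted (keyle fC) sC -> sorted (keyle fP) sP -> uniq sP ->
  runs W (cross_code lC lP kC kP) s0
    (4 + zip_time lC lP kC kP
    (CRSet 12 (WConst 0)
       (RAdd (RGet 12 (WConst 0)) (RGet 9 (WGet lC (var 27)))))
    (CRSet 11 (WGet lP (var 28))
       (RAdd (RGet 11 (WGet lP (var 28))) (RGet 12 (WConst 0)))) (na + nb))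
    (fun s => forall i, rmem s 11 i = rmem s0 11 i +
       if i \in sP then \sum_(j <- sC | fC j <= fP i) rmem s0 9 j else 0).
Proof.
move=> lCb lPb aW bW abW kCf kPf regs sC sP sortC sortP uniqP.
apply: runs_seq; apply: runs_loopfree => //=; rewrite mod0n.
set s1 := State _ _.
have sm01 : same_off [:: 5; 27; 28]%N [:: 12; 11]%N s0 s1.
  split=> //= c j; rewrite /upd; by case: (c =P 12) => [->|].
pose Inv a b s := [/\ rmem s 12 0 = \sum_(j <- take a sC) rmem s0 9 j,
  forall i, rmem s 11 i = rmem s0 11 i +
       (if i \in take b sP then \sum_(j <- sC | fC j <= fP i) rmem s0 9 j else 0) &
  {in take a sC & drop b sP, forall j i, fC j <= fP i}].
apply: (@runs_weaken _ _ _ _ _ _ (Inv na nb)) (leqnn _) _; last first.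
  by move=> s [_ h _] i; rewrite h take_oversize // size_seg.
apply: (@zip_run _ _ _ _ _ _ fC fP [::] [:: 12; 11]%N s1 a0 na b0 nb) => //.
- by move=> s e sm; apply: kCf; apply: same_off_trans sm01 sm.
- by move=> s e sm; apply: kPf; apply: same_off_trans sm01 sm.
- move=> a b s s' [_ sm] [i1 i2 i3]; split=> //; first by rewrite sm.
  by move=> i; rewrite sm.
- rewrite /Inv !take0 big_nil; split=> //.
  by move=> i; rewrite addr0.
- move=> a b s aN bN sm s27 s28 s5 cmp [i1 i2 i3].
  have rd i : wmem s lC i = wmem s0 lC i by apply: sm.1.
  have r9 i : rmem s 9 i = rmem s0 9 i by apply: sm.2.
  have tkE : take a.+1 sC = rcons (take a sC) (wmem s0 lC (a0 + a)).
    by rewrite (take_nth 0%N) ?size_seg // nth_seg.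
  split.
  + by rewrite /= /upd /= !mod0n s27 rd r9 i1 tkE -cats1 big_cat big_seq1.
  + by move=> i; rewrite /= /upd /=.
  + move=> j i; rewrite tkE mem_rcons inE => /predU1P[->|jin]; last by apply: i3.
    case: (ltnP b nb) => bn; last by rewrite drop_oversize ?size_seg.
    have := drop_sorted b sortP; rewrite (drop_seg (wmem s0 lP) b0 bn) /= => srt.
    have := order_path_min (@keyle_trans fP) srt => /allP mn.
    rewrite inE => /predU1P[->|iin]; first exact: cmp.
    exact: le_trans (cmp bn) (mn _ iin).
- move=> a b s aN bN sm s27 s28 s5 cmp [i1 i2 i3].
  have rd i : wmem s lP i = wmem s0 lP i by apply: sm.1.
  set x := wmem s0 lP (b0 + b).
  have tkE : take b.+1 sP = rcons (take b sP) x.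
    by rewrite (take_nth 0%N) ?size_seg // nth_seg.
  have dpE : drop b sP = x :: drop b.+1 sP by apply: drop_seg.
  have xN : x \notin take b sP.
    by have := take_uniq b.+1 uniqP; rewrite tkE rcons_uniq => /andP[].
  split.
  + by rewrite /= /upd.
  + move=> i; rewrite /= /upd /= !mod0n s28 rd -/x i1 tkE mem_rcons inE !i2.
    case: eqP => [->|//]; rewrite (negbTE xN) addr0; congr (_ + _).
    rewrite -[sC in RHS](cat_take_drop a) big_cat /=.
    (* A customer still waiting has a key above that of the point just taken, because the head of
       its list lost the comparison and the list is sorted. *)
    rewrite [X in _ = _ + X]big_seq_cond [X in _ = _ + X]big1 => [|j /andP[jin]].
      rewrite addr0 big_seq_cond [RHS]big_seq_cond; apply: eq_bigl => j.
      by case: (boolP (j \in _)) => //= jin; rewrite i3 // dpE mem_head.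
    case: (ltnP a na) => an; last by move: jin; rewrite drop_oversize ?size_seg.
    have := drop_sorted a sortC; rewrite (drop_seg (wmem s0 lC) a0 an) /= => srt.
    have := order_path_min (@keyle_trans fC) srt => /allP mn.
    have lt := cmp an; rewrite leNgt.
    move: jin; rewrite (drop_seg (wmem s0 lC) a0 an) inE => /predU1P[->|jin]; first by rewrite lt.
    by rewrite (lt_le_trans lt (mn _ jin)).
  + by move=> j i jin iin; apply: i3 => //; rewrite dpE inE iin orbT.
Qed.

End Zip.

(** * Contraction of a cluster tree *)

Section Contraction.
Variables (R : realType) (K : nat) (delta : nat -> nat -> R).
Variables (dep tdep pi rho : nat -> R) (rk : nat -> nat).
Hypothesis delta_sym : forall i j, (i < K)%N -> (j < K)%N -> delta i j = delta j i.

Definition cluster (rep : nat -> nat) (k : nat) : seq nat :=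
  [seq i <- iota 0 K | rep i == k].

Definition live (rep : nat -> nat) (k : nat) : bool := (0 < size (cluster rep k))%N.

Lemma liveE rep k : live rep k = (0 < size (cluster rep k))%N.
Proof. by []. Qed.

Definition lives (rep : nat -> nat) : seq nat := [seq k <- iota 0 K | live rep k].

Definition kids (rep par : nat -> nat) (k : nat) : seq nat :=
  [seq c <- lives rep | (c != 0%N) && (par c == k)].

Definition nkids rep par k : nat := size (kids rep par k).

Definition above (par : nat -> nat) (A C : nat) : Prop := exists m, iter m par C = A.

(** Across clusters [delta] splits into a term for each item: [kb] looks down from an item of the
    upper cluster, [dep] looks up from an item of the lower one, and two items on sibling branches
    meet at depth [tdep]. The strictly decreasing [rk] excludes cycles of parents. [acc] counts the
    customers of the item's own cluster only; once a single cluster is left it is the complete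
    sum. *)
Record contraction_inv (rep par : nat -> nat) (kb acc : nat -> R) : Prop := {
  ci_rep : forall i, (i < K)%N -> (rep i < K)%N;
  ci_live0 : live rep 0;
  ci_par0 : par 0%N = 0%N;
  ci_par : forall k, (k < K)%N -> k != 0%N -> live rep k ->
    [/\ (par k < K)%N, live rep (par k) & (rk (par k) < rk k)%N];
  ci_kids : forall k, (k < K)%N -> (nkids rep par k <= 2)%N;
  ci_below : forall a b, (a < K)%N -> (b < K)%N -> above par (rep a) (rep b) ->
    rep a != rep b -> delta a b = kb a + dep b;
  ci_siblings : forall B B' a b, (B < K)%N -> (B' < K)%N -> live rep B -> live rep B' ->
    B != 0%N -> B' != 0%N -> B != B' -> par B = par B' ->
    (a < K)%N -> (b < K)%N -> above par B (rep a) -> above par B' (rep b) ->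
    delta a b = dep a + dep b - 2 * tdep B;
  ci_acc : forall i, (i < K)%N ->
    acc i = \sum_(j <- iota 0 K | rep j == rep i) (if delta i j <= rho j then pi j else 0) }.

Definition mergeable rep par k : bool :=
  (nkids rep par k == 0)%N || ((nkids rep par k == 1)%N && (nkids rep par (par k) == 1)%N).

(* fl k = 2 : k is absorbed by its parent; fl k = 1 : k absorbs its child mate k. *)
Record matching (rep par fl mate : nat -> nat) : Prop := {
  mt_absorbed : forall k, (k < K)%N -> fl k = 2 ->
    [/\ k != 0%N, live rep k, fl (par k) = 1%N, mate (par k) = k & mergeable rep par k];
  mt_absorbing : forall k, (k < K)%N -> fl k = 1%N ->
    [/\ live rep k, (mate k < K)%N, fl (mate k) = 2 & par (mate k) = k];
  mt_values : forall k, (k < K)%N -> (fl k <= 2)%N;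
  mt_maximal : forall k, (k < K)%N -> k != 0%N -> live rep k -> mergeable rep par k ->
    (fl k != 0%N) || (fl (par k) != 0%N) }.

Lemma mem_lives rep k : (k \in lives rep) = (k < K)%N && live rep k.
Proof. by rewrite mem_filter mem_iota /= add0n andbC. Qed.

Lemma mem_cluster rep k i : (i \in cluster rep k) = (i < K)%N && (rep i == k).
Proof. by rewrite mem_filter mem_iota /= add0n andbC. Qed.

Lemma liveP rep k : reflect (exists2 i, (i < K)%N & rep i = k) (live rep k).
Proof.
rewrite /live -has_predT; apply: (iffP hasP) => [[i]|[i iK ri]].
  by rewrite mem_cluster => /andP[iK /eqP ri] _; exists i.
by exists i => //; rewrite mem_cluster iK ri eqxx.
Qed.

Lemma lives_uniq rep : uniq (lives rep).
Proof. by rewrite filter_uniq ?iota_uniq. Qed.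

Section Round.
Variables (rep par fl mate : nat -> nat) (kb acc : nat -> R).
Hypothesis ci : contraction_inv rep par kb acc.
Hypothesis mt : matching rep par fl mate.

Definition rep' i := if fl (rep i) == 2 then par (rep i) else rep i.
Definition par' k := if fl (par k) == 2 then par (par k) else par k.
(** Nothing hangs below a leaf, so its lower keys carry no information. Once it is absorbed, its
    items see what remains below its parent through its attachment point, at depth [tdep (rep i)],
    whence the formula for siblings. *)
Definition kb' i :=
  if (fl (rep i) == 2) && (nkids rep par (rep i) == 0)%N then dep i - 2 * tdep (rep i)
  else kb i.
(** The conditions are [delta i j <= rho j] with the customer's terms moved to one side and the
    point's to the other: this is the comparison of keys made by the scan. *)
Definition acc' i :=
  acc i + if fl (rep i) == 2 then
            \sum_(j <- cluster rep (par (rep i)) | kb j - rho j <= - dep i) pi j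
          else if fl (rep i) == 1%N then
            \sum_(j <- cluster rep (mate (rep i)) | dep j - rho j <= - kb i) pi j
          else 0.

Let above_refl A : above par A A. Proof. by exists 0%N. Qed.

Let above_trans B A C : above par A B -> above par B C -> above par A C.
Proof. by move=> [m <-] [k <-]; exists (m + k)%N; rewrite iterD. Qed.

Let above_par A : above par (par A) A. Proof. by exists 1%N. Qed.

Let above_par' A C : above par' A C -> above par A C.
Proof.
case=> m <-; elim: m => [|m IH] /=; first exact: above_refl.
apply: above_trans IH; rewrite {1}/par'; case: ifP => _; last exact: above_par.
by apply: above_trans (above_par _) (above_par _).
Qed.

Let above_rep' i : above par (rep' i) (rep i).
Proof. by rewrite /rep'; case: ifP => _; [apply: above_par|apply: above_refl]. Qed.

Let live_lt k : live rep k -> (k < K)%N.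
Proof. by case/liveP=> i iK <-; apply: ci_rep ci _ iK. Qed.

Let live_rep i : (i < K)%N -> live rep (rep i).
Proof. by move=> iK; apply/liveP; exists i. Qed.

Let live_par k : live rep k -> live rep (par k).
Proof.
move=> lk; have [->|k0] := eqVneq k 0%N; first by rewrite (ci_par0 ci) (ci_live0 ci).
by have [] := ci_par ci (live_lt lk) k0 lk.
Qed.

Let live_iter m k : live rep k -> live rep (iter m par k).
Proof. by move=> lk; elim: m => //= m; apply: live_par. Qed.

Let mem_kids c k : (c \in kids rep par k) = [&& live rep c, c != 0%N & par c == k].
Proof.
rewrite mem_filter mem_lives andbC; case lc: (live rep c); rewrite ?andbF //.
by rewrite live_lt.
Qed.

Let above_kid A C : live rep C -> above par A C -> A != C ->
  exists2 B, B \in kids rep par A & above par B C.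
Proof.
move=> lC [m mA] AC.
elim: m mA => [mA|m IH mA]; first by rewrite -mA eqxx in AC.
have [mA'|mA'] := eqVneq (iter m par C) A; first exact: IH.
exists (iter m par C); last by exists m.
rewrite mem_kids live_iter //= -mA /= eqxx andbT.
by apply: contra mA' => /eqP z; rewrite -mA /= z (ci_par0 ci).
Qed.

Let rep'K i : (i < K)%N -> (rep' i < K)%N.
Proof.
move=> iK; rewrite /rep'; case: ifP => _; last exact: (ci_rep ci iK).
by apply/live_lt/live_par/live_rep.
Qed.

Let live' k : (k < K)%N -> live rep' k = live rep k && (fl k != 2).
Proof.
move=> kK; apply/liveP/andP => [[i iK <-]|[/liveP[i iK ik] fk]].
  rewrite /rep'; case: eqP => f2; last by split; [apply: live_rep|apply/eqP].
  have [_ lr f1 _ _] := mt_absorbed mt (ci_rep ci iK) f2.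
  by rewrite f1; split=> //; apply/live_par/live_rep.
by exists i => //; rewrite /rep' ik (negbTE fk).
Qed.

Let absorbed_uniq B B' : (B < K)%N -> (B' < K)%N -> fl B = 2 -> fl B' = 2 ->
  par B = par B' -> B = B'.
Proof.
move=> bK bK' f f' e; have [_ _ _ m _] := mt_absorbed mt bK f.
by have [_ _ _ m' _] := mt_absorbed mt bK' f'; rewrite -m -m' e.
Qed.

Let only_kid A B C : B \in kids rep par A -> C \in kids rep par A ->
  nkids rep par A = 1%N -> B = C.
Proof.
rewrite /nkids; case: (kids _ _ _) => [|x [|]] //.
by rewrite !inE => /eqP-> /eqP->.
Qed.

(** New children differ from old ones only if some absorbed child B of k had a child. Then B is not
    a leaf, so B is the only child of k and has an only child: the children of B replace those of k.
    Otherwise every new child was a child before. *)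
Let round_kids k : (k < K)%N -> (nkids rep' par' k <= 2)%N.
Proof.
move=> kK.
have unq r p j : uniq (kids r p j) by rewrite filter_uniq ?lives_uniq.
have kidsE c : c \in kids rep' par' k ->
    [/\ live rep c, c != 0%N, (c < K)%N, fl c != 2 & par' c = k].
  rewrite mem_filter mem_lives => /andP[/andP[c0 /eqP pc] /andP[cK]].
  by rewrite live' // => /andP[].
case: (boolP (has (fun c => fl (par c) == 2) (kids rep' par' k))) => [/hasP|/hasPn] h.
  have [c /kidsE[lc c0 cK fc pck] /eqP fB] := h.
  set B := par c in fB; have BK : (B < K)%N by apply/live_lt/live_par.
  have pB : par B = k by rewrite -pck /par' -/B fB eqxx.
  have [B0 lB fk _ mg] := mt_absorbed mt BK fB.
  have cB : c \in kids rep par B by rewrite mem_kids lc c0 /=.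
  have /andP[/eqP nB /eqP nA] : (nkids rep par B == 1)%N && (nkids rep par k == 1)%N.
    move: mg; rewrite /mergeable pB; case: eqP => // nB0.
    by move: cB; rewrite /nkids in nB0; rewrite (size0nil nB0).
  apply: leq_trans (_ : nkids rep par B <= 2)%N; last by rewrite nB.
  apply: uniq_leq_size (unq _ _ _) _ => d /kidsE[ld d0 dK fd pd].
  rewrite mem_kids ld d0 /=; move: pd; rewrite /par'; case: eqP => fD pd.
    by apply/eqP/absorbed_uniq => //; [apply/live_lt/live_par|rewrite pd].
  have : d = B.
    by apply: (@only_kid k) => //; rewrite mem_kids ?ld ?d0 ?lB ?B0 /= ?pd ?pB.
  by move=> dB; rewrite dB fB in fd.
apply: leq_trans (ci_kids ci kK); apply: uniq_leq_size (unq _ _ _) _ => d din.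
have [ld d0 dK fd pd] := kidsE d din.
by rewrite mem_kids ld d0 /= -pd /par' (negbTE (h d din)).
Qed.

(** Only an item a of an absorbed cluster B needs an argument. If B is a leaf, b lies below another
    child of the parent of B, and the sibling formula applies. If B is an only child, b lies below B
    itself, and the old key is still right. *)
Let round_below a b : (a < K)%N -> (b < K)%N -> above par' (rep' a) (rep' b) ->
  rep' a != rep' b -> delta a b = kb' a + dep b.
Proof.
move=> aK bK /above_par' ab0; have ab := above_trans ab0 (above_rep' b).
rewrite {1}/rep' in ab *; rewrite {}/rep' in ab0 *; rewrite /kb'.
have [f2|f2] := eqVneq (fl (rep a)) 2; rewrite ?f2 ?eqxx ?(negbTE f2) /= in ab ab0 *; last first.
  move=> ne; apply: (ci_below ci) => //; apply: contra ne => /eqP e.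
  by rewrite -e (negbTE f2).
have [a0 la f1 m mg] := mt_absorbed mt (ci_rep ci aK) f2.
move: ab; set A := par _; set B := rep a => ab ne.
have nA : A != rep b.
  by apply: contra ne => /eqP e; rewrite -e -/A f1.
have nB : B != rep b.
  by apply: contra ne => /eqP e; rewrite -e f2.
have [C Cin Cb] := above_kid (live_rep bK) ab nA.
have Bin : B \in kids rep par A by rewrite mem_kids la a0 /=.
move: mg; rewrite /mergeable -/A -/B; case: eqP => [n0 _|_ /= /andP[/eqP n1 /eqP n2]].
  have CB : B != C.
    apply/eqP => e; rewrite -e in Cb; have [D] := above_kid (live_rep bK) Cb nB.
    by rewrite (size0nil n0).
  move: Cin; rewrite mem_kids => /and3P[lC C0 /eqP pC].
  have -> : delta a b = dep a + dep b - 2 * tdep B; last by rewrite addrAC.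
  apply: (ci_siblings ci (B' := C)) => //; rewrite ?live_lt ?pC //; exact: above_refl.
apply: (ci_below ci) => //; have := @only_kid A B C Bin Cin n2.
by move=> BC; rewrite -/B BC.
Qed.

(** Clusters that are siblings after the round were siblings before. Otherwise one of them is a
    child of an absorbed cluster whose parent is the parent of the other; that absorbed cluster is
    an only child, hence equals the other sibling, which has not been absorbed. *)
Let round_siblings B B' a b : (B < K)%N -> (B' < K)%N -> live rep' B -> live rep' B' ->
    B != 0%N -> B' != 0%N -> B != B' -> par' B = par' B' ->
    (a < K)%N -> (b < K)%N -> above par' B (rep' a) -> above par' B' (rep' b) ->
    delta a b = dep a + dep b - 2 * tdep B.
Proof.
move=> BK BK'; rewrite !live' // => /andP[lB fB] /andP[lB' fB'] B0 B0' ne pe aK bK.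
move=> /above_par' ha /above_par' hb.
have key C C' : live rep C -> live rep C' -> C != 0%N -> C' != 0%N -> fl C' != 2 ->
    fl (par C) = 2 -> par (par C) = par C' -> False.
  move=> lC lC' C0 C0' fC' f e.
  have DK : (par C < K)%N by apply/live_lt/live_par.
  have [D0 lD _ _] := mt_absorbed mt DK f.
  have Cin : C \in kids rep par (par C) by rewrite mem_kids lC C0 /=.
  rewrite /mergeable; case: eqP => [n0 _|_ /= /andP[_ /eqP n1]].
    by move: Cin; rewrite (size0nil n0).
  have : par C = C'.
    by apply: (@only_kid (par (par C))) => //; rewrite mem_kids ?lD ?D0 ?lC' ?C0' /= ?e.
  by move=> dC; rewrite -dC f in fC'.
have pe' : par B = par B'.
  move: pe; rewrite /par'; case: eqP => f; case: eqP => f' // pe.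
  - by apply: absorbed_uniq => //; apply/live_lt/live_par.
  - by case: (key B B').
  - by case: (key B' B).
apply: (ci_siblings ci (B' := B')) => //.
  exact: above_trans ha (above_rep' a).
exact: above_trans hb (above_rep' b).
Qed.

(** A new cluster is the disjoint union of at most two old ones, one the parent of the other. The
    old [acc] covers the item's own half, and [ci_below] turns the coverage conditions across the
    pair into comparisons of keys. *)
Let round_acc i : (i < K)%N ->
  acc' i = \sum_(j <- iota 0 K | rep' j == rep' i) (if delta i j <= rho j then pi j else 0).
Proof.
move=> iK; rewrite /acc' (ci_acc ci iK).
have clE P k : \sum_(j <- cluster rep k | P j) pi j =
    \sum_(j <- iota 0 K | rep j == k) (if P j then pi j else 0).
  by rewrite /cluster big_filter_cond big_mkcondr.
have split2 A B : A != B ->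
    (forall j, (j < K)%N -> (rep' j == A) = (rep j == A) || (rep j == B)) ->
    forall F : nat -> R, \sum_(j <- iota 0 K | rep' j == A) F j =
      \sum_(j <- iota 0 K | rep j == A) F j + \sum_(j <- iota 0 K | rep j == B) F j.
  move=> AB h F; rewrite [X in _ = X + _]big_mkcond [X in _ = _ + X]big_mkcond.
  rewrite [LHS]big_mkcond -big_split; apply: eq_big_seq => j.
  rewrite mem_iota /= add0n => jK; rewrite h //.
  have [->|_] /= := eqVneq (rep j) A; first by rewrite (negbTE AB) addr0.
  by rewrite add0r.
have pairE B : (B < K)%N -> fl B = 2 -> forall j, (j < K)%N ->
    (rep' j == par B) = (rep j == par B) || (rep j == B).
  move=> BK fB j jK; have [_ lB fA mA _] := mt_absorbed mt BK fB.
  rewrite /rep'; case: (fl (rep j) =P 2) => fj.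
    have [e|ne] := eqVneq (rep j) (par B); first by rewrite e fA in fj.
    apply/eqP/eqP => [e|-> //]; by apply: absorbed_uniq => //; apply: (ci_rep ci).
  by have [e|] := eqVneq (rep j) B; rewrite ?orbF //; rewrite e fB in fj.
have parNE B : (B < K)%N -> fl B = 2 -> par B != B.
  move=> BK fB; have [B0 lB _ _ _] := mt_absorbed mt BK fB.
  by have [_ _] := ci_par ci BK B0 lB; apply: contraTneq => ->; rewrite ltnn.
have eqF A (F G : nat -> R) : (forall j, (j < K)%N -> rep j = A -> F j = G j) ->
    \sum_(j <- iota 0 K | rep j == A) F j = \sum_(j <- iota 0 K | rep j == A) G j.
  move=> h; rewrite big_seq_cond [RHS]big_seq_cond; apply: eq_bigr => j.
  by rewrite mem_iota /= add0n => /andP[jK /eqP]; apply: h.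
have rK := ci_rep ci iK.
have [f2|f2] := eqVneq (fl (rep i)) 2.
  have -> : rep' i = par (rep i) by rewrite /rep' f2.
  rewrite (split2 _ (rep i)) ?parNE //; last exact: pairE.
  rewrite clE addrC; congr (_ + _); apply: eqF => j jK rj.
  rewrite delta_sym // (ci_below ci jK iK).
  - by congr (if _ then _ else _); apply/idP/idP; lra.
  - by rewrite rj; apply: above_par.
  - by rewrite rj parNE.
have -> : rep' i = rep i by rewrite /rep' (negbTE f2).
have [f1|f1] := eqVneq (fl (rep i)) 1%N.
  have [_ mK fm pm] := mt_absorbing mt rK f1.
  rewrite (split2 _ (mate (rep i))); last first.
  - by move=> j jK; rewrite -{1 2}pm pairE.
  - by rewrite -{1}pm parNE.
  rewrite clE; congr (_ + _); apply: eqF => j jK rj.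
  rewrite (ci_below ci iK jK).
  - by congr (if _ then _ else _); apply/idP/idP; lra.
  - by rewrite rj -{1}pm; apply: above_par.
  - by rewrite rj -{1}pm parNE.
rewrite addr0 big_seq_cond [RHS]big_seq_cond; apply: eq_bigl => j.
rewrite mem_iota /= add0n; case: (ltnP j K) => //= jK.
rewrite {1}/rep'; case: (fl (rep j) =P 2) => // fj.
have [_ _ fp _ _] := mt_absorbed mt (ci_rep ci jK) fj.
rewrite [RHS]negbTE; last by apply: contraNneq f1 => <-; rewrite fp.
by apply: contraNF f2 => /eqP <-; rewrite fj.
Qed.

Lemma contraction_round : contraction_inv rep' par' kb' acc'.
Proof.
have f0 : fl 0%N != 2.
  apply/eqP => f; have [] := mt_absorbed mt (live_lt (ci_live0 ci)) f.
  by rewrite eqxx.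
split=> //.
- by rewrite live' ?f0 ?andbT ?live_lt ?(ci_live0 ci).
- by rewrite /par' (ci_par0 ci) (negbTE f0).
- move=> k kK k0; rewrite live' // => /andP[lk fk].
  have [pK lp rp] := ci_par ci kK k0 lk.
  rewrite /par'; case: (fl (par k) =P 2) => [f2|/eqP f2]; last by split; rewrite ?live' ?lp.
  have [p0 _ f1 _ _] := mt_absorbed mt pK f2.
  have [ppK lpp rpp] := ci_par ci pK p0 lp.
  by split; rewrite ?live' ?lpp ?f1 //; apply: ltn_trans rpp rp.
Qed.

Lemma live_round k : (k < K)%N -> live rep' k = live rep k && (fl k != 2).
Proof. exact: live'. Qed.

Lemma size_lives_round :
  size (lives rep) = (size (lives rep') + count (fun k => fl k == 2) (lives rep))%N.
Proof.
rewrite addnC -(count_predC (fun k => fl k == 2)); congr (_ + _)%N.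
rewrite /lives -size_filter -filter_predI; congr size; apply: eq_in_filter => k.
by rewrite mem_iota /= add0n => kK; rewrite live_round // andbC.
Qed.

(* Summing 1 <= [mergeable c] + [c has two kids] + [par c has two kids] over the
   nodes other than the root, together with #leaves = #binary + 1, bounds the
   number of mergeable nodes from below; maximality bounds it from above. *)
Lemma many_merges :
  (size (lives rep) <= (24 * count (fun k => fl k == 2) (lives rep)).+1)%N.
Proof.
set L := lives rep; set M := count _ _.
have LK k : k \in L -> (k < K)%N by rewrite mem_lives => /andP[].
have Llive k : k \in L -> live rep k by rewrite mem_lives => /andP[].
have Lpar k : k \in L -> par k \in L.
  by move=> /Llive lk; rewrite mem_lives live_lt ?live_par.
have sum_par (f : nat -> nat) : (\sum_(k <- L) nkids rep par k * f k =
    \sum_(c <- L | c != 0) f (par c))%N.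
  rewrite (eq_bigr (fun k => \sum_(c <- L | (c != 0%N) && (par c == k)) f (par c))%N).
    rewrite (exchange_big_dep (fun c => c != 0%N)) /=; last by move=> k c _ /andP[].
    rewrite big_seq_cond [RHS]big_seq_cond; apply: eq_bigr => c /andP[cL c0].
    rewrite (eq_bigl (fun k => k == par c)); last by move=> k; rewrite c0 eq_sym.
    by rewrite -big_filter filter_pred1_uniq ?lives_uniq ?Lpar // big_seq1.
  move=> k _; rewrite /nkids /kids size_filter -sum1_count big_distrl /=.
  by apply: eq_bigr => c /andP[_ /eqP ->]; rewrite mul1n.
have x2 k : k \in L -> (nkids rep par k <= 2)%N by move=> /LK; apply: ci_kids ci _.
have xpar c : c \in L -> c != 0%N -> (0 < nkids rep par (par c))%N.
  move=> cL c0; rewrite /nkids -has_predT; apply/hasP; exists c => //.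
  by rewrite mem_kids Llive ?c0 /=.
pose N2 := (\sum_(k <- L) (nkids rep par k == 2))%N.
pose N0 := (\sum_(k <- L) (nkids rep par k == 0))%N.
pose E := (\sum_(c <- L | c != 0%N) mergeable rep par c)%N.
pose F := (\sum_(k <- L) (fl k != 0%N))%N.
have L0 : 0%N \in L by rewrite mem_lives (ci_live0 ci) live_lt ?(ci_live0 ci).
have Lnz : (size L = (\sum_(c <- L | c != 0%N) 1).+1)%N.
  by rewrite -sum1_size (bigD1_seq 0%N) ?lives_uniq //= add1n.
have h1 : (size L + N2 = (\sum_(c <- L | c != 0%N) 1) + N0)%N.
  rewrite -(sum_par (fun=> 1%N)) -sum1_size -!big_split /=; apply: eq_big_seq => k kL.
  by have := x2 k kL; case: (nkids _ _ _) => [|[|[|]]].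
have h2 : (\sum_(c <- L | c != 0%N) 1 <= E + (N2 + 2 * N2))%N.
  have -> : (2 * N2 = \sum_(c <- L | c != 0%N) (nkids rep par (par c) == 2))%N.
    rewrite -(sum_par (fun k => (nkids rep par k == 2) : nat)) big_distrr /=.
    by apply: eq_bigr => k _; case: eqP => [->|]; rewrite ?muln0.
  apply: (@leq_trans (E + (\sum_(c <- L | c != 0%N) (nkids rep par c == 2) +
      \sum_(c <- L | c != 0%N) (nkids rep par (par c) == 2)))).
    rewrite -!big_split /= big_seq_cond [X in (_ <= X)%N]big_seq_cond.
    apply: leq_sum => c /andP[cL c0]; have := x2 _ cL; have := xpar _ cL c0.
    have := x2 _ (Lpar _ cL); rewrite /mergeable.
    by case: (nkids _ _ _) => [|[|[|]]] //; case: (nkids _ _ _) => [|[|[|]]].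
  rewrite leq_add2l leq_add2r /N2 [X in (_ <= X)%N](bigID (fun c => c != 0%N)) /=.
  exact: leq_addr.
have h3 : (N0 <= E.+1)%N.
  rewrite /N0 (bigD1_seq 0%N) ?lives_uniq //= -add1n leq_add //; first by case: eqP.
  by apply: leq_sum => c _; rewrite /mergeable; case: eqP.
have h4 : (E <= F + 2 * F)%N.
  apply: (@leq_trans (\sum_(c <- L | c != 0%N) (fl c != 0%N) +
      \sum_(c <- L | c != 0%N) (fl (par c) != 0%N))).
    rewrite /E -big_split /= big_seq_cond [X in (_ <= X)%N]big_seq_cond.
    apply: leq_sum => c /andP[cL c0]; case mg: (mergeable _ _ _) => //.
    have := mt_maximal mt (LK _ cL) c0 (Llive _ cL) mg.
    by case: (fl c != 0%N) => //= ->.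
  rewrite -(sum_par (fun k => (fl k != 0%N) : nat)) leq_add //.
    rewrite /F [X in (_ <= X)%N](bigID (fun c => c != 0%N)) /=; exact: leq_addr.
  rewrite /F big_distrr /= big_seq [X in (_ <= X)%N]big_seq; apply: leq_sum => k kL.
  by rewrite leq_mul2r x2 ?orbT.
(* Flagged clusters come in pairs: [mate] maps the absorbing ones injectively to the absorbed
   ones. *)
have h5 : (F <= 2 * M)%N.
  have F12 : (F <= M + count (fun k => fl k == 1%N) L)%N.
    rewrite /F /M -!sum1_count [X in (_ <= X + _)%N]big_mkcond [X in (_ <= _ + X)%N]big_mkcond -big_split /=.
    rewrite big_seq [X in (_ <= X)%N]big_seq; apply: leq_sum => k kL.
    by have := mt_values mt (LK _ kL); case: (fl k) => [|[|[|]]].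
  suff le1 : (count (fun k => fl k == 1%N) L <= M)%N by lia.
  rewrite -size_filter /M -(size_filter (fun k => fl k == 2)) -(size_map mate).
  apply: uniq_leq_size.
    rewrite map_inj_in_uniq ?filter_uniq ?iota_uniq // => x y.
    rewrite mem_filter => /andP[/eqP fx xL]; rewrite mem_filter => /andP[/eqP fy yL] e.
    have [_ _ _ px] := mt_absorbing mt (LK _ xL) fx.
    by have [_ _ _ py] := mt_absorbing mt (LK _ yL) fy; rewrite -px -py e.
  move=> y /mapP[x]; rewrite mem_filter => /andP[/eqP fx xL] ->.
  have [_ mK fm px] := mt_absorbing mt (LK _ xL) fx.
  have [_ lm _ _ _] := mt_absorbed mt mK fm.
  by rewrite mem_filter fm eqxx mem_lives mK.
(* Origin of 24: [N2 + 1 = N0 <= E + 1], so the number of non-root clusters is at most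
   [E + 3 * N2 <= 4 * E], while [E <= 3 * F] and [F <= 2 * M]. *)
by clear -Lnz h1 h2 h3 h4 h5; lia.
Qed.

End Round.

(** A logarithmic potential with integer values that drops at each round. The quotient lies between
    48 and 95 for positive m and measures the progress inside a dyadic range; the factor 48 is twice
    the constant of [many_merges]. *)
Definition rounds (m : nat) : nat :=
  (48 * trunc_log 2 m + (48 * m) %/ 2 ^ trunc_log 2 m)%N.

Lemma rounds_lt m M : (1 < m)%N -> (m <= (24 * M).+1)%N -> (M < m)%N ->
  (rounds (m - M) < rounds m)%N.
Proof.
move=> m1 mM Mm; rewrite /rounds; set m' := (m - M)%N.
have m'0 : (0 < m')%N by rewrite /m'; lia.
have m0 : (0 < m)%N by lia.
set L := trunc_log 2 m; set L' := trunc_log 2 m'.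
have /andP[lL hL] := trunc_log_bounds (isT : (1 < 2)%N) m0.
have /andP[lL' hL'] := trunc_log_bounds (isT : (1 < 2)%N) m'0.
have LL : (L' <= L)%N by apply: leq_trunc_log; rewrite /m'; lia.
rewrite -/L in lL hL; rewrite -/L' in lL' hL'.
have p0 : (0 < 2 ^ L)%N by rewrite expn_gt0.
have p0' : (0 < 2 ^ L')%N by rewrite expn_gt0.
(* Within one dyadic range, [48 * M] is at least [m], hence at least [2 ^ L], and the quotient
   drops. When the exponent drops, the first term loses at least 48 and the quotient gains at most
   47. *)
have [e|ne] := eqVneq L' L.
  rewrite e ltn_add2l ltn_divLR //.
  have := divn_eq (48 * m) (2 ^ L); have := ltn_pmod (48 * m) p0.
  set q := (_ %/ _)%N; set r := (_ %% _)%N; move: lL; move: (2 ^ L)%N => x.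
  rewrite /m'; clear -mM m1 Mm; nia.
have lt : (L' < L)%N by rewrite ltn_neqAle ne.
have : ((48 * m') %/ 2 ^ L' < 96)%N.
  by rewrite ltn_divLR //; move: hL'; rewrite expnS; lia.
have : (48 <= (48 * m) %/ 2 ^ L)%N by rewrite leq_divRL //; lia.
clear -lt; lia.
Qed.

Lemma rounds_le m : (0 < m)%N -> (rounds m <= 48 * trunc_log 2 m + 96)%N.
Proof.
move=> m0; rewrite /rounds leq_add2l; have p0 : (0 < 2 ^ trunc_log 2 m)%N by rewrite expn_gt0.
have /andP[_ h] := trunc_log_bounds (isT : (1 < 2)%N) m0.
apply: ltnW; rewrite ltn_divLR //; move: h; rewrite expnS; lia.
Qed.

End Contraction.

(** * The program for one round *)

Notation w0 := (WConst 0).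
Notation w1 := (WConst 1).
Notation w2 := (WConst 2).

(** T and B stand for the keys seen from the top and from the bottom of a cluster, P and C for
    points and customers. Point keys are negated distances and customer keys are distances minus
    radii, so that a point is covered when the customer key is at most the point key. *)
Definition kTP (e : wexp) : rexp := RSub (ROfWord w0) (RGet 6 e).
Definition kTC (e : wexp) : rexp := RSub (RGet 6 e) (RGet 10 e).
Definition kBP (e : wexp) : rexp := RSub (ROfWord w0) (RGet 7 e).
Definition kBC (e : wexp) : rexp := RSub (RGet 7 e) (RGet 10 e).

Definition round_clear : cmd :=
  For 4 (var 33)
    (CWSet 13 (var 4) w0 ;; CWSet 15 (var 4) w0 ;; CWSet 36 (var 4) w0).

Definition round_count : cmd :=
  For 4 (var 33)
    (CIf (TAnd (TWlt w0 (var 4)) (TWlt w0 (WGet 17 (var 4))))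
       (CWSet 13 (WGet 12 (var 4)) (WAdd (WGet 13 (WGet 12 (var 4))) w1))
       CSkip).

Definition mergeable_test : test :=
  TNot (TAnd (TNot (TWeq (WGet 13 (var 4)) w0))
             (TNot (TAnd (TWeq (WGet 13 (var 4)) w1)
                         (TWeq (WGet 13 (WGet 12 (var 4))) w1)))).

Definition round_match : cmd :=
  For 4 (var 33)
    (CIf (TAnd (TAnd (TWlt w0 (var 4)) (TWlt w0 (WGet 17 (var 4))))
            (TAnd (TAnd (TWeq (WGet 15 (var 4)) w0)
                        (TWeq (WGet 15 (WGet 12 (var 4))) w0)) mergeable_test))
       (CWSet 15 (var 4) w2 ;; CWSet 15 (WGet 12 (var 4)) w1 ;;
        CWSet 14 (WGet 12 (var 4)) (var 4))
       CSkip).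

(** Registers 40 and 41 delimit the lists of the cluster, 42 and 43 those of its mate, empty if
    there is none, so that unmatched clusters need no separate code. The mate starts on the left of
    the scan, since the first scan takes its items as customers; [swap_regs] then exchanges the
    sides. *)
Definition pair_regs : cmd :=
  40 <-- WGet 16 (var 4) ;; 41 <-- WAdd (var 40) (WGet 17 (var 4)) ;;
  CIf (TWeq (WGet 15 (var 4)) w1)
    (34 <-- WGet 14 (var 4) ;; 42 <-- WGet 16 (var 34) ;;
     43 <-- WAdd (var 42) (WGet 17 (var 34)))
    (42 <-- w0 ;; 43 <-- w0) ;;
  32 <-- WAdd (WSub (var 41) (var 40)) (WSub (var 43) (var 42)) ;;
  37 <-- var 42 ;; 29 <-- var 43 ;; 38 <-- var 40 ;; 30 <-- var 41.

Definition swap_regs : cmd :=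
  37 <-- var 40 ;; 29 <-- var 41 ;; 38 <-- var 42 ;; 30 <-- var 43.

Definition leaf_keys : cmd :=
  For 5 (WSub (var 30) (var 38))
    (CRSet 7 (WGet 18 (WAdd (var 38) (var 5)))
       (RSub (RSub (RGet 6 (WGet 18 (WAdd (var 38) (var 5)))) (RGet 8 (var 34)))
             (RGet 8 (var 34)))).

(** The new lower keys of an absorbed leaf are its upper keys minus a constant. Its lists 18 and 19,
    sorted from the top, are thus already sorted for the new lower keys and take the place of 20 and
    21. *)
Definition bottom_merges : cmd :=
  CIf (TAnd (TWeq (WGet 15 (var 4)) w1) (TWeq (WGet 13 (var 34)) w0))
    (leaf_keys ;; merge_code 20 18 24 kBP ;; merge_code 21 19 25 kBC)
    (merge_code 20 20 24 kBP ;; merge_code 21 21 25 kBC).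

Definition pair_store : cmd :=
  CWSet 35 (var 4) (var 26) ;; CWSet 36 (var 4) (var 32) ;;
  26 <-- WAdd (var 26) (var 32).

Definition pair_body : cmd :=
  pair_regs ;;
  (cross_code 19 20 kTC kBP ;; swap_regs ;; cross_code 21 18 kBC kTP) ;;
  bottom_merges ;; merge_code 18 18 22 kTP ;; merge_code 19 19 23 kTC ;; pair_store.

Definition round_pairs : cmd :=
  26 <-- w0 ;;
  For 4 (var 33)
    (CIf (TAnd (TWlt w0 (WGet 17 (var 4))) (TWle (WGet 15 (var 4)) w1))
       pair_body CSkip).

Definition round_update : cmd :=
  For 4 (var 33)
    (CWSet 18 (var 4) (WGet 22 (var 4)) ;; CWSet 19 (var 4) (WGet 23 (var 4)) ;;
     CWSet 20 (var 4) (WGet 24 (var 4)) ;; CWSet 21 (var 4) (WGet 25 (var 4)) ;;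
     CWSet 16 (var 4) (WGet 35 (var 4)) ;; CWSet 17 (var 4) (WGet 36 (var 4)) ;;
     CIf (TWeq (WGet 15 (var 4)) w2) (31 <-- WSub (var 31) w1) CSkip ;;
     CIf (TWeq (WGet 15 (WGet 12 (var 4))) w2)
       (CWSet 12 (var 4) (WGet 12 (WGet 12 (var 4)))) CSkip).

Definition round : cmd :=
  round_clear ;; round_count ;; round_match ;; round_pairs ;; round_update.

Definition contract : cmd := CWhile (TWlt w1 (var 31)) round.

(** * Clearing, counting children and matching *)

Section RoundRuns.
Variables (R : realType) (W K : nat) (delta : nat -> nat -> R).
Variables (dep tdep pi rho : nat -> R) (rk : nat -> nat).
Hypothesis delta_sym : forall i j, (i < K)%N -> (j < K)%N -> delta i j = delta j i.
Hypothesis KW : (4 * K + 20 < W)%N.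
Implicit Types (s : state R).

Notation contraction_inv := (contraction_inv K delta dep tdep pi rho rk).
Notation cluster := (cluster K).
Notation live := (live K).
Notation lives := (lives K).
Notation nkids := (nkids K).

Definition list_ok (l : seq nat) (f : nat -> R) rep k : Prop :=
  perm_eq l (cluster rep k) /\ sorted (keyle f) l.

Definition lists_ok (rep : nat -> nat) (kb : nat -> R) k (l1 l2 l3 l4 : seq nat) : Prop :=
  [/\ list_ok l1 (fun i => - dep i) rep k, list_ok l2 (fun i => dep i - rho i) rep k,
      list_ok l3 (fun i => - kb i) rep k & list_ok l4 (fun i => kb i - rho i) rep k].

(** Memory between rounds. Words: 12 parents, 16 and 17 start and length of the lists of a cluster,
    18 to 21 the four lists, 31 the number of clusters, 33 the number of items. Reals: 6 [dep], 7
    [kb], 8 [tdep], 9 penalties, 10 radii, 11 accumulators. *)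
Record round_inv (rep : nat -> nat) s : Prop := {
  ri_K : wmem s 33 0 = K;
  ri_dep : forall i, rmem s 6 i = dep i;
  ri_tdep : forall i, rmem s 8 i = tdep i;
  ri_pi : forall i, rmem s 9 i = pi i;
  ri_rho : forall i, rmem s 10 i = rho i;
  ri_ci : contraction_inv rep (wmem s 12) (rmem s 7) (rmem s 11);
  ri_size : forall k, (k < K)%N -> wmem s 17 k = size (cluster rep k);
  ri_seg : forall k, (k < K)%N -> live rep k -> (wmem s 16 k + wmem s 17 k <= K)%N;
  ri_lists : forall k, (k < K)%N -> live rep k ->
    let l a := seg (wmem s a) (wmem s 16 k) (wmem s 17 k) in
    lists_ok rep (rmem s 7) k (l 18%N) (l 19%N) (l 20%N) (l 21%N);
  ri_live : wmem s 31 0 = size (lives rep) }.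

Let W0 : (0 < W)%N. Proof. by lia. Qed.
Let wc1 : (1 %% W = 1)%N. Proof. by rewrite modn_small //; lia. Qed.
Let wc2 : (2 %% W = 2)%N. Proof. by rewrite modn_small //; lia. Qed.
Let KW1 : (K < W)%N. Proof. by lia. Qed.

Lemma round_clear_run s : wmem s 33 0 = K ->
  runs W round_clear s (K.+1 * 50)
    (fun s' => (forall k, (k < K)%N -> [/\ wmem s' 13 k = 0%N, wmem s' 15 k = 0%N &
       wmem s' 36 k = 0%N]) /\ same_off (wmods round_clear) (rmods round_clear) s s').
Proof.
move=> s33; apply: runs_frame; rewrite /round_clear; set body := (X in For _ _ X).
pose Inv k s1 := wmem s1 33 0 = K /\ forall c, (c < k)%N ->
  [/\ wmem s1 13 c = 0%N, wmem s1 15 c = 0%N & wmem s1 36 c = 0%N].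
have H := @runs_for_lf R W 4 (var 33) K body s Inv KW1 isT isT.
apply: runs_weaken (H _ _ _ _) _ _ => {H} //.
- by move=> k s1 _ [e _]; rewrite /= mod0n.
- move=> k s1 kK v4 [e33 h]; split; first by rewrite /= /upd.
  move=> c; rewrite ltnS leq_eqVlt /= /upd /= !mod0n v4.
  by case: (c =P k) => //= _ /h.
- by rewrite leq_mul2l.
- by move=> s1 [].
Qed.

Lemma round_count_run rep s : round_inv rep s -> (forall k, (k < K)%N -> wmem s 13 k = 0%N) ->
  runs W round_count s (K.+1 * 70)
    (fun s' => (forall k, (k < K)%N -> wmem s' 13 k = nkids rep (wmem s 12) k) /\
       same_off (wmods round_count) (rmods round_count) s s').
Proof.
move=> ri cnt0; apply: runs_frame; rewrite /round_count; set body := (X in For _ _ X).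
pose P k d := [&& d != 0%N, live rep d & wmem s 12 d == k].
pose Inv k s1 := [/\ wmem s1 33 0 = K, forall c, wmem s1 12 c = wmem s 12 c,
  forall c, wmem s1 17 c = wmem s 17 c &
  forall c, (c < K)%N -> wmem s1 13 c = count (P c) (iota 0 k)].
have H := @runs_for_lf R W 4 (var 33) K body s Inv KW1 isT isT.
apply: runs_weaken (H _ _ _ _) _ _ => {H} //.
- by move=> k s1 _ [e _ _ _]; rewrite /= mod0n.
- move=> k s1 kK v4 [e33 e12 e17 h].
  have sif b c1 c2 : sexec W (CIf b c1 c2) s1 =
    if teval W s1 b then sexec W c1 s1 else sexec W c2 s1 by [].
  have ioS : iota 0 k.+1 = rcons (iota 0 k) k by rewrite -addn1 iotaD cats1.
  rewrite /body sif /= !mod0n v4 e17 (ri_size ri kK) -!ltnNge lt0n -/(live rep k).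
  case: ifP => /= cond; last first.
    split=> // c cK; rewrite h // ioS -cats1 count_cat /= /P andbA cond /=.
    by rewrite !addn0.
  case/andP: cond => k0 lk; have [pK _ _] := ci_par (ri_ci ri) kK k0 lk.
  rewrite e12 h // modnDmr.
  have cl : (count (P (wmem s 12 k)) (iota 0 k) <= k)%N.
    by rewrite -[k in X in (_ <= X)%N](size_iota 0) count_size.
  rewrite modn_small; last by clear -cl kK KW; lia.
  split=> // c cK; rewrite ioS -cats1 count_cat /= /upd /= [P _ k]/P k0 lk /=.
  by case: (c =P _) => [->|/eqP ne]; rewrite ?eqxx ?addn0 // eq_sym (negbTE ne) addn0 h.
- by split=> //; apply: (ri_K ri).
- by rewrite leq_mul2l.
- move=> s1 [_ _ _ h] k kK; rewrite h // /nkids /kids size_filter count_filter.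
  by apply: eq_count => d; rewrite /P /= -andbA; congr (_ && _); rewrite andbC.
Qed.

(** A greedy matching is maximal: when k is visited, it is matched unless it or its parent already
    has a flag, and a nonzero flag is never reset. *)
Lemma round_match_run rep s : round_inv rep s ->
  (forall k, (k < K)%N -> wmem s 13 k = nkids rep (wmem s 12) k) ->
  (forall k, (k < K)%N -> wmem s 15 k = 0%N) ->
  runs W round_match s (K.+1 * 150)
    (fun s' => matching K rep (wmem s 12) (wmem s' 15) (wmem s' 14) /\
       same_off (wmods round_match) (rmods round_match) s s').
Proof.
move=> ri cnt fl0; apply: runs_frame; rewrite /round_match; set body := (X in For _ _ X).
set par := wmem s 12; have ci := ri_ci ri.
pose Inv k s1 := [/\ wmem s1 33 0 = K, forall c, wmem s1 12 c = par c,
  forall c, wmem s1 17 c = wmem s 17 c, forall c, wmem s1 13 c = wmem s 13 c &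
  let fl := wmem s1 15 in let mate := wmem s1 14 in
  [/\ forall c, (c < K)%N -> fl c = 2 ->
       [/\ c != 0%N, live rep c, fl (par c) = 1%N, mate (par c) = c & mergeable K rep par c],
      forall c, (c < K)%N -> fl c = 1%N ->
       [/\ live rep c, (mate c < K)%N, fl (mate c) = 2 & par (mate c) = c],
      forall c, (c < K)%N -> (fl c <= 2)%N &
      forall c, (c < k)%N -> c != 0%N -> live rep c -> mergeable K rep par c ->
       (fl c != 0%N) || (fl (par c) != 0%N)]].
have H := @runs_for_lf R W 4 (var 33) K body s Inv KW1 isT isT.
apply: runs_weaken (H _ _ _ _) _ _ => {H} //.
- by move=> k s1 _ [e _ _ _]; rewrite /= mod0n.
- move=> k s1 kK v4 [e33 e12 e17 e13 [h1 h2 h3 h4]].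
  have sif b c1 c2 : sexec W (CIf b c1 c2) s1 =
    if teval W s1 b then sexec W c1 s1 else sexec W c2 s1 by [].
  have tst : k != 0%N -> live rep k -> teval W s1 mergeable_test = mergeable K rep par k.
    move=> k0 lk; have [pK _ _] := ci_par ci kK k0 lk.
    rewrite /= !mod0n v4 wc1 !e13 e12 -!eqn_leq !cnt // -/par.
    by rewrite /mergeable negb_and !negbK.
  rewrite /body sif; set b := (X in teval _ _ X).
  have -> : teval W s1 b = [&& k != 0%N, live rep k, wmem s1 15 k == 0%N,
      wmem s1 15 (par k) == 0%N & mergeable K rep par k].
    have tand b1 b2 : teval W s1 (TAnd b1 b2) = teval W s1 b1 && teval W s1 b2 by [].
    rewrite /b tand (tand (TAnd (TWeq _ _) _)).
    have -> : teval W s1 (TAnd (TWlt w0 (var 4)) (TWlt w0 (WGet 17 (var 4)))) =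
        (k != 0%N) && live rep k.
      by rewrite /= !mod0n v4 e17 (ri_size ri kK) -!ltnNge (lt0n k).
    have -> : teval W s1 (TAnd (TWeq (WGet 15 (var 4)) w0)
        (TWeq (WGet 15 (WGet 12 (var 4))) w0)) =
        (wmem s1 15 k == 0%N) && (wmem s1 15 (par k) == 0%N).
      by rewrite /= !mod0n v4 e12 -!eqn_leq.
    case k0: (k != 0%N); last by [].
    case lk: (live rep k); last by [].
    by rewrite tst ?k0 ?lk //= andbA.
  case: ifP => [/and5P[k0 lk /eqP fk /eqP fp mg]|cond]; last first.
    split=> //; split=> // c; rewrite ltnS leq_eqVlt => /predU1P[->|]; last exact: h4.
    move=> k0 lk mg; move: cond; rewrite k0 lk mg /= andbT => /negbT.
    by rewrite negb_and.
  have [pK lp rp] := ci_par ci kK k0 lk.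
  have pk : par k != k by apply: contraTneq rp => e; rewrite -/par e ltnn.
  have s1E : sexec W (CWSet 15 (var 4) w2 ;; CWSet 15 (WGet 12 (var 4)) w1 ;;
        CWSet 14 (WGet 12 (var 4)) (var 4)) s1 =
      State (upd (upd (upd (wmem s1) 15 k 2) 15 (par k) 1) 14 (par k) k) (rmem s1).
    by rewrite /= !mod0n v4 wc1 wc2 ?e12.
  have W2 : (1 < W)%N by clear -KW; lia.
  rewrite s1E; set f := upd _ 14 _ _.
  have fE c : f 15%N c = if c == par k then 1%N else if c == k then 2 else wmem s1 15 c.
    by rewrite /f /upd /=.
  have mE c : f 14%N c = if c == par k then k else wmem s1 14 c by rewrite /f /upd /=.
  split=> //; rewrite /= -/f; split.
  + move=> c cK; rewrite fE; case: eqP => // cp; case: eqP => [-> _|ck fc].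
      by rewrite !fE !mE eqxx; split.
    have [c0 lc fpc mpc mgc] := h1 c cK fc.
    have [npk npp] : par c != k /\ par c != par k.
      by split; apply/eqP => e; move: fpc; rewrite e ?fk ?fp.
    by rewrite !fE !mE (negbTE npk) (negbTE npp); split.
  + move=> c cK; rewrite fE mE; case: eqP => [-> _|cp].
      by rewrite fE eqxx eq_sym (negbTE pk).
    case: eqP => // ck fc; have [lc mK fm pm] := h2 c cK fc.
    have [nmk nmp] : wmem s1 14 c != k /\ wmem s1 14 c != par k.
      by split; apply/eqP => e; move: fm; rewrite e ?fk ?fp.
    by rewrite fE (negbTE nmk) (negbTE nmp); split.
  + by move=> c cK; rewrite fE; do 2![case: eqP => // _]; apply: h3.
  + move=> c; rewrite ltnS leq_eqVlt => /predU1P[->|ck] c0 lc mgc.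
      by rewrite !fE eqxx; case: ifP.
    have := h4 c ck c0 lc mgc; rewrite !fE.
    by do ![case: ifP => // _]; rewrite ?orbT.
- split; [exact: (ri_K ri)|by []|by []|by []|split=> //].
  + by move=> c cK; rewrite fl0.
  + by move=> c cK; rewrite fl0.
  + by move=> c cK; rewrite fl0.
- by rewrite leq_mul2l.
- by move=> s1 [_ _ _ _ [h1 h2 h3 h4]]; split.
Qed.

End RoundRuns.

Lemma sorted_key (R : realType) (f g : nat -> R) (l : seq nat) :
  {in l &, forall i j, (f i <= f j) = (g i <= g j)} ->
  sorted (keyle f) l -> sorted (keyle g) l.
Proof.
move=> fg; apply: (@sub_in_sorted _ (mem l)); last by apply/allP.
by move=> i j il jl; rewrite /keyle fg.
Qed.

(** * Merging one pair of clusters *)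

Section Pairs.
Variables (R : realType) (W K : nat) (delta : nat -> nat -> R).
Variables (dep tdep pi rho : nat -> R) (rk : nat -> nat).
Hypothesis KW : (4 * K + 20 < W)%N.
Implicit Types (s : state R).

Notation contraction_inv := (contraction_inv K delta dep tdep pi rho rk).
Notation cluster := (cluster K).
Notation live := (live K).
Notation lives := (lives K).
Notation nkids := (nkids K).
Notation round_inv := (round_inv K delta dep tdep pi rho rk).
Notation lists_ok := (lists_ok K dep rho).
Notation list_ok := (list_ok K).

Let W0 : (0 < W)%N. Proof. by lia. Qed.
Let wc1 : (1 %% W = 1)%N. Proof. by rewrite modn_small //; lia. Qed.
Let wc2 : (2 %% W = 2)%N. Proof. by rewrite modn_small //; lia. Qed.
Let KW1 : (K < W)%N. Proof. by lia. Qed.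

Variables (s0 : state R) (rep : nat -> nat).
Hypothesis ri : round_inv rep s0.
Let par := wmem s0 12.
Let fl := wmem s0 15.
Let mate := wmem s0 14.
Let kb := rmem s0 7.
Hypothesis mt : matching K rep par fl mate.
Hypothesis cnt : forall k, (k < K)%N -> wmem s0 13 k = nkids rep par k.

Let ci : contraction_inv rep par kb (rmem s0 11) := ri_ci ri.
Let rep1 := rep' rep par fl.
Let kb1 := kb' K dep tdep rep par fl kb.

Definition mate_cluster k := if fl k == 1%N then cluster rep (mate k) else [::].

Definition gain i :=
  if fl (rep i) == 2 then
    \sum_(j <- cluster rep (par (rep i)) | kb j - rho j <= - dep i) pi j
  else if fl (rep i) == 1%N then
    \sum_(j <- cluster rep (mate (rep i)) | dep j - rho j <= - kb i) pi j
  else 0.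

Lemma cluster_uniq r k : uniq (cluster r k).
Proof. by rewrite filter_uniq ?iota_uniq. Qed.

Let mate_neq k : (k < K)%N -> fl k = 1%N -> mate k != k.
Proof.
move=> kK fk; have [_ _ fm _] := mt_absorbing mt kK fk.
by apply: contra_eqN fk => /eqP e; rewrite -e fm.
Qed.

Lemma cluster_round k : (k < K)%N -> fl k != 2 ->
  perm_eq (cluster rep1 k) (cluster rep k ++ mate_cluster k).
Proof.
move=> kK fk; apply: uniq_perm; first exact: cluster_uniq.
  rewrite cat_uniq cluster_uniq /mate_cluster; case: eqP => //= f1.
  rewrite cluster_uniq andbT; apply/hasPn => i; rewrite !mem_cluster.
  by move=> /andP[-> /eqP->]; rewrite mate_neq.
move=> i; rewrite mem_cat !mem_cluster /mate_cluster.
have [iK|iK] /= := ltnP i K; last first.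
  by case: ifP => _; rewrite ?in_nil // mem_cluster ltnNge iK.
have rK := ci_rep ci iK; rewrite /rep1 /rep'.
case: (fl (rep i) =P 2) => f2.
  have [_ _ fp mp _] := mt_absorbed mt rK f2.
  have -> : (rep i == k) = false by apply: contraNF fk => /eqP <-; rewrite f2.
  case: (fl k =P 1%N) => f1 /=.
    rewrite mem_cluster iK /=; apply/eqP/eqP => [e|e].
      by rewrite -mp e.
    by have [_ _ _ pm] := mt_absorbing mt kK f1; rewrite e pm.
  by rewrite in_nil; apply/eqP => e; rewrite -e fp in f1.
case: (fl k =P 1%N) => f1; last by rewrite in_nil orbF.
rewrite mem_cluster iK /=; have [_ _ fm _] := mt_absorbing mt kK f1.
have -> : (rep i == mate k) = false by apply/eqP => e; rewrite e in f2.
by rewrite orbF.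
Qed.

Lemma cluster_absorbed k : (k < K)%N -> fl k = 2 -> cluster rep1 k = [::].
Proof.
move=> kK f2; apply/size0nil/eqP; rewrite -leqn0 leqNgt; apply/negP.
by rewrite -/(live rep1 k) (live_round ci mt kK) f2 andbF.
Qed.

Lemma cluster_dead k : (k < K)%N -> ~~ live rep k -> cluster rep1 k = [::].
Proof.
move=> kK nl; apply/size0nil/eqP; rewrite -leqn0 leqNgt; apply/negP.
by rewrite -/(live rep1 k) (live_round ci mt kK) (negbTE nl).
Qed.

Section Pair.
Variable k : nat.
Hypotheses (kK : (k < K)%N) (lk : live rep k) (fk : fl k != 2).

Definition a0 := wmem s0 16 k.
Definition nA := size (cluster rep k).
Definition b0 := if fl k == 1%N then wmem s0 16 (mate k) else 0%N.
Definition nB := size (mate_cluster k).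
Definition sA a := seg (wmem s0 a) a0 nA.
Definition sB a := seg (wmem s0 a) b0 nB.

Let mate_live : fl k = 1%N -> [/\ (mate k < K)%N, live rep (mate k), fl (mate k) = 2 & par (mate k) = k].
Proof.
move=> f1; have [_ mK fm pm] := mt_absorbing mt kK f1.
by have [_ lm _ _ _] := mt_absorbed mt mK fm.
Qed.

Lemma a_bound : (a0 + nA <= K)%N.
Proof. by rewrite /a0 /nA -(ri_size ri kK); apply: ri_seg ri _ kK lk. Qed.

Lemma b_bound : (b0 + nB <= K)%N.
Proof.
rewrite /b0 /nB /mate_cluster; case: eqP => // f1; have [mK lm _ _] := mate_live f1.
by rewrite -(ri_size ri mK); apply: ri_seg ri _ mK lm.
Qed.

Lemma sA_ok : lists_ok rep kb k (sA 18) (sA 19) (sA 20) (sA 21).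
Proof. by have := ri_lists ri kK lk; rewrite (ri_size ri kK). Qed.

Lemma sB_ok : fl k = 1%N ->
  lists_ok rep kb (mate k) (sB 18) (sB 19) (sB 20) (sB 21).
Proof.
move=> f1; have [mK lm _ _] := mate_live f1; have := ri_lists ri mK lm.
by rewrite (ri_size ri mK) /sB /b0 /nB /mate_cluster f1.
Qed.

Lemma sB_nil a : fl k != 1%N -> sB a = [::].
Proof. by move=> f1; rewrite /sB /nB /mate_cluster (negbTE f1). Qed.

Lemma sA_perm : [/\ perm_eq (sA 18) (cluster rep k), perm_eq (sA 19) (cluster rep k),
  perm_eq (sA 20) (cluster rep k) & perm_eq (sA 21) (cluster rep k)].
Proof. by have [[? _] [? _] [? _] [? _]] := sA_ok. Qed.

Lemma sB_perm : [/\ perm_eq (sB 18) (mate_cluster k), perm_eq (sB 19) (mate_cluster k),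
  perm_eq (sB 20) (mate_cluster k) & perm_eq (sB 21) (mate_cluster k)].
Proof.
rewrite /mate_cluster; case: eqP => [f1|/eqP f1]; last by rewrite !sB_nil.
by have [[? _] [? _] [? _] [? _]] := sB_ok f1.
Qed.

Definition pair_ws : seq nat :=
  [:: 4; 5; 22; 23; 24; 25; 26; 27; 28; 29; 30; 32; 34; 35; 36; 37; 38; 40; 41; 42; 43]%N.
Definition pair_rs : seq nat := [:: 7; 11; 12]%N.

Definition pair_base s := [/\ same_off pair_ws pair_rs s0 s, wmem s 4 0 = k &
  fl k = 1%N -> wmem s 34 0 = mate k].

Definition regs4 s := [/\ wmem s 40 0 = a0, wmem s 41 0 = (a0 + nA)%N,
  wmem s 42 0 = b0, wmem s 43 0 = (b0 + nB)%N & wmem s 32 0 = (nA + nB)%N].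

Definition zip_regs s a na b nb :=
  [/\ wmem s 37 0 = a, wmem s 38 0 = b, wmem s 29 0 = (a + na)%N,
      wmem s 30 0 = (b + nb)%N & wmem s 32 0 = (na + nb)%N].

Lemma pair_regs_sexec s : same_off pair_ws pair_rs s0 s -> wmem s 4 0 = k ->
  let s' := sexec W pair_regs s in
  [/\ pair_base s', regs4 s' & zip_regs s' b0 nB a0 nA].
Proof.
move=> sm e4 s'.
have sm' : same_off pair_ws pair_rs s0 s'.
  apply: same_off_trans sm _; apply: same_off_sub (sexec_same W s _) => //.
  by move=> x; rewrite !inE; do ![case/orP => [/eqP->|] //]; move/eqP->.
have r c j : c \notin pair_ws -> wmem s c j = wmem s0 c j by apply: sm.1.
have aK := a_bound; have bK := b_bound.
have szk : wmem s0 17 k = nA by rewrite (ri_size ri kK).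
have e32 : ((nA + nB) %% W = nA + nB)%N.
  by rewrite modn_small //; clear -aK bK KW; lia.
have e41 : ((a0 + nA) %% W)%N = (a0 + nA)%N by rewrite modn_small //; clear -aK KW1; lia.
have e43 : ((b0 + nB) %% W)%N = (b0 + nB)%N by rewrite modn_small //; clear -bK KW1; lia.
have [f1|f1] := eqVneq (fl k) 1%N.
  have [mK lm _ _] := mate_live f1.
  have eb : wmem s0 16 (mate k) = b0 by rewrite /b0 f1 eqxx.
  have sb : wmem s0 17 (mate k) = nB.
    by rewrite (ri_size ri mK) /nB /mate_cluster f1 eqxx.
  have s'E : s' = State (upd (upd (upd (upd (upd (upd (upd (upd (upd (upd (wmem s)
     40 0 a0) 41 0 (a0 + nA)%N) 34 0 (mate k)) 42 0 b0) 43 0 (b0 + nB)%N) 32 0 (nA + nB)%N)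
     37 0 b0) 29 0 (b0 + nB)%N) 38 0 a0) 30 0 (a0 + nA)%N) (rmem s).
    rewrite /s' /= !mod0n e4 !(r 16%N) // !(r 17%N) // szk -/a0 e41 (r 15%N) // -/fl f1 wc1 /=.
    rewrite (r 14%N) // -/mate eb sb e43 !addKn.
    by rewrite e32.
  split; last 2 first.
  - by rewrite s'E; split.
  - by rewrite s'E; split=> //; rewrite /= addnC.
  by split=> // [|_]; rewrite s'E.
have [eb sb] : b0 = 0%N /\ nB = 0%N.
  by rewrite /b0 /nB /mate_cluster (negbTE f1).
rewrite eb sb in e32 e43 *.
have s'E : s' = State (upd (upd (upd (upd (upd (upd (upd (upd (upd (wmem s)
     40 0 a0) 41 0 (a0 + nA)%N) 42 0 0%N) 43 0 0%N) 32 0 (nA + 0)%N)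
     37 0 0%N) 29 0 0%N) 38 0 a0) 30 0 (a0 + nA)%N) (rmem s).
  rewrite /s' /= !mod0n e4 !(r 16%N) // !(r 17%N) // szk -/a0 e41 (r 15%N) // -/fl wc1 /=.
  by rewrite -eqn_leq (negbTE f1) /= ?mod0n addKn e32.
split; last 2 first.
- by rewrite s'E; split; rewrite /= ?eb ?sb.
- by rewrite s'E; split=> //=; rewrite addn0.
split=> //; first by rewrite s'E.
by move=> e; rewrite e eqxx in f1.
Qed.

Lemma zip_time_le lL lR kL kR actL actR N :
  (ctime (CIf (take_left lL lR kL kR)
       (actL ;; 27 <-- WAdd (var 27) (WConst 1))
       (actR ;; 28 <-- WAdd (var 28) (WConst 1))) <= 200)%N ->
  (zip_time lL lR kL kR actL actR N <= 240 * N.+1)%N.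
Proof. by rewrite /zip_time; move: (ctime _) => c; clear; nia. Qed.

Let members i : (i \in cluster rep1 k) = (i \in cluster rep k) || (i \in mate_cluster k).
Proof. by rewrite (perm_mem (cluster_round kK fk)) mem_cat. Qed.

Let pair_baseP s s' ws rs : pair_base s -> same_off ws rs s s' ->
  all (mem pair_ws) ws -> all (mem pair_rs) rs -> 4%N \notin ws -> 34%N \notin ws ->
  pair_base s'.
Proof.
case=> sm e4 e34 sm' /allP wsS /allP rsS n4 n34; split.
- by apply: same_off_trans sm _; apply: same_off_sub sm'.
- by rewrite sm'.1.
- by rewrite sm'.1.
Qed.

(** The code compares the keys [f] read from memory, whereas the result must be sorted by the
    intended keys [g]. They need to agree only on the members of the new cluster, as the lower keys
    in memory are up to date only there. *)
Lemma merge_pair_run a b out key (f g : nat -> R) s pos :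
    pair_base s -> zip_regs s a0 nA b0 nB -> wmem s 26 0 = pos -> (pos + (nA + nB) <= K)%N ->
    a \notin pair_ws -> b \notin pair_ws -> out \in [:: 22; 23; 24; 25]%N ->
    (ctime (CIf (take_left a b key key)
       (CWSet out (WAdd (var 26) (var 5)) (WGet a (var 27)) ;; 27 <-- WAdd (var 27) (WConst 1))
       (CWSet out (WAdd (var 26) (var 5)) (WGet b (var 28)) ;; 28 <-- WAdd (var 28) (WConst 1)))
       <= 200)%N ->
    (forall s' e, same_off [:: 5; 27; 28; out]%N [::] s s' ->
       reval W s' (key e) = f (weval W s' e)) ->
    {in cluster rep1 k, f =1 g} ->
    perm_eq (sA a) (cluster rep k) -> perm_eq (sB b) (mate_cluster k) ->
    sorted (keyle g) (sA a) -> sorted (keyle g) (sB b) ->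
  runs W (merge_code a b out key) s (240 * (nA + nB).+1)
    (fun s' => list_ok (seg (wmem s' out) pos (nA + nB)) g rep1 k /\
       forall j, (j < pos)%N -> wmem s' out j = wmem s out j).
Proof.
move=> [sm e4 _] regs e26 pK aN bN oin tm keyf fg pA pB srtA srtB.
have aK := a_bound; have bK := b_bound.
have inA i : i \in sA a -> i \in cluster rep1 k.
  by rewrite (perm_mem pA) members => ->.
have inB i : i \in sB b -> i \in cluster rep1 k.
  by rewrite (perm_mem pB) members orbC => ->.
have outW x : x \notin pair_ws -> x \notin [:: 5; 27; 28; out]%N.
  apply: contra; move: oin; rewrite !inE => /or4P[]/eqP-> /or4P[]/eqP->;
    by rewrite ?eqxx ?orbT.
have o1 : out \notin [:: 5; 27; 28; 29; 30; 32; 37; 38]%N.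
  by move: oin; rewrite !inE => /or4P[]/eqP->.
have o2 : out != 26%N by move: oin; rewrite !inE => /or4P[]/eqP->.
apply: runs_weaken (merge_run (outW _ aN) (outW _ bN) o1 o2 _ _ _ keyf regs e26) _ _.
- by clear -aK KW; lia.
- by clear -bK KW; lia.
- by clear -pK KW; lia.
- exact: zip_time_le.
move=> s' [segE same]; split=> //; rewrite segE.
have -> : seg (wmem s a) a0 nA = sA a by apply: eq_seg => j _; apply: sm.1.
have -> : seg (wmem s b) b0 nB = sB b by apply: eq_seg => j _; apply: sm.1.
have fgE l : {subset l <= cluster rep1 k} -> {in l &, forall i j, (g i <= g j) = (f i <= f j)}.
  by move=> sub i j il jl; rewrite !fg //; apply: sub.
split.
  rewrite perm_merge; apply: perm_trans (perm_cat pA pB) _.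
  by rewrite perm_sym cluster_round.
apply: (@sorted_key _ f).
  by move=> i j; rewrite !mem_merge !mem_cat => /orP[/inA|/inB] ii /orP[/inA|/inB] jj; rewrite !fg.
apply: merge_sorted; first exact: keyle_total.
  by apply: sorted_key srtA; apply: fgE.
by apply: sorted_key srtB; apply: fgE.
Qed.

(** Across the pair, items of the upper cluster are seen through their lower keys and items of the
    mate through their upper keys, in both scans. The first scan has the customers in the mate, the
    second in the upper cluster. *)
Lemma crosses_run s : pair_base s -> regs4 s -> zip_regs s b0 nB a0 nA ->
    {in cluster rep k, rmem s 7 =1 kb} ->
  runs W (cross_code 19 20 kTC kBP ;; swap_regs ;; cross_code 21 18 kBC kTP) s
    (600 * (nA + nB).+1)
    (fun s' => zip_regs s' a0 nA b0 nB /\ forall i, rmem s' 11 i = rmem s 11 i +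
      (if i \in cluster rep k then \sum_(j <- mate_cluster k | dep j - rho j <= - kb i) pi j
       else 0) +
      (if i \in mate_cluster k then \sum_(j <- cluster rep k | kb j - rho j <= - dep i) pi j
       else 0)).
Proof.
move=> pb r4 zr kbE; have [sm e4 e34] := pb.
have aK := a_bound; have bK := b_bound.
have [pA18 pA19 pA20 pA21] := sA_perm; have [pB18 pB19 pB20 pB21] := sB_perm.
have [[_ sA18] [_ sA19] [_ sA20] [_ sA21]] := sA_ok.
have [sB18 sB19] : sorted (keyle (fun i => - dep i)) (sB 18) /\
    sorted (keyle (fun i => dep i - rho i)) (sB 19).
  have [f1|f1] := eqVneq (fl k) 1%N; last by rewrite !sB_nil.
  by have [[_ ?] [_ ?] _ _] := sB_ok f1.
have segE s1 c x m : same_off pair_ws pair_rs s0 s1 -> c \notin pair_ws ->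
    seg (wmem s1 c) x m = seg (wmem s0 c) x m.
  by move=> sm1 cN; apply: eq_seg => j _; apply: sm1.1.
have rE s1 c i : same_off pair_ws pair_rs s0 s1 -> c \notin pair_rs -> rmem s1 c i = rmem s0 c i.
  by move=> sm1 cN; apply: sm1.2.
have uA c : perm_eq c (cluster rep k) -> uniq c by move/perm_uniq->; apply: cluster_uniq.
have uB c : perm_eq c (mate_cluster k) -> uniq c.
  by move/perm_uniq->; rewrite /mate_cluster; case: ifP => // _; apply: cluster_uniq.
apply: (@runs_weaken R W _ _ ((4 + 240 * (nB + nA).+1) + (16 + (4 + 240 * (nA + nB).+1)))%N) => [|
  |s' h]; [|by clear; nia|exact: h].
apply: runs_seq.
have H1 : runs W (cross_code 19 20 kTC kBP) s (4 + 240 * (nB + nA).+1) (fun s' =>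
    forall i, rmem s' 11 i = rmem s 11 i +
      (if i \in cluster rep k then \sum_(j <- mate_cluster k | dep j - rho j <= - kb i) pi j
       else 0)).
  apply: runs_weaken (cross_run (fC := fun i => dep i - rho i) (fP := fun i => - rmem s 7 i)
    _ _ _ _ _ _ _ zr _ _ _) _ _ => //.
  - by clear -bK KW; lia.
  - by clear -aK KW; lia.
  - by clear -aK bK KW; lia.
  - move=> s1 e sm1; rewrite /= !sm1.2 // !(rE s) //.
    by rewrite (ri_dep ri) (ri_rho ri).
  - by move=> s1 e sm1; rewrite /= !sm1.2 // mod0n sub0r.
  - by rewrite (segE s).
  - rewrite (segE s) //; apply: sorted_key sA20 => i j; rewrite !(perm_mem pA20) => ii jj.
    by rewrite !kbE.
  - by rewrite (segE s) //; apply: uA.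
  - by rewrite leq_add2l; apply: zip_time_le.
  - move=> s' h i; rewrite h !(segE s) // (perm_mem pA20); congr (_ + _).
    case: ifP => // ii; rewrite kbE //.
    rewrite (perm_big _ pB19) /=; apply: eq_bigr => j _.
    by rewrite (rE s) // (ri_pi ri).
apply: runs_weaken (runs_frame H1) (leqnn _) _ => s1 [acc1 sm01].
have pb1 : pair_base s1 by apply: (pair_baseP pb sm01).
have [e40 e41 e42 e43 e32] := r4.
apply: runs_seq; apply: runs_loopfree => //.
pose s2 := State (upd (upd (upd (upd (wmem s1) 37 0 a0) 29 0 (a0 + nA)%N) 38 0 b0) 30 0 (b0 + nB)%N) (rmem s1).
have -> : sexec W swap_regs s1 = s2.
  by rewrite /= !mod0n !sm01.1 // e40 e41 e42 e43.
have pb2 : pair_base s2.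
  apply: (@pair_baseP s1 s2 [:: 37; 29; 38; 30]%N [::]) => //.
  by split=> // c j; rewrite !inE !negb_or /= => /and4P[/negbTE-> /negbTE-> /negbTE-> /negbTE->].
have zr2 : zip_regs s2 a0 nA b0 nB by split=> //=; rewrite sm01.1.
have [sm2 _ _] := pb2.
have H2 : runs W (cross_code 21 18 kBC kTP) s2 (4 + 240 * (nA + nB).+1) (fun s' =>
    forall i, rmem s' 11 i = rmem s2 11 i +
      (if i \in mate_cluster k then \sum_(j <- cluster rep k | kb j - rho j <= - dep i) pi j
       else 0)).
  apply: runs_weaken (cross_run (fC := fun i => rmem s2 7 i - rho i) (fP := fun i => - dep i)
    _ _ _ _ _ _ _ zr2 _ _ _) _ _ => //.
  - by clear -aK KW; lia.
  - by clear -bK KW; lia.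
  - by clear -aK bK KW; lia.
  - move=> s3 e sm3; rewrite /= !sm3.2 // (rE s2 10%N) //.
    by rewrite (ri_rho ri).
  - by move=> s3 e sm3; rewrite /= !sm3.2 // mod0n sub0r (rE s2 6%N) // (ri_dep ri).
  - rewrite (segE s2) //; apply: sorted_key sA21 => i j; rewrite !(perm_mem pA21) => ii jj.
    by rewrite /= !sm01.2 // !kbE.
  - by rewrite (segE s2).
  - by rewrite (segE s2) //; apply: uB.
  - by rewrite leq_add2l; apply: zip_time_le.
  - move=> s' h i; rewrite h !(segE s2) // (perm_mem pB18); congr (_ + _).
    case: ifP => // ii.
    rewrite (perm_big _ pA21) /= big_seq_cond [RHS]big_seq_cond.
    apply: eq_big => j; last by rewrite (rE s2 9%N) // (ri_pi ri).
    by case: (boolP (j \in _)) => //= jj; rewrite sm01.2 // kbE.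
apply: runs_weaken (runs_frame H2) (leqnn _) _ => s3 [acc3 sm23]; split.
  by case: zr2 => *; split; rewrite sm23.1.
by move=> i; rewrite acc3 /= acc1.
Qed.

Lemma leaf_keys_run s : pair_base s -> zip_regs s a0 nA b0 nB -> fl k = 1%N ->
  runs W leaf_keys s (nB.+1 * 60)
    (fun s' => forall i, rmem s' 7 i =
       if i \in mate_cluster k then dep i - 2 * tdep (mate k) else rmem s 7 i).
Proof.
move=> [sm e4 e34] [_ e38 _ e30 _] f1; rewrite /leaf_keys; set body := (X in For _ _ X).
have bK := b_bound; have [pB18 _ _ _] := sB_perm.
pose Inv j s1 := same_off [:: 5]%N [:: 7]%N s s1 /\ forall i, rmem s1 7 i =
  if i \in take j (sB 18) then dep i - 2 * tdep (mate k) else rmem s 7 i.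
have nBW : (nB < W)%N by clear -bK KW; lia.
have H := @runs_for_lf R W 5 (WSub (var 30) (var 38)) nB body s Inv nBW isT isT.
apply: runs_weaken (H _ _ _ _) _ _ => {H} //.
- move=> j s1 x [sm1 h]; split=> //; apply: same_off_trans sm1 _.
  exact: same_off_upd.
- by move=> j s1 _ [sm1 _]; rewrite /= mod0n !sm1.1 // e38 e30 addKn.
- move=> j s1 jB e5 [sm1 h].
  have jW : ((b0 + j) %% W = b0 + j)%N by rewrite modn_small //; clear -bK jB KW; lia.
  have tkE : take j.+1 (sB 18) = rcons (take j (sB 18)) (wmem s0 18 (b0 + j)).
    by rewrite (take_nth 0%N) ?size_seg // nth_seg.
  have E : sexec W body s1 = State (wmem s1) (upd (rmem s1) 7 (wmem s0 18 (b0 + j))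
      (dep (wmem s0 18 (b0 + j)) - tdep (mate k) - tdep (mate k))).
    rewrite /= !mod0n e5 !(sm1.1 38%N) // e38 jW !(sm1.1 18%N) // !(sm.1 18%N) //.
    rewrite (sm1.1 34%N) // e34 // !(sm1.2 6%N) // !(sm1.2 8%N) // !(sm.2 6%N) // !(sm.2 8%N) //.
    by rewrite (ri_dep ri) (ri_tdep ri).
  rewrite E; split.
    apply: same_off_trans sm1 _; split=> // c i; rewrite inE /=.
    by move=> /negbTE ->.
  move=> i; rewrite /= h tkE mem_rcons inE; case: eqP => //= ->.
  by rewrite mulrDl mul1r opprD addrA.
- by split=> [|i]; [split|rewrite take0 in_nil].
- by rewrite leq_mul2l.
- move=> s1 [_ h] i; rewrite h take_oversize ?size_seg //.
  by rewrite (perm_mem pB18).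
Qed.

Let kb1_A i : i \in cluster rep k -> kb1 i = kb i.
Proof. by rewrite mem_cluster /kb1 /kb' => /andP[_ /eqP->]; rewrite (negbTE fk). Qed.

Let kb1_B i : i \in mate_cluster k -> kb1 i =
  if nkids rep par (mate k) == 0%N then dep i - 2 * tdep (mate k) else kb i.
Proof.
rewrite /mate_cluster; case: eqP => // f1; rewrite mem_cluster /kb1 /kb' => /andP[_ /eqP->].
by have [_ _ -> _] := mate_live f1.
Qed.

Lemma bottom_run s pos : pair_base s -> zip_regs s a0 nA b0 nB ->
    wmem s 26 0 = pos -> (pos + (nA + nB) <= K)%N ->
    {in cluster rep1 k, rmem s 7 =1 kb} ->
  runs W bottom_merges s (600 * (nA + nB).+1)
    (fun s' => [/\ list_ok (seg (wmem s' 24) pos (nA + nB)) (fun i => - kb1 i) rep1 k,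
       list_ok (seg (wmem s' 25) pos (nA + nB)) (fun i => kb1 i - rho i) rep1 k,
       forall j, (j < pos)%N -> wmem s' 24 j = wmem s 24 j /\ wmem s' 25 j = wmem s 25 j &
       forall i, rmem s' 7 i = if i \in cluster rep1 k then kb1 i else rmem s 7 i]).
Proof.
move=> pb zr e26 pK kbE; have [sm e4 e34] := pb.
have [pA18 pA19 pA20 pA21] := sA_perm; have [pB18 pB19 pB20 pB21] := sB_perm.
have [[_ sA18] [_ sA19] [_ sA20] [_ sA21]] := sA_ok.
have rE s1 c i : same_off pair_ws pair_rs s0 s1 -> c \notin pair_rs -> rmem s1 c i = rmem s0 c i.
  by move=> sm1 cN; apply: sm1.2.
have sA20' : sorted (keyle (fun i => - kb1 i)) (sA 20).
  by apply: sorted_key sA20 => i j; rewrite !(perm_mem pA20) => ii jj; rewrite !kb1_A.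
have sA21' : sorted (keyle (fun i => kb1 i - rho i)) (sA 21).
  by apply: sorted_key sA21 => i j; rewrite !(perm_mem pA21) => ii jj; rewrite !kb1_A.
have two_merges s1 lP lC : pair_base s1 -> zip_regs s1 a0 nA b0 nB -> wmem s1 26 0 = pos ->
    {in cluster rep1 k, rmem s1 7 =1 kb1} -> lP \notin pair_ws -> lC \notin pair_ws ->
    perm_eq (sB lP) (mate_cluster k) -> perm_eq (sB lC) (mate_cluster k) ->
    sorted (keyle (fun i => - kb1 i)) (sB lP) ->
    sorted (keyle (fun i => kb1 i - rho i)) (sB lC) ->
    runs W (merge_code 20 lP 24 kBP ;; merge_code 21 lC 25 kBC) s1
      (240 * (nA + nB).+1 + 240 * (nA + nB).+1)
      (fun s' => [/\ list_ok (seg (wmem s' 24) pos (nA + nB)) (fun i => - kb1 i) rep1 k,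
       list_ok (seg (wmem s' 25) pos (nA + nB)) (fun i => kb1 i - rho i) rep1 k,
       forall j, (j < pos)%N -> wmem s' 24 j = wmem s1 24 j /\ wmem s' 25 j = wmem s1 25 j &
       forall i, rmem s' 7 i = rmem s1 7 i]).
  move=> pb1 zr1 e261 kb7 lPN lCN pP pC srtP srtC; apply: runs_seq.
  have [sm1 _ _] := pb1.
  apply: runs_weaken (runs_frame (merge_pair_run (f := fun i => - rmem s1 7 i)
     (g := fun i => - kb1 i) pb1 zr1 e261 pK _ lPN _ _ _ _ _ pP sA20' srtP)) (leqnn _) _ => //.
  - by move=> s2 e sm2; rewrite /= mod0n sub0r sm2.2.
  - by move=> i ii; rewrite kb7.
  move=> s2 [[ok24 lt24] sm12].
  have pb2 : pair_base s2.
    by apply: (pair_baseP pb1 sm12).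
  have zr2 : zip_regs s2 a0 nA b0 nB by case: zr1 => *; split; rewrite sm12.1.
  have e262 : wmem s2 26 0 = pos by rewrite sm12.1.
  apply: runs_weaken (runs_frame (merge_pair_run (f := fun i => rmem s2 7 i - rho i)
     (g := fun i => kb1 i - rho i) pb2 zr2 e262 pK _ lCN _ _ _ _ _ pC sA21' srtC)) (leqnn _) _ => //.
  - move=> s3 e sm3; rewrite /= !sm3.2 // (rE s2 10%N) ?(ri_rho ri) //.
    by case: pb2.
  - by move=> i ii; rewrite sm12.2 // kb7.
  move=> s3 [[ok25 lt25] sm23]; split=> //.
  - by rewrite (eq_seg (g := wmem s2 24)) // => j _; rewrite sm23.1.
  - by move=> j jp; rewrite sm23.1 // lt24 // lt25 // sm12.1.
  - by move=> i; rewrite sm23.2 // sm12.2.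
apply: (@runs_weaken R W _ _ (tcost (TAnd (TWeq (WGet 15 (var 4)) w1) (TWeq (WGet 13 (var 34)) w0)) +
   maxn (nB.+1 * 60 + (240 * (nA + nB).+1 + 240 * (nA + nB).+1))
     (240 * (nA + nB).+1 + 240 * (nA + nB).+1)).+1%N); last by move=> s' h; exact: h.
  apply: runs_if; rewrite /= !mod0n e4 wc1 !(sm.1 15%N) // -/fl -!eqn_leq.
    case/andP=> /eqP f1; rewrite e34 // (sm.1 13%N) // cnt => [nk|]; last by have [] := mate_live f1.
    apply: runs_seq; apply: runs_weaken (runs_frame (leaf_keys_run pb zr f1)) (leqnn _) _.
    move=> s1 [kb7 sm01].
    have pb1 : pair_base s1.
      by apply: (pair_baseP pb sm01).
    have zr1 : zip_regs s1 a0 nA b0 nB by case: zr => *; split; rewrite sm01.1.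
    have kb71 : {in cluster rep1 k, rmem s1 7 =1 kb1}.
      move=> i ii; rewrite kb7; case: (boolP (i \in mate_cluster k)) => iB; first by rewrite kb1_B // nk.
      by rewrite kbE // kb1_A //; move: ii; rewrite members (negbTE iB) orbF.
    apply: runs_weaken (two_merges s1 18%N 19%N pb1 zr1 _ kb71 _ _ pB18 pB19 _ _) (leqnn _) _ => //.
    - by rewrite sm01.1.
    - have [[_ srt] _ _ _] := sB_ok f1; apply: sorted_key srt => i j.
      rewrite !(perm_mem pB18) => ii jj; rewrite !kb1_B // nk.
      by apply/idP/idP; lra.
    - have [_ [_ srt] _ _] := sB_ok f1; apply: sorted_key srt => i j.
      rewrite !(perm_mem pB19) => ii jj; rewrite !kb1_B // nk.
      by apply/idP/idP; lra.
    move=> s' [h1 h2 h3 h4]; split=> //.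
      by move=> j jp; have := h3 j jp; rewrite !sm01.1.
    move=> i; rewrite h4; case: ifP => [/kb71 //|iN]; rewrite kb7.
    by move: iN; rewrite members => /norP[_ /negbTE ->].
  move=> tst.
  have kbB : {in mate_cluster k, kb1 =1 kb}.
    move=> i ii; rewrite kb1_B //; case: eqP => // nk.
    have f1 : fl k = 1%N by move: ii; rewrite /mate_cluster; case: eqP.
    move: tst; rewrite f1 e34 // (sm.1 13%N) // cnt ?nk //.
    by have [] := mate_live f1.
  have kb71 : {in cluster rep1 k, rmem s 7 =1 kb1}.
    by move=> i ii; rewrite kbE //; move: ii; rewrite members => /orP[/kb1_A|/kbB].
  apply: runs_weaken (two_merges s 20%N 21%N pb zr _ kb71 _ _ pB20 pB21 _ _) (leqnn _) _ => //.
  - have [f1|f1] := eqVneq (fl k) 1%N; last by rewrite sB_nil.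
    have [_ _ [_ srt] _] := sB_ok f1; apply: sorted_key srt => i j.
    by rewrite !(perm_mem pB20) => ii jj; rewrite !kbB.
  - have [f1|f1] := eqVneq (fl k) 1%N; last by rewrite sB_nil.
    have [_ _ _ [_ srt]] := sB_ok f1; apply: sorted_key srt => i j.
    by rewrite !(perm_mem pB21) => ii jj; rewrite !kbB.
  move=> s' [h1 h2 h3 h4]; split=> //.
  by move=> i; rewrite h4; case: ifP => [/kb71|].
by rewrite /= !add1n /=; clear; nia.
Qed.

Lemma pair_body_run s pos : same_off pair_ws pair_rs s0 s -> wmem s 4 0 = k ->
    wmem s 26 0 = pos -> (pos + (nA + nB) <= K)%N ->
    {in cluster rep1 k, rmem s 7 =1 kb} ->
  runs W pair_body s (2000 * (nA + nB).+1)
    (fun s' => [/\ lists_ok rep1 kb1 k (seg (wmem s' 22) pos (nA + nB))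
        (seg (wmem s' 23) pos (nA + nB)) (seg (wmem s' 24) pos (nA + nB))
        (seg (wmem s' 25) pos (nA + nB)),
       forall a j, a \in [:: 22; 23; 24; 25]%N -> (j < pos)%N -> wmem s' a j = wmem s a j,
       forall i, rmem s' 7 i = if i \in cluster rep1 k then kb1 i else rmem s 7 i,
       forall i, rmem s' 11 i = rmem s 11 i + (if i \in cluster rep1 k then gain i else 0) &
       [/\ forall c, wmem s' 35 c = if c == k then pos else wmem s 35 c,
           forall c, wmem s' 36 c = if c == k then (nA + nB)%N else wmem s 36 c &
           wmem s' 26 0 = (pos + (nA + nB))%N]]).
Proof.
move=> sm e4 e26 pK kbE.
have aK := a_bound; have bK := b_bound.
have [pA18 pA19 pA20 pA21] := sA_perm; have [pB18 pB19 pB20 pB21] := sB_perm.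
have [[_ sA18] [_ sA19] _ _] := sA_ok.
have [sB18 sB19] : sorted (keyle (fun i => - dep i)) (sB 18) /\
    sorted (keyle (fun i => dep i - rho i)) (sB 19).
  have [f1|f1] := eqVneq (fl k) 1%N; last by rewrite !sB_nil.
  by have [[_ ?] [_ ?] _ _] := sB_ok f1.
apply: ((@runs_weaken R W _ _ (ctime pair_regs + (600 * (nA + nB).+1 + (600 * (nA + nB).+1 +
  (240 * (nA + nB).+1 + (240 * (nA + nB).+1 + ctime pair_store)))))%N)) => [||s' h]; [|
  have c1 : (ctime pair_regs <= 100)%N by [];
  have c2 : (ctime pair_store <= 30)%N by [];
  by move: c1 c2; move: (ctime _) (ctime _) (nA + nB)%N => x y N; clear; lia|exact: h].
apply: runs_seq; apply: runs_loopfree => //.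
have [pb1 r4 zr1] := pair_regs_sexec sm e4.
have sm01 := sexec_same W s (isT : loopfree pair_regs).
move: (sexec W pair_regs s) pb1 r4 zr1 sm01 => s1 pb1 r4 zr1 sm01.
apply: runs_seq.
have kbE1 : {in cluster rep k, rmem s1 7 =1 kb}.
  by move=> i ii; rewrite sm01.2 // kbE // members ii.
apply: runs_weaken (runs_frame (crosses_run pb1 r4 zr1 kbE1)) (leqnn _) _.
move=> s2 [[zr2 acc2] sm12].
have pb2 : pair_base s2.
  by apply: (pair_baseP pb1 sm12).
have e262 : wmem s2 26 0 = pos by rewrite sm12.1 // sm01.1.
apply: runs_seq.
have kbE2 : {in cluster rep1 k, rmem s2 7 =1 kb}.
  by move=> i ii; rewrite sm12.2 // sm01.2 // kbE.
apply: runs_weaken (runs_frame (bottom_run pb2 zr2 e262 pK kbE2)) (leqnn _) _.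
move=> s3 [[ok24 ok25 lt2425 kb3] sm23].
have pb3 : pair_base s3.
  by apply: (pair_baseP pb2 sm23).
have zr3 : zip_regs s3 a0 nA b0 nB by case: zr2 => *; split; rewrite sm23.1.
have e263 : wmem s3 26 0 = pos by rewrite sm23.1.
have rE s5 c i : same_off pair_ws pair_rs s0 s5 -> c \notin pair_rs -> rmem s5 c i = rmem s0 c i.
  by move=> sm5 cN; apply: sm5.2.
apply: runs_seq.
apply: runs_weaken (runs_frame (merge_pair_run (f := fun i => - dep i)
     (g := fun i => - dep i) pb3 zr3 e263 pK _ _ _ _ _ _ pA18 pB18 sA18 sB18)) (leqnn _) _ => //.
  move=> s5 e sm5; rewrite /= mod0n sub0r sm5.2 // (rE s3) ?(ri_dep ri) //.
  by case: pb3.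
move=> s4 [[ok22 lt22] sm34].
have pb4 : pair_base s4.
  by apply: (pair_baseP pb3 sm34).
have zr4 : zip_regs s4 a0 nA b0 nB by case: zr3 => *; split; rewrite sm34.1.
have e264 : wmem s4 26 0 = pos by rewrite sm34.1.
apply: runs_seq.
apply: runs_weaken (runs_frame (merge_pair_run (f := fun i => dep i - rho i)
     (g := fun i => dep i - rho i) pb4 zr4 e264 pK _ _ _ _ _ _ pA19 pB19 sA19 sB19)) (leqnn _) _ => //.
  move=> s5 e sm5; rewrite /= !sm5.2 // !(rE s4) ?(ri_dep ri) ?(ri_rho ri) //; by case: pb4.
move=> s5 [[ok23 lt23] sm45]; apply: runs_loopfree => //.
have e5 : wmem s5 4 0 = k by rewrite sm45.1 //; case: pb4.
have e325 : wmem s5 32 0 = (nA + nB)%N by rewrite sm45.1 //; case: zr4.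
have e265 : wmem s5 26 0 = pos by rewrite sm45.1.
have -> : sexec W pair_store s5 = State (upd (upd (upd (wmem s5) 35 k pos) 36 k (nA + nB)%N)
    26 0 (pos + (nA + nB))%N) (rmem s5).
  rewrite /= !mod0n e5 e325 e265 modn_small //; clear -pK KW1; lia.
split; rewrite /=.
- split; rewrite /=.
  + by rewrite (eq_seg (g := wmem s4 22)) // => j _ /=; rewrite sm45.1.
  + by [].
  + by rewrite (eq_seg (g := wmem s3 24)) // => j _ /=; rewrite sm45.1 // sm34.1.
  + by rewrite (eq_seg (g := wmem s3 25)) // => j _ /=; rewrite sm45.1 // sm34.1.
- move=> a j; rewrite !inE => /or4P[]/eqP-> jp /=.
  + by rewrite sm45.1 // lt22 // sm23.1 // sm12.1 // sm01.1.
  + by rewrite lt23 // sm34.1 // sm23.1 // sm12.1 // sm01.1.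
  + by rewrite sm45.1 // sm34.1 // (lt2425 j jp).1 sm12.1 // sm01.1.
  + by rewrite sm45.1 // sm34.1 // (lt2425 j jp).2 sm12.1 // sm01.1.
- by move=> i; rewrite sm45.2 // sm34.2 // kb3 sm12.2 // sm01.2.
- move=> i; rewrite sm45.2 // sm34.2 // sm23.2 // acc2 sm01.2 // -addrA; congr (_ + _).
  rewrite members /mate_cluster mem_cluster /gain.
  case: (fl k =P 1%N) => f1; last first.
    rewrite in_nil orbF big_nil addr0; case: ifP => // /andP[_ /eqP ->].
    by rewrite (negbTE fk); case: eqP.
  have [mK lm fm pm] := mate_live f1; rewrite mem_cluster.
  case: (ltnP i K) => iK /=; last by rewrite addr0.
  case: (rep i =P k) => [->|nk] /=.
    by rewrite eq_sym (negbTE (mate_neq kK f1)) f1 /= addr0.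
  by case: eqP => [->|]; rewrite ?fm ?pm /= add0r.
- split=> // c.
  + by case: (c == k); rewrite ?sm45.1 // sm34.1 // sm23.1 // sm12.1 // sm01.1.
  + by case: (c == k); rewrite ?sm45.1 // sm34.1 // sm23.1 // sm12.1 // sm01.1.
Qed.

End Pair.
End Pairs.

(** The program also rewrites the parents of clusters that have disappeared, so its parent array
    agrees with [par'] on live clusters only. Chains of parents that start at a live cluster stay
    among live ones, which makes this agreement sufficient. *)
Lemma contraction_inv_ext (R : realType) K delta (dep tdep pi rho : nat -> R) rk rep
    par par2 kb kb2 acc acc2 :
  contraction_inv K delta dep tdep pi rho rk rep par kb acc ->
  (forall k, (k < K)%N -> live K rep k -> par2 k = par k) ->
  (forall i, (i < K)%N -> kb2 i = kb i) -> (forall i, (i < K)%N -> acc2 i = acc i) ->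
  contraction_inv K delta dep tdep pi rho rk rep par2 kb2 acc2.
Proof.
move=> ci parE kbE accE.
have live_lt k : live K rep k -> (k < K)%N by case/liveP=> i iK <-; apply: (ci_rep ci).
have live_par k : live K rep k -> live K rep (par k).
  move=> lk; have [->|k0] := eqVneq k 0%N; first by rewrite (ci_par0 ci) (ci_live0 ci).
  by have [] := ci_par ci (live_lt _ lk) k0 lk.
have iterE m k : live K rep k -> iter m par2 k = iter m par k /\ live K rep (iter m par k).
  move=> lk; elim: m => //= m [-> lm]; split; last exact: live_par.
  by rewrite parE ?live_lt.
have aboveE A k : live K rep k -> above par2 A k -> above par A k.
  by move=> lk [m <-]; exists m; rewrite (iterE m k lk).1.
have live_rep i : (i < K)%N -> live K rep (rep i) by move=> iK; apply/liveP; exists i.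
split.
- exact: (ci_rep ci).
- exact: (ci_live0 ci).
- by rewrite parE ?(ci_par0 ci) ?live_lt ?(ci_live0 ci).
- by move=> k kK k0 lk; rewrite parE //; apply: (ci_par ci).
- move=> k kK; apply: leq_trans (ci_kids ci kK); rewrite /nkids /kids.
  rewrite (@eq_in_filter _ _ (fun c => (c != 0%N) && (par c == k))) // => c.
  by rewrite mem_lives => /andP[cK lc]; rewrite parE.
- move=> a b aK bK ab ne; rewrite kbE //; apply: (ci_below ci) => //.
  by apply: aboveE ab; apply: live_rep.
- move=> B B' a b BK BK' lB lB' B0 B0' ne pe aK bK ha hb.
  apply: (ci_siblings ci (B' := B')) => //; first by rewrite -!parE.
    by apply: aboveE ha; apply: live_rep.
  by apply: aboveE hb; apply: live_rep.
- by move=> i iK; rewrite accE // (ci_acc ci).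
Qed.

(** * A whole round and the contraction loop *)

Section RoundRun.
Variables (R : realType) (W K : nat) (delta : nat -> nat -> R).
Variables (dep tdep pi rho : nat -> R) (rk : nat -> nat).
Hypothesis delta_sym : forall i j, (i < K)%N -> (j < K)%N -> delta i j = delta j i.
Hypothesis KW : (4 * K + 20 < W)%N.
Implicit Types (s : state R).

Notation cluster := (cluster K).
Notation live := (live K).
Notation lives := (lives K).
Notation nkids := (nkids K).
Notation round_inv := (round_inv K delta dep tdep pi rho rk).
Notation lists_ok := (lists_ok K dep rho).

Let wc1 : (1 %% W = 1)%N. Proof. by rewrite modn_small //; lia. Qed.
Let wc2 : (2 %% W = 2)%N. Proof. by rewrite modn_small //; lia. Qed.
Let KW1 : (K < W)%N. Proof. by lia. Qed.

Lemma sum_cluster r : (forall i, (i < K)%N -> (r i < K)%N) ->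
  (\sum_(0 <= c < K) size (cluster r c) = K)%N.
Proof.
move=> rK; rewrite (eq_bigr (fun c => \sum_(0 <= i < K | r i == c) 1)%N); last first.
  by move=> c _; rewrite /cluster size_filter -sum1_count /index_iota subn0.
rewrite (exchange_big_dep xpredT) //= big_nat_cond.
rewrite (eq_bigr (fun=> 1%N)); first by rewrite -big_nat_cond sum_nat_const_nat subn0 muln1.
move=> i /andP[/andP[_ iK] _]; rewrite (eq_bigl (fun c => c == r i)); last first.
  by move=> c; rewrite eq_sym.
by rewrite -big_filter filter_pred1_uniq ?iota_uniq ?big_seq1 // mem_index_iota rK.
Qed.

Section Round.
Variables (s0 : state R) (rep : nat -> nat).
Hypothesis ri : round_inv rep s0.
Let par := wmem s0 12.
Let fl := wmem s0 15.
Let mate := wmem s0 14.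
Let kb := rmem s0 7.
Let acc := rmem s0 11.
Hypothesis mt : matching K rep par fl mate.
Hypothesis cnt : forall k, (k < K)%N -> wmem s0 13 k = nkids rep par k.
Hypothesis clr : forall k, (k < K)%N -> wmem s0 36 k = 0%N.

Let ci := ri_ci ri.
Let rep1 := rep' rep par fl.
Let kb1 := kb' K dep tdep rep par fl kb.
Let acc1 := acc' K dep pi rho rep par fl mate kb acc.
Let size1 c := size (cluster rep1 c).

Let ci1 : contraction_inv K delta dep tdep pi rho rk rep1 (par' par fl) kb1 acc1.
Proof. exact: contraction_round. Qed.

Let acc1E i : acc1 i = acc i + gain K dep pi rho s0 rep i. Proof. by []. Qed.

(** The new lists are packed one after the other in the order of the representatives. Keys and
    accumulators are updated in place; this is harmless because an item belongs to a single new
    cluster, so its values are still the old ones when that cluster is treated. *)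
Definition pairs_inv k s : Prop :=
  [/\ same_off pair_ws pair_rs s0 s, wmem s 26 0 = (\sum_(0 <= c < k) size1 c)%N,
      forall i, rmem s 7 i = if (i < K)%N && (rep1 i < k)%N then kb1 i else kb i,
      forall i, rmem s 11 i = if (i < K)%N && (rep1 i < k)%N then acc1 i else acc i &
      (forall c, (c < K)%N -> wmem s 36 c = if (c < k)%N then size1 c else 0%N) /\
      (forall c, (c < k)%N -> (c < K)%N -> live rep1 c ->
         (wmem s 35 c + size1 c <= wmem s 26 0)%N /\
         let l a := seg (wmem s a) (wmem s 35 c) (size1 c) in
         lists_ok rep1 kb1 c (l 22%N) (l 23%N) (l 24%N) (l 25%N))].

Lemma round_pairs_run :
  runs W round_pairs s0 (4300 * K.+1) (fun s' => pairs_inv K s').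
Proof.
apply: (@runs_weaken R W _ _ (3 + (\sum_(c < K) (2100 * (size1 c).+1) + K.+1 * (20 + 2)))%N) =>
  [| |s' h]; [| |exact: h]; last first.
  (* The sizes of the new clusters add up to [K], and the successor in each term pays for empty
     ones: the total is linear. *)
  rewrite -(big_mkord xpredT (fun c => 2100 * (size1 c).+1)%N) -big_distrr /=.
  rewrite (eq_bigr (fun c => 1 + size1 c)%N) // big_split /= sum_nat_const_nat subn0 muln1.
  rewrite sum_cluster; last exact: (ci_rep ci1).
  by clear; lia.
apply: runs_seq; apply: runs_loopfree => //.
apply: (@runs_for R W 4 (var 33) K _ _ (fun c => 2100 * (size1 c).+1)%N pairs_inv) => //.
- move=> k s x [sm h1 h2 h3 h4]; split=> //.
  by apply: same_off_trans sm _; apply: same_off_upd.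
- by move=> k s _ [sm _ _ _ _]; rewrite /= mod0n sm.1 // (ri_K ri).
- move=> k s kK e4 [sm e26 h7 h11 [h36 hl]].
  have tst : teval W s (TAnd (TWlt w0 (WGet 17 (var 4))) (TWle (WGet 15 (var 4)) w1)) =
      live rep k && (fl k != 2).
    rewrite /= !mod0n e4 !sm.1 // (ri_size ri kK) wc1 -ltnNge -/(live rep k).
    by have := mt_values mt kK; rewrite -/fl; case: (fl k) => [|[|[|]]].
  (* The write position is a partial sum of cluster sizes whose total is [K]. *)
  have pos_le : (wmem s 26 0 + size1 k <= K)%N.
    rewrite e26 -[X in (_ <= X)%N](sum_cluster (ci_rep ci1)).
    rewrite -/(size1 k) -(@big_nat_recr _ _ _ k 0 size1) //=.
    by rewrite [X in (_ <= X)%N](@big_cat_nat _ _ _ k.+1) //= leq_addr.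
  apply: (@runs_weaken R W _ _ (tcost (TAnd (TWlt w0 (WGet 17 (var 4))) (TWle (WGet 15 (var 4)) w1)) +
    maxn (2000 * (size1 k).+1) 1).+1) => [||s' h]; [|by rewrite /=; move: (size1 k) => z; clear; lia|exact: h].
  apply: runs_if; rewrite tst.
    case/andP=> lk fk; have szE : size1 k = (nA K rep k + nB K s0 rep k)%N.
      by rewrite /size1 (perm_size (cluster_round ri mt kK fk)) size_cat.
    have kbE : {in cluster rep1 k, rmem s 7 =1 kb}.
      by move=> i; rewrite mem_cluster h7 => /andP[-> /eqP ->]; rewrite ltnn.
    rewrite szE in pos_le *.
    apply: runs_weaken (runs_frame (pair_body_run KW ri mt cnt kK lk fk sm e4 erefl pos_le kbE))
      (leqnn _) _.
    move=> s1 [[ok lt kb2' acc2' [e35 e36 e26']] sm1].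
    have kb2 i : rmem s1 7 i = if i \in cluster rep1 k then kb1 i else rmem s 7 i := kb2' i.
    have acc2 i : rmem s1 11 i = rmem s 11 i +
      (if i \in cluster rep1 k then gain K dep pi rho s0 rep i else 0) := acc2' i.
    split.
    + apply: same_off_trans sm _; apply: same_off_sub sm1.
        by apply/allP.
      by apply/allP.
    + by rewrite e26' e26 big_nat_recr //= szE.
    + move=> i; rewrite kb2 h7 mem_cluster ltnS (leq_eqVlt (rep1 i)).
      by case: (ltnP i K) => //= iK; case: eqP.
    + move=> i; rewrite acc2 h11 mem_cluster ltnS (leq_eqVlt (rep1 i)).
      case: (ltnP i K) => //= iK; last by rewrite addr0.
      by case: eqP => [->|_]; rewrite ?ltnn ?acc1E ?addr0.
    split=> [c cK|c].
      rewrite e36 ltnS leq_eqVlt; case: eqP => [->|_] //=.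
      exact: h36.
    rewrite ltnS leq_eqVlt e35 e26'; case: (c =P k) => [-> _ _ _|ck /= ck' cK lc].
      by rewrite szE /=; split.
    have [le ok'] := hl c ck' cK lc; split; first by apply: leq_trans le (leq_addr _ _).
    have E a : a \in [:: 22; 23; 24; 25]%N ->
        seg (wmem s1 a) (wmem s 35 c) (size1 c) = seg (wmem s a) (wmem s 35 c) (size1 c).
      by move=> ain; apply: eq_seg => j /andP[_ jb]; rewrite lt //; apply: leq_trans jb le.
    by rewrite !E.
  move=> dead; apply: (@runs_loopfree R W CSkip) => //=.
  have cl0 : cluster rep1 k = [::].
    move: dead; rewrite negb_and negbK => /orP[nl|/eqP f2].
      exact: (cluster_dead ri mt).
    exact: (cluster_absorbed ri mt).
  have ltE i : (i < K)%N -> (rep1 i < k.+1)%N = (rep1 i < k)%N.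
    move=> iK; rewrite ltnS leq_eqVlt; case: eqP => // e.
    have : i \in cluster rep1 k by rewrite mem_cluster iK e eqxx.
    by rewrite cl0.
  split=> //.
  + by rewrite big_nat_recr //= /size1 cl0 addn0.
  + by move=> i; rewrite h7; case: (ltnP i K) => //= iK; rewrite ltE.
  + by move=> i; rewrite h11; case: (ltnP i K) => //= iK; rewrite ltE.
  split=> [c cK|c].
    rewrite h36 // ltnS (leq_eqVlt c); case: (c =P k) => [->|_]; last by [].
    by rewrite ltnn /size1 cl0.
  rewrite ltnS leq_eqVlt => /predU1P[->|]; last exact: hl.
  by rewrite liveE -/rep1 cl0.
- split=> //; rewrite /= ?mod0n ?big_geq //.
  + by apply: same_off_upd.
  + by move=> i; rewrite ltn0 andbF.
  + by move=> i; rewrite ltn0 andbF.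
Qed.

Definition update_inv s1 k s : Prop :=
  [/\ same_off [:: 4; 12; 16; 17; 18; 19; 20; 21; 31]%N [::] s1 s,
      forall c, (c < k)%N -> [/\ wmem s 18 c = wmem s1 22 c, wmem s 19 c = wmem s1 23 c,
         wmem s 20 c = wmem s1 24 c, wmem s 21 c = wmem s1 25 c &
         wmem s 16 c = wmem s1 35 c /\ wmem s 17 c = wmem s1 36 c],
      forall c, (c < K)%N -> live rep c -> wmem s 12 c = if (c < k)%N then par' par fl c else par c &
      wmem s 31 0 = (size (lives rep) - count (fun c => fl c == 2) (iota 0 k))%N].

Lemma round_update_run s1 : pairs_inv K s1 ->
  runs W round_update s1 (K.+1 * 140) (round_inv rep1).
Proof.
case=> sm e26 h7 h11 [h36 hl]; rewrite /round_update; set body := (X in For _ _ X).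
have H := @runs_for_lf R W 4 (var 33) K body s1 (update_inv s1) KW1 isT isT.
apply: runs_weaken (H _ _ _ _) _ _ => {H} //.
- move=> k s x [sm1 i1 i2 i3]; split=> //.
  by apply: same_off_trans sm1 _; apply: same_off_upd.
- by move=> k s _ [sm1 _ _ _]; rewrite /= mod0n sm1.1 // sm.1 // (ri_K ri).
- move=> k s kK e4 [sm1 i1 i2 i3].
  have fE c : wmem s 15 c = fl c by rewrite sm1.1 // sm.1.
  have smb : same_off [:: 4; 12; 16; 17; 18; 19; 20; 21; 31]%N [::] s1 (sexec W body s).
    apply: same_off_trans sm1 _; apply: same_off_sub (sexec_same W s _) => //.
    by apply/allP.
  have ioS : iota 0 k.+1 = rcons (iota 0 k) k by rewrite -addn1 iotaD cats1.
  have m1 c : c \in [:: 22; 23; 24; 25; 35; 36]%N -> wmem s c k = wmem s1 c k.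
    by move=> cin; rewrite sm1.1 //; move: cin; rewrite !inE; do ![case/orP => [/eqP->|] //]; move/eqP->.
  have E31 : wmem (sexec W body s) 31 0 = (wmem s 31 0 - (fl k == 2))%N.
    rewrite /= !mod0n e4 wc1 wc2 !fE -!eqn_leq; case: (fl k == 2) => /=.
      by case: ifP => _ /=; rewrite ?mod0n ?wc1.
    by case: ifP => _ /=; rewrite subn0.
  have E12 c : wmem (sexec W body s) 12 c = if c == k then
      (if fl (wmem s 12 k) == 2 then wmem s 12 (wmem s 12 k) else wmem s 12 k) else wmem s 12 c.
    rewrite /= !mod0n e4 wc2 !fE -!eqn_leq.
    by case: (fl k == 2) => /=; rewrite ?mod0n ?e4 !fE; case: (fl _ == 2) => /=;
      rewrite ?mod0n ?e4 //; case: eqP => // ->.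
  have Ecopy c (x y : nat) : (x, y) \in [:: (18, 22); (19, 23); (20, 24); (21, 25); (16, 35); (17, 36)]%N ->
      wmem (sexec W body s) x c = if c == k then wmem s y k else wmem s x c.
    rewrite /= !mod0n e4 wc2 !fE -!eqn_leq.
    by case: (fl k == 2) => /=; rewrite ?mod0n ?e4 !fE; case: (fl _ == 2) => /=;
      rewrite !inE; do ![case/orP => [/eqP[-> ->]|] //=]; move/eqP => [-> ->].
  split=> //.
  + move=> c; rewrite ltnS leq_eqVlt !(Ecopy _ 18%N 22%N) // !(Ecopy _ 19%N 23%N) //.
    rewrite !(Ecopy _ 20%N 24%N) // !(Ecopy _ 21%N 25%N) // !(Ecopy _ 16%N 35%N) // !(Ecopy _ 17%N 36%N) //.
    by case: eqP => [-> _|_ /= /i1 //]; rewrite !m1.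
  + move=> c cK lc; rewrite E12 ltnS leq_eqVlt; case: (c =P k) => [e|_] /=; last exact: i2.
    rewrite -e (i2 c) // e ltnn -e /par'; case: eqP => // f2.
    have c0 : c != 0%N.
      apply: contra_eqN f2 => /eqP ->; rewrite [par 0](ci_par0 ci).
      by apply/eqP => f2; have [] := mt_absorbed mt (leq_ltn_trans (leq0n _) kK) f2; rewrite eqxx.
    have [pK lp _] := ci_par ci cK c0 lc.
    (* The parent entry of [par c] may already have been updated in this pass, or not yet. Both
       cases give the same value: [par c] is absorbed, so its own parent carries flag 1 and [par']
       does not change that entry. *)
    have [_ _ f1 _ _] := mt_absorbed mt pK f2.
    by rewrite i2 // /par' -/par f1 /=; case: ifP.
  + rewrite E31 i3 ioS -cats1 count_cat /= addn0 subnDA //.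
- by split=> // [c cK lc|]; rewrite ?subn0 sm.1 // (ri_live ri).
- by rewrite leq_mul2l.
- move=> s [sm1 i1 i2 i3].
  have rE c i : c \notin pair_rs -> rmem s c i = rmem s0 c i.
    by move=> cN; rewrite sm1.2 // sm.2.
  have rep1K := ci_rep ci1.
  have lv c : (c < K)%N -> live rep1 c -> live rep c.
    by move=> cK; rewrite /rep1 (live_round ci mt cK) => /andP[].
  have posK : wmem s1 26 0 = K by rewrite e26 sum_cluster.
  have szE c : (c < K)%N -> wmem s 17 c = size (cluster rep1 c).
    by move=> cK; have [_ _ _ _ [_ ->]] := i1 c cK; rewrite h36 // cK.
  have stE c : (c < K)%N -> wmem s 16 c = wmem s1 35 c.
    by move=> cK; have [_ _ _ _ [-> _]] := i1 c cK.
  split.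
  + by rewrite sm1.1 // sm.1 // (ri_K ri).
  + by move=> i; rewrite rE // (ri_dep ri).
  + by move=> i; rewrite rE // (ri_tdep ri).
  + by move=> i; rewrite rE // (ri_pi ri).
  + by move=> i; rewrite rE // (ri_rho ri).
  + apply: contraction_inv_ext ci1 _ _ _.
    * by move=> c cK lc; rewrite i2 ?cK //; apply: lv.
    * by move=> i iK; rewrite sm1.2 // h7 iK rep1K.
    * by move=> i iK; rewrite sm1.2 // h11 iK rep1K.
  + exact: szE.
  + move=> c cK lc; rewrite szE // stE //; have [+ _] := hl c cK cK lc.
    by rewrite posK.
  + move=> c cK lc /=; rewrite szE // stE //; have [le ok] := hl c cK cK lc.
    have kbs : rmem s 7 = rmem s1 7 by apply: funext => i; rewrite sm1.2.
    have cp x y : (forall j, (j < K)%N -> wmem s x j = wmem s1 y j) ->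
        seg (wmem s x) (wmem s1 35 c) (size (cluster rep1 c)) =
        seg (wmem s1 y) (wmem s1 35 c) (size1 c).
      move=> h; apply: eq_seg => j /andP[_ jb]; apply: h; rewrite -posK.
      exact: leq_trans jb le.
    rewrite !(cp 18%N 22%N, cp 19%N 23%N, cp 20%N 24%N, cp 21%N 25%N);
      try by move=> j /i1[].
    have kb7 i : i \in cluster rep1 c -> rmem s 7 i = kb1 i.
      by rewrite mem_cluster => /andP[iK _]; rewrite kbs h7 iK rep1K.
    case: ok => [ok1 ok2 [p3 s3] [p4 s4]]; split=> //; split=> //.
      apply: sorted_key s3 => i j; rewrite !(perm_mem p3) => ii jj; by rewrite !kb7.
    apply: sorted_key s4 => i j; rewrite !(perm_mem p4) => ii jj; by rewrite !kb7.
  + rewrite i3 (size_lives_round ci mt) -/rep1.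
    have -> : count (fun c => fl c == 2) (lives rep) = count (fun c => fl c == 2) (iota 0 K).
      rewrite /lives count_filter; apply: eq_in_count => c; rewrite mem_iota /= add0n => cK.
      by case: eqP => //= f2; have [_ -> _ _ _] := mt_absorbed mt cK f2.
    by rewrite addnK.
Qed.

End Round.

Lemma round_inv_same rep ws s s' : round_inv rep s -> same_off ws [::] s s' ->
  all (fun c => c \notin ws) [:: 12; 16; 17; 18; 19; 20; 21; 31; 33]%N -> round_inv rep s'.
Proof.
move=> ri sm /allP nws.
have rE c : rmem s' c = rmem s c by apply: funext => i; apply: sm.2.
have wE c : c \in [:: 12; 16; 17; 18; 19; 20; 21; 31; 33]%N -> wmem s' c = wmem s c.
  by move=> /nws cN; apply: funext => i; apply: sm.1.
case: ri => h1 h2 h3 h4 h5 h6 h7 h8 h9 h10; split.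
- by rewrite wE.
- by move=> i; rewrite rE.
- by move=> i; rewrite rE.
- by move=> i; rewrite rE.
- by move=> i; rewrite rE.
- by rewrite !rE wE.
- by move=> k kK; rewrite wE // h7.
- by move=> k kK lk; rewrite !wE // h8.
- by move=> k kK lk /=; rewrite rE !wE //; apply: h9.
- by rewrite wE.
Qed.

Lemma round_run rep s : round_inv rep s -> (1 < size (lives rep))%N ->
  runs W round s (4800 * K.+1)
    (fun s' => exists2 rep1, round_inv rep1 s' &
       (rounds (size (lives rep1)) < rounds (size (lives rep)))%N).
Proof.
move=> ri m1.
apply: (@runs_weaken R W _ _ (K.+1 * 50 + (K.+1 * 70 + (K.+1 * 150 + (4300 * K.+1 + K.+1 * 140))))%N) =>
  [||s' h]; [|by clear; lia|exact: h].
apply: runs_seq; apply: runs_weaken (round_clear_run KW (ri_K ri)) (leqnn _) _ => s1 [clr sm1].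
have ri1 : round_inv rep s1 by apply: round_inv_same ri sm1 _.
apply: runs_seq; apply: runs_weaken (round_count_run KW ri1 _) (leqnn _) _ => [k /clr[]//|s2 [cnt sm2]].
have ri2 : round_inv rep s2 by apply: round_inv_same ri1 sm2 _.
have e12 : wmem s2 12 = wmem s1 12 by apply: funext => i; apply: sm2.1.
apply: runs_seq; apply: runs_weaken (round_match_run KW ri2 _ _) (leqnn _) _ => [k kK|k kK|s3 [mt sm3]].
- by rewrite cnt // e12.
- by rewrite sm2.1 //; have [] := clr k kK.
have ri3 : round_inv rep s3 by apply: round_inv_same ri2 sm3 _.
have e123 : wmem s3 12 = wmem s2 12 by apply: funext => i; apply: sm3.1.
rewrite -e123 in mt.
have cnt3 k : (k < K)%N -> wmem s3 13 k = nkids rep (wmem s3 12) k.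
  by move=> kK; rewrite sm3.1 // cnt // e123 e12.
have clr3 k : (k < K)%N -> wmem s3 36 k = 0%N.
  by move=> kK; rewrite sm3.1 // sm2.1 //; have [] := clr k kK.
apply: runs_seq; apply: runs_weaken (round_pairs_run ri3 mt cnt3 clr3) (leqnn _) _ => s4 pi4.
apply: runs_weaken (round_update_run ri3 mt pi4) (leqnn _) _ => s5 ri5.
exists (rep' rep (wmem s3 12) (wmem s3 15)) => //.
have := many_merges (ri_ci ri3) mt; have := size_lives_round (ri_ci ri3) mt.
set M := count _ _; set m' := size (lives (rep' rep (wmem s3 12) (wmem s3 15))) => mE mM.
have -> : m' = (size (lives rep) - M)%N by rewrite mE addnK.
apply: rounds_lt => //; rewrite mE -addn1 addnC leq_add2r.
have := ci_live0 (ri_ci ri5); rewrite /m' -has_predT => l0; apply/hasP; exists 0%N => //.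
rewrite mem_lives l0 andbT; have /liveP[i iK _] := l0.
exact: leq_ltn_trans (leq0n _) iK.
Qed.

Lemma contract_run rep s : round_inv rep s ->
  runs W contract s ((rounds (size (lives rep))).+1 * (4900 * K.+1))
    (fun s' => forall i, (i < K)%N ->
       rmem s' 11 i = \sum_(j <- iota 0 K) (if delta i j <= rho j then pi j else 0)).
Proof.
move=> ri; pose Inv m s' := exists2 r, round_inv r s' & m = size (lives r).
have I0 : Inv (size (lives rep)) s by exists rep.
have H := @runs_while R W (TWlt w1 (var 31)) round (4800 * K.+1)%N rounds Inv _ s _ _ I0.
apply: runs_weaken (H _ _) _ _.
- by move=> m s1 [r ri1 ->]; rewrite /= mod0n wc1 (ri_live ri1) -ltnNge.
- move=> m s1 [r ri1 ->] m1.
  apply: runs_weaken (round_run ri1 m1) (leqnn _) _ => s2 [r2 ri2 lt2].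
  by exists (size (lives r2)) => //; exists r2.
- rewrite leq_mul2l; apply/orP; right; rewrite /=; clear; lia.
move=> s1 [m le1 [r ri1 em]] i iK; rewrite (ci_acc (ri_ci ri1) iK).
have l0 := ci_live0 (ri_ci ri1).
(* The root cluster is always live, so the only cluster left is 0 and every item belongs to it. *)
have r0 j : (j < K)%N -> r j = 0%N.
  move=> jK; have mj x : (x < K)%N -> live r x -> x \in lives r by rewrite mem_lives => -> ->.
  have jin : r j \in lives r by apply: mj; [exact: (ci_rep (ri_ci ri1))|apply/liveP; exists j].
  have zin : 0%N \in lives r by apply: mj => //; apply: leq_ltn_trans jK.
  move: jin zin; rewrite em in le1; case: (lives r) le1 => [|x [|]] //= _.
  by rewrite !inE => /eqP-> /eqP.
rewrite big_seq_cond [RHS]big_seq_cond; apply: eq_bigl => j; rewrite mem_iota /= add0n.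
by case: (ltnP j K) => //= jK; rewrite !r0.
Qed.

End RoundRun.

(** * The rooted tree: parents, ancestors and distances *)

Section Rooted.
Variables (R : realType) (n : nat) (I : instance R n).
Implicit Types (u v w x y : 'I_n) (Y : {set 'I_n}).

Definition rootv : 'I_n := Ordinal (node_gt0 I).

(** Tuples make the predicate boolean, so that [ex_minn] can define [rank] as the hop distance to
    the root. *)
Definition hops x k : bool :=
  [exists p : k.-tuple 'I_n, path (adj I) x p && (last x p == rootv)].

Lemma hopsP x : exists k, hops x k.
Proof.
have /connectP[p xp e] := adj_connected I x rootv.
by exists (size p); apply/existsP; exists (in_tuple p); rewrite xp -e eqxx.
Qed.

Definition rank x : nat := ex_minn (hopsP x).

Lemma rank_min x p : path (adj I) x p -> last x p = rootv -> (rank x <= size p)%N.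
Proof.
move=> xp e; rewrite /rank; case: ex_minnP => k _; apply.
by apply/existsP; exists (in_tuple p); rewrite xp e eqxx.
Qed.

Lemma rank_path x : exists p, [/\ path (adj I) x p, last x p = rootv & size p = rank x].
Proof.
rewrite /rank; case: ex_minnP => k /existsP[p /andP[xp /eqP e]] _.
by exists p; rewrite size_tuple.
Qed.

Lemma rank_eq0 x : (rank x == 0%N) = (x == rootv).
Proof.
apply/eqP/eqP => [e|->].
  by have [[|y p] [_ /= lx sz]] := rank_path x; rewrite e in sz.
by apply/eqP; rewrite -leqn0; apply: (@rank_min rootv [::]).
Qed.

Lemma rank_adj x y : adj I x y -> (rank x <= (rank y).+1)%N.
Proof.
have [p [yp ly sz]] := rank_path y => xy.
by rewrite -sz; apply: (@rank_min x (y :: p)); rewrite //= xy.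
Qed.

(** The root is its own parent, so that [parent] can be iterated freely. *)
Definition parent x : 'I_n :=
  if x == rootv then rootv else odflt x [pick y | adj I x y && (rank y < rank x)%N].

Lemma parentP x : x != rootv -> adj I x (parent x) /\ rank x = (rank (parent x)).+1.
Proof.
move=> x0; rewrite /parent (negbTE x0); case: pickP => [y /andP[xy ryx]|none] /=.
  by split=> //; apply/eqP; rewrite eqn_leq rank_adj.
have [[|y p] [/= xp lx sz]] := rank_path x.
  by move: x0; rewrite -rank_eq0 -sz.
case/andP: xp => xy yp; have := none y.
by rewrite xy -sz /= ltnS rank_min.
Qed.

Lemma parent_root : parent rootv = rootv. Proof. by rewrite /parent eqxx. Qed.

Lemma rank_parent x : rank (parent x) = (rank x).-1.
Proof.
have [->|x0] := eqVneq x rootv; last by have [_ ->] := parentP x0.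
by rewrite parent_root; have /eqP -> : rank rootv == 0%N by rewrite rank_eq0.
Qed.

Lemma parent_neq x : x != rootv -> parent x != x.
Proof.
move=> x0; have [_ rx] := parentP x0; apply: contra_eqN rx => /eqP ->.
by rewrite neq_ltn ltnSn.
Qed.

(** A simple path from y to x that avoids the step from y to x has at least three nodes; the edge
    from x to y closes it to a cycle, which acyclicity forbids. *)
Lemma adj_bridge x y (e : rel 'I_n) : adj I x y -> subrel e (adj I) ->
  ~~ e y x -> connect e y x -> False.
Proof.
move=> xy sub nyx /connectP[p yp lx].
case/shortenP: yp lx => {}p yp up _ lx.
have c : ucycle (adj I) (y :: p).
  by rewrite /ucycle /= rcons_path (sub_path sub yp) /= -lx xy.
have := adj_acyclic c; case: p yp up lx {c} => [|a [|b p]] //=.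
  by move=> _ _ e'; rewrite e' (adj_irr I) in xy.
by rewrite andbT => yx _ e'; rewrite e' yx in nyx.
Qed.

(** The edges between nodes and their parents already join both ends to the root; any other edge
    would be bypassed by them, against [adj_bridge]. *)
Lemma adj_parent x y : adj I x y -> (parent x == y) || (parent y == x).
Proof.
move=> xy; case: (boolP (_ || _)) => // /norP[px py].
pose t : rel 'I_n := [rel a b | adj I a b && ((parent a == b) || (parent b == a))].
have tsym : connect_sym t.
  by apply: sym_connect_sym => a b; rewrite /t /= (adj_sym I) orbC.
have troot a : connect t a rootv.
  elim/ltn_ind: (rank a) {-2}a (erefl (rank a)) => k IH b rb.
  have [->|b0] := eqVneq b rootv; first exact: connect0.
  have [ba rab] := parentP b0; apply: connect_trans (IH (rank (parent b)) _ _ erefl).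
    by apply: connect1; rewrite /t /= ba eqxx.
  by rewrite -rb rab.
case: (@adj_bridge x y t) => //.
- by move=> a b /andP[].
- by rewrite /t /= negb_and negb_or py px orbT.
- by apply: connect_trans (troot y) _; rewrite tsym.
Qed.

Definition anc w x : bool :=
  (rank w <= rank x)%N && (iter (rank x - rank w) parent x == w).

Lemma anc_refl x : anc x x. Proof. by rewrite /anc leqnn subnn /= eqxx. Qed.

Lemma anc_rank w x : anc w x -> (rank w <= rank x)%N. Proof. by case/andP. Qed.

Lemma rank_iter k x : rank (iter k parent x) = (rank x - k)%N.
Proof. by elim: k => [|k IH] /=; rewrite ?subn0 // rank_parent IH subnS. Qed.

Lemma anc_iter k x : anc (iter k parent x) x.
Proof.
rewrite /anc rank_iter leq_subr /=; case: (leqP k (rank x)) => kx.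
  by rewrite subKn.
have e0 j : (rank x <= j)%N -> iter j parent x = rootv.
  by move=> jx; apply/eqP; rewrite -rank_eq0 rank_iter subn_eq0.
by rewrite (eqP (_ : (rank x - k == 0)%N)) ?subn0 ?e0 ?(ltnW kx) // subn_eq0 ltnW.
Qed.

Lemma ancP w x : reflect (exists k, iter k parent x = w) (anc w x).
Proof.
apply: (iffP idP) => [/andP[_ /eqP <-]|[k <-]]; last exact: anc_iter.
by exists (rank x - rank w)%N.
Qed.

Lemma anc_trans v w x : anc w v -> anc v x -> anc w x.
Proof.
by move=> /ancP[j <-] /ancP[k <-]; apply/ancP; exists (j + k)%N; rewrite iterD.
Qed.

Lemma anc_parent x : anc (parent x) x. Proof. by apply/ancP; exists 1%N. Qed.

Lemma anc_compare v w x : anc w x -> anc v x -> (rank w <= rank v)%N -> anc w v.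
Proof.
move=> /andP[wx /eqP ew] /andP[vx /eqP ev] wv; apply/ancP; exists (rank v - rank w)%N.
by rewrite -{2}ev -iterD addnC addnBA // subnK.
Qed.

Lemma anc_eq w x : anc w x -> rank w = rank x -> w = x.
Proof. by move=> /andP[_ /eqP e] r; rewrite -e r subnn. Qed.

Lemma anc_step w x : x != rootv -> anc w x = (w == x) || anc w (parent x).
Proof.
move=> x0; have [_ rx] := parentP x0; apply/idP/orP => [wx|[/eqP->|]].
- have [e|ne] := eqVneq w x; [by left|right]; apply: (anc_compare wx (anc_parent x)).
  have := anc_rank wx; rewrite leq_eqVlt => /predU1P[/(anc_eq wx)|].
    by move=> e; rewrite e eqxx in ne.
  by rewrite rx.
- exact: anc_refl.
- by move=> h; apply: anc_trans h (anc_parent x).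
Qed.

Lemma anc_root w : anc w rootv = (w == rootv).
Proof.
apply/idP/eqP => [h|->]; last exact: anc_refl.
have r0 : rank rootv = 0%N by apply/eqP; rewrite rank_eq0.
by apply: (anc_eq h); apply/eqP; rewrite eqn_leq anc_rank //= r0.
Qed.

Lemma anc_parentF x : x != rootv -> anc x (parent x) = false.
Proof.
by move=> x0; have [_ rx] := parentP x0; apply/negP => /anc_rank; rewrite rx ltnn.
Qed.

Lemma root_anc x : anc rootv x.
Proof.
apply/ancP; exists (rank x); apply/eqP; by rewrite -rank_eq0 rank_iter subnn.
Qed.

(** The only edge that leaves the set of descendants of v is the one from v to its parent. *)
Lemma anc_cut v x y : adj I x y -> anc v x -> ~~ anc v y ->
  [/\ v = x, y = parent v & v != rootv].
Proof.
move=> xy vx vy; have xney : x != y by apply: contraTneq xy => ->; rewrite (adj_irr I).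
case/orP: (adj_parent xy) => /eqP e.
  have x0 : x != rootv by apply: contra_neq xney => x0; rewrite -e x0 parent_root.
  move: vx; rewrite anc_step // e (negbTE vy) orbF => /eqP vE.
  by rewrite vE e.
have y0 : y != rootv by apply: contra_neq xney => y0; rewrite -e y0 parent_root.
by move: vy; rewrite anc_step // e vx orbT.
Qed.

Definition pcost x : R := if x == rootv then 0 else cost I x (parent x).

Lemma pcost_ge0 x : 0 <= pcost x.
Proof. by rewrite /pcost; case: eqVneq => // x0; apply: cost_ge0; case: (parentP x0). Qed.

Definition depth x : R := \sum_(w | anc w x) pcost w.

Lemma depth_root : depth rootv = 0.
Proof. by rewrite /depth (eq_bigl _ _ anc_root) big_pred1_eq /pcost eqxx. Qed.

Lemma depth_parent x : depth x = depth (parent x) + pcost x.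
Proof.
have [->|x0] := eqVneq x rootv.
  by rewrite parent_root /pcost eqxx addr0.
rewrite /depth (bigD1 x) ?anc_refl //= addrC; congr (_ + _); apply: eq_bigl => w.
rewrite anc_step //; have [->|//] := eqVneq w x; rewrite ?andbT //=.
by rewrite anc_parentF.
Qed.

Lemma le_depth x y : anc x y -> depth x <= depth y.
Proof.
move=> xy; rewrite /depth [leRHS](bigID (fun w => anc w x)) /=.
rewrite [X in _ <= X + _](eq_bigl (fun w => anc w x)); last first.
  move=> w; apply/andP/idP => [[]//|wx]; split=> //; exact: anc_trans wx xy.
by rewrite lerDl; apply: sumr_ge0 => w _; apply: pcost_ge0.
Qed.

(* The path from x to y uses the edge above w exactly when it separates x from y. *)
Lemma path_cost x p : path (adj I) x p -> uniq (x :: p) ->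
  \sum_(e <- zip (x :: p) p) cost I e.1 e.2 =
  \sum_(w | anc w x (+) anc w (last x p)) pcost w.
Proof.
elim: p x => [|y p IH] x /=.
  by move=> _ _; rewrite big_nil big_pred0 // => w; rewrite addbb.
move=> /andP[xy yp] /andP[xN up]; rewrite big_cons IH //=.
(* If the first step crosses the edge above v, then x is an end of that edge. A second crossing
   would visit x again, which a simple path does not do. *)
have const v : anc v x != anc v y -> anc v y = anc v (last y p).
  move=> sep.
  have stay q z : path (adj I) z q -> x \notin z :: q -> anc v z = anc v (last z q).
    elim: q z => //= a q IHq z /andP[za aq]; rewrite !inE !negb_or => /and3P[xz xa xq].
    rewrite -IHq ?inE ?negb_or ?xa //; apply/idP/idP => h; apply/negPn/negP => h'.
    - have [vz ap v0] := anc_cut za h h'.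
      move: sep; case vx: (anc v x); case vy: (anc v y) => // _.
        have [vE _ _] := anc_cut xy vx (negbT vy); by rewrite -vE vz eqxx in xz.
      rewrite (adj_sym I) in xy.
      have [_ xE _] := anc_cut xy vy (negbT vx); by rewrite xE ap eqxx in xa.
    - rewrite (adj_sym I) in za; have [va zp v0] := anc_cut za h h'.
      move: sep; case vx: (anc v x); case vy: (anc v y) => // _.
        have [vE _ _] := anc_cut xy vx (negbT vy); by rewrite -vE va eqxx in xa.
      rewrite (adj_sym I) in xy.
      have [_ xE _] := anc_cut xy vy (negbT vx); by rewrite xE zp eqxx in xz.
  exact: stay.
have [w0 [w0sep w0u w0c]] : exists w0, [/\ anc w0 x != anc w0 y,
    forall w, w != w0 -> anc w x = anc w y & cost I x y = pcost w0].
  have xney : x != y by apply: contraTneq xy => ->; rewrite (adj_irr I).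
  case/orP: (adj_parent xy) => /eqP e.
    have x0 : x != rootv by apply: contra_neq xney => x0; rewrite -e x0 parent_root.
    exists x; rewrite anc_refl -e anc_parentF // /pcost (negbTE x0); split=> // w wx.
    by rewrite anc_step // (negbTE wx).
  have y0 : y != rootv by apply: contra_neq xney => y0; rewrite -e y0 parent_root.
  exists y; rewrite anc_refl -e anc_parentF // /pcost (negbTE y0) e (cost_sym xy); split=> // w wy.
  by rewrite -e [RHS]anc_step // (negbTE wy).
rewrite [RHS](bigD1 w0) /=; last by rewrite -const // addbC; case: (anc w0 x) w0sep; case: (anc w0 y).
rewrite w0c; congr (_ + _); apply: eq_bigl => w.
have [->|ww] := eqVneq w w0; first by rewrite -const // addbb andbF.
by rewrite w0u // andbT.
Qed.

Lemma distE x y : dist I x y = \sum_(w | anc w x (+) anc w y) pcost w.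
Proof.
rewrite /dist /tree_path; set p := xchoose _.
have /and3P[xp /eqP ly up] := xchooseP (simple_path_exists I x y).
by rewrite path_cost // ly.
Qed.

Lemma dist_depth x y :
  dist I x y = depth x + depth y - 2 * \sum_(w | anc w x && anc w y) pcost w.
Proof.
rewrite distE /depth [X in _ = X + _ - _](bigID (fun w => anc w y)) /=.
rewrite [X in _ = _ + X - _](bigID (fun w => anc w x)) /=.
rewrite [X in _ = _ + (X + _) - _](eq_bigl (fun w => anc w x && anc w y)); last by move=> w; rewrite andbC.
rewrite (bigID (fun w => anc w x)) /=.
rewrite [X in X + _ = _](eq_bigl (fun w => anc w x && ~~ anc w y)); last first.
  by move=> w; case: (anc w x); case: (anc w y).
rewrite [X in _ + X = _](eq_bigl (fun w => anc w y && ~~ anc w x)); last first.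
  by move=> w; case: (anc w x); case: (anc w y).
by lra.
Qed.

Lemma tree_dist_sym x y : dist I x y = dist I y x.
Proof. by rewrite !distE; apply: eq_bigl => w; rewrite addbC. Qed.

Lemma dist_anc x y : anc x y -> dist I x y = depth y - depth x.
Proof.
move=> xy; rewrite dist_depth (eq_bigl (fun w => anc w x)) -/(depth x); first by lra.
by move=> w; apply/andP/idP => [[]//|wx]; split=> //; apply: anc_trans wx xy.
Qed.

(** The common ancestors of a and b are those of [parent v]: one of larger rank would make v an
    ancestor of b, hence equal to w, which has the same rank. *)
Lemma dist_branch v w a b : v != rootv -> w != rootv -> v != w -> parent v = parent w ->
  anc v a -> anc w b -> dist I a b = depth a + depth b - 2 * depth (parent v).
Proof.
move=> v0 w0 vw pvw va wb; rewrite dist_depth; congr (_ - 2 * _).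
apply: eq_bigl => z; apply/andP/idP => [[za zb]|zp].
  have rvw : rank v = rank w by have [_ ->] := parentP v0; have [_ ->] := parentP w0; rewrite pvw.
  have [zv|vz] := leqP (rank z) (rank (parent v)).
    exact: anc_compare za (anc_trans (anc_parent v) va) zv.
  have vz' : (rank v <= rank z)%N by have [_ ->] := parentP v0.
  have vb := anc_trans (anc_compare va za vz') zb.
  have := anc_compare vb wb; rewrite rvw leqnn => /(_ isT) /anc_eq /(_ rvw) e.
  by rewrite e eqxx in vw.
have zv := anc_trans zp (anc_parent v); have zw : anc z w by apply: anc_trans zp _; rewrite pvw anc_parent.
by split; [apply: anc_trans zv va|apply: anc_trans zw wb].
Qed.

Lemma dist_notin u v : v != rootv -> ~~ anc v u -> dist I u v = dist I u (parent v) + pcost v.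
Proof.
move=> v0 nvu; rewrite !distE (bigD1 v) /= ?anc_refl ?(negbTE nvu) // addrC.
congr (_ + _); apply: eq_bigl => w; rewrite (anc_step w v0).
have [->|_] := eqVneq w v; first by rewrite anc_parentF // (negbTE nvu) andbF.
by rewrite andbT.
Qed.

(** * Subtrees given by their top node *)

Definition topped Y r : Prop :=
  r \in Y /\ {in Y, forall v, v != r -> v != rootv /\ parent v \in Y}.

Lemma topped_anc Y r v : topped Y r -> v \in Y -> anc r v.
Proof.
move=> [rY top]; elim/ltn_ind: (rank v) {-2}v (erefl (rank v)) => k IH w rw wY.
have [->|wr] := eqVneq w r; first exact: anc_refl.
have [w0 pY] := top w wY wr; rewrite anc_step // (IH (rank (parent w))) ?orbT // -rw.
by have [_ ->] := parentP w0.
Qed.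

(** The top is a node of least rank. For another node v of Y, a path inside Y from v to the top must
    leave the descendants of v, which it can do only through the parent of v. *)
Lemma subtree_topped Y : subtree I Y -> exists r, topped Y r.
Proof.
move=> [/set0Pn[y0 y0Y] conn].
case: (arg_minnP rank y0Y) => r rY rmin; exists r; split=> // v vY vr.
have nvr : ~~ anc v r.
  apply: contra vr => h; apply/eqP/(anc_eq h)/eqP.
  by rewrite eqn_leq anc_rank // rmin.
have /connectP[p vp lr] := conn v r vY rY; rewrite lr in nvr.
suff key q a : path [rel a b | [&& a \in Y, b \in Y & adj I a b]] a q -> anc v a ->
    ~~ anc v (last a q) -> v != rootv /\ parent v \in Y.
  by apply: key vp (anc_refl v) nvr.
elim: q a => [|b q IH] a /=; first by move=> _ ->.
move=> /andP[/and3P[aY bY ab] bq] va nvl.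
case: (boolP (anc v b)) => vb; first exact: IH bq vb nvl.
by have [_ <- v0] := anc_cut ab va vb.
Qed.

Lemma topped_subtree Y r : topped Y r -> subtree I Y.
Proof.
move=> tp; have [rY top] := tp; split; first by apply/set0Pn; exists r.
set e := (X in connect X).
have esym : connect_sym e.
  by apply: sym_connect_sym => a b; rewrite /e /= (adj_sym I) andbCA.
have toR v : v \in Y -> connect e v r.
  elim/ltn_ind: (rank v) {-2}v (erefl (rank v)) => k IH w rw wY.
  have [->|wr] := eqVneq w r; first exact: connect0.
  have [w0 pY] := top w wY wr; have [wp rp] := parentP w0.
  apply: connect_trans (IH (rank (parent w)) _ _ erefl pY); last by rewrite -rw rp.
  by apply: connect1; rewrite /e /= wY pY wp.
by move=> x y xY yY; apply: connect_trans (toR x xY) _; rewrite esym toR.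
Qed.

(** Each edge is charged to its child end. An edge occurs in the double sum in one orientation,
    fixed by the order of the labels; writing its cost as [f x y + f y x], with one of the two terms
    zero, and exchanging the sums removes this dependence. *)
Lemma setup_costE Y r : topped Y r -> setup_cost I Y = \sum_(v in Y | v != r) pcost v.
Proof.
move=> tp; have [rY top] := tp.
have nr : {in Y, forall v, (v != r) = (v != rootv) && (parent v \in Y)}.
  move=> v vY; apply/idP/andP => [|[v0 pY]]; first exact: top.
  by apply/eqP => e; rewrite e in v0 pY; have := topped_anc tp pY; rewrite anc_parentF.
pose f x y : R := if (x != rootv) && (parent x == y) then pcost x else 0.
have costE x y : adj I x y -> cost I x y = f x y + f y x.
  move=> xy; have xney : x != y by apply: contraTneq xy => ->; rewrite (adj_irr I).
  have aux a b : adj I a b -> a != b -> parent a = b -> cost I a b = f a b + f b a.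
    move=> ab anb e; have a0 : a != rootv by apply: contra_neq anb => a0; rewrite -e a0 parent_root.
    rewrite /f a0 e eqxx /= /pcost (negbTE a0) e [X in _ = _ + X]ifF ?addr0 //.
    apply/andP => -[b0 /eqP eb]; have := anc_parentF a0; rewrite e.
    by rewrite -{1}eb anc_parent.
  case/orP: (adj_parent xy) => /eqP e; first exact: aux.
  by rewrite (cost_sym xy) addrC; apply: aux => //; [rewrite (adj_sym I)|rewrite eq_sym].
have inner x (P : pred 'I_n) : (forall y, P y -> adj I x y) ->
    \sum_(y | P y) f x y = if (x != rootv) && P (parent x) then pcost x else 0.
  move=> Padj; rewrite /f; have [x0|x0] := eqVneq x rootv; first by rewrite big1.
  rewrite -big_mkcondr /=; case: ifP => Pp.
    rewrite (eq_bigl (fun y => y == parent x)) ?big_pred1_eq // => y.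
    by rewrite andbC eq_sym; case: eqP => [->|].
  by rewrite big_pred0 // => y; rewrite andbC; case: eqP => [<-|].
rewrite /setup_cost.
under eq_bigr => x xY.
  under eq_bigr => y /andP[yY /andP[xy _]] do rewrite costE //.
  rewrite big_split /= inner; last by move=> y /andP[_ /andP[]].
  over.
rewrite big_split /= (exchange_big_dep (fun y => y \in Y)) /=; last by move=> x y _ /andP[].
under [X in _ + X]eq_bigr => y yY.
  rewrite inner; last by move=> x; rewrite (adj_sym I) => /andP[_ /andP[_ /andP[]]].
  over.
rewrite -big_split /= [RHS]big_mkcondr; apply: eq_bigr => v vY; rewrite nr //.
have [v0|v0] /= := eqVneq v rootv; first by rewrite addr0.
have [vp _] := parentP v0; have pv : adj I (parent v) v by rewrite (adj_sym I).
rewrite vp pv vY /=.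
case: (boolP (parent v \in Y)) => pY /=; last by rewrite addr0.
have : val (parent v) != val v by rewrite (inj_eq val_inj) parent_neq.
by rewrite neq_ltn; case: (ltngtP (parent v) v) => //= _ _; rewrite ?add0r ?addr0.
Qed.

Definition child_end (e : 'I_n * 'I_n) : 'I_n := if parent e.1 == e.2 then e.1 else e.2.

Lemma child_endP e : adj I e.1 e.2 -> child_end e != rootv /\
  (e = (child_end e, parent (child_end e)) \/ e = (parent (child_end e), child_end e)).
Proof.
case: e => x y /= xy; have xney : x != y by apply: contraTneq xy => ->; rewrite (adj_irr I).
rewrite /child_end /=; case: (parent x =P y) => [e|ne].
  by split; [apply: contra_neq xney => x0; rewrite -e x0 parent_root|left; rewrite e].
have /orP[/eqP//|/eqP e] := adj_parent xy.
by split; [apply: contra_neq xney => y0; rewrite -e y0 parent_root|right; rewrite e].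
Qed.

(** An edge is determined up to orientation by its child end, and the exclusive or in [edge_list]
    says that exactly one orientation is listed. Sums over the input thereby become sums over the
    nodes other than the root. *)
Lemma edges_children es : edge_list I es -> perm_eq (map child_end es) (enum (predC1 rootv)).
Proof.
move=> [ue ae xore]; apply: uniq_perm; rewrite ?enum_uniq //.
  rewrite map_inj_in_uniq // => e e' ein ein'.
  have [c0 h] := child_endP (ae e ein); have [_ h'] := child_endP (ae e' ein') => ec.
  rewrite -ec in h'; move: (child_end e) c0 h h' => c c0 h h' {ec}.
  have [cp _] := parentP c0; have := xore _ _ cp.
  case: h => he; case: h' => he'; rewrite -?he -?he' ?ein ?ein' //; by rewrite he he'.
move=> w; rewrite mem_enum inE; apply/mapP/idP => [[e ein ->]|w0].
  by have [] := child_endP (ae e ein).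
have [wp _] := parentP w0; have := xore _ _ wp.
have ce : child_end (w, parent w) = w by rewrite /child_end eqxx.
have ce' : child_end (parent w, w) = w.
  rewrite /child_end /=; case: eqP => // e.
  have := anc_parentF w0; rewrite -{1}e anc_parent //.
case win: ((w, parent w) \in es) => /=; first by exists (w, parent w).
by move=> win'; exists (parent w, w).
Qed.

Lemma size_edges es : edge_list I es -> size es = n.-1.
Proof.
by move=> /edges_children/perm_size; rewrite size_map -cardE cardC1 card_ord => ->.
Qed.

Lemma sum_edges (V : nmodType) es (f : 'I_n -> 'I_n -> V) : edge_list I es ->
  (forall x y, adj I x y -> f x y = f y x) ->
  \sum_(e <- es) f e.1 e.2 = \sum_(w | w != rootv) f w (parent w).
Proof.
move=> el fs; have [_ ae _] := el.
have -> : \sum_(w | w != rootv) f w (parent w) = \sum_(w <- enum (predC1 rootv)) f w (parent w).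
  by rewrite big_enum; apply: eq_bigl => w; rewrite inE.
rewrite -(perm_big _ (edges_children el)) /= big_map.
rewrite big_seq [RHS]big_seq; apply: eq_bigr => e ein.
have [c0 [h|h]] := child_endP (ae e ein); rewrite {1 2}h //=.
by apply: fs; have := ae e ein; rewrite {1 2}h.
Qed.

End Rooted.

(** * The objective as a weight of nodes and edges, and its dynamic program *)

Section Score.
Variables (R : realType) (n : nat) (I : instance R n).
Implicit Types (u v w x y : 'I_n) (Y : {set 'I_n}).
Notation rootv := (rootv I).
Notation parent := (parent I).
Notation rank := (rank I).
Notation anc := (anc I).
Notation pcost := (pcost I).

Definition covers u v : bool := dist I u v <= radius I u.

(** With [edge_gain], the P and Q of the overview; an edge is named by its child end. *)
Definition node_gain v : R := \sum_(u | covers u v) penalty I u.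

Definition edge_gain v : R := \sum_(u | covers u v && covers u (parent v)) penalty I u.

Lemma topped_neq Y r v : topped I Y r -> v \in Y ->
  (v != r) = (v != rootv) && (parent v \in Y).
Proof.
move=> tp vY; have [rY top] := tp; apply/idP/andP => [|[v0 pY]]; first exact: top.
by apply/eqP => e; rewrite e in v0 pY; have := topped_anc tp pY; rewrite anc_parentF.
Qed.

Lemma dist_setP u Y : Y != set0 ->
  (dist_set I u Y <= radius I u) = [exists y in Y, covers u y].
Proof.
move=> /set0Pn[y1 y1Y]; rewrite /dist_set; case: pickP => [y0 y0Y|/(_ y1)]; last by rewrite y1Y.
apply/idP/exists_inP => [|[y yY yc]].
  elim/big_rec: _ => [h|y x yY IH]; first by exists y0.
  by rewrite ge_min => /orP[h|/IH //]; exists y.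
by apply: le_trans yc; apply: bigmin_le_cond.
Qed.

(* Among the nodes of Y covering u, exactly one is r or has a parent that does
   not cover u, because the ball around u is connected. *)
Lemma cover_count Y r u : topped I Y r ->
  [exists y in Y, covers u y]%:R =
  \sum_(v in Y) (covers u v)%:R -
  \sum_(v in Y | v != r) (covers u v && covers u (parent v))%:R :> R.
Proof.
move=> tp; have [rY top] := tp.
pose tops v := covers u v && ((v == r) || ~~ covers u (parent v)).
have -> : \sum_(v in Y) (covers u v)%:R -
  \sum_(v in Y | v != r) (covers u v && covers u (parent v))%:R =
  \sum_(v in Y) (tops v)%:R :> R.
  rewrite [X in _ - X]big_mkcondr -sumrB; apply: eq_bigr => v _.
  rewrite /tops; case: (covers u v) => /=; last by case: ifP => _; rewrite subr0.
  by case: (v == r) => /=; rewrite ?subr0 //; case: (covers u _); rewrite ?subrr ?subr0.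
(* If v is not an ancestor of u, the path from u to v passes through the parent of v, which is no
   farther from u and is then covered as well. *)
have topP v : v \in Y -> tops v -> anc v u \/ v = r.
  move=> vY /andP[cv /orP[/eqP->|ncp]]; first by right.
  have [->|vr] := eqVneq v r; [by right|left].
  have [v0 pY] := top v vY vr; apply/negPn/negP => nvu.
  by move: ncp cv; rewrite /covers (dist_notin v0 nvu); have := pcost_ge0 I v; lra.
(* Of two covered ancestors of u, the parent of the lower one lies between the two; it is no farther
   from u than the upper one, so the lower one is not a top. *)
have uniqT v v' : v \in Y -> v' \in Y -> tops v -> tops v' -> (rank v' <= rank v)%N -> v' = v.
  move=> vY vY' tv tv' rle.
  have [vr|vr] := eqVneq v r.
    have rv' := topped_anc tp vY'; apply/esym; rewrite vr in rle *; apply: (anc_eq rv').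
    by apply/eqP; rewrite eqn_leq rle (anc_rank rv').
  have vu : anc v u by case: (topP v vY tv) => // e; rewrite e eqxx in vr.
  have vu' : anc v' u.
    by case: (topP v' vY' tv') => // ->; apply: anc_trans (topped_anc tp vY) vu.
  have v'v := anc_compare vu' vu rle.
  move: rle; rewrite leq_eqVlt => /predU1P[|rlt]; first exact: anc_eq.
  have [v0 pY] := top v vY vr; have [_ rp] := parentP v0.
  have v'p : anc v' (parent v).
    by apply: (anc_compare v'v (anc_parent I v)); rewrite rp in rlt.
  have pu := anc_trans (anc_parent I v) vu.
  move: tv tv'; rewrite /tops (negbTE vr) /= => /andP[_ ncp] /andP[cv' _].
  have e1 : dist I u (parent v) = depth I u - depth I (parent v).
    by rewrite (tree_dist_sym I) (dist_anc pu).
  have e2 : dist I u v' = depth I u - depth I v' by rewrite (tree_dist_sym I) (dist_anc vu').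
  by exfalso; move: ncp cv' (le_depth v'p); rewrite /covers e1 e2; clear; lra.
case: exists_inP => [[y yY cy]|none]; last first.
  rewrite big1 // => v vY; rewrite /tops; case cv: (covers u v) => //.
  by case: none; exists v.
have PY : (y \in Y) && covers u y by rewrite yY cy.
case: (@arg_minnP _ y (fun y => (y \in Y) && covers u y) rank PY) => z /andP[zY cz] zmin.
have tz : tops z.
  rewrite /tops cz /=; have [//|zr /=] := eqVneq z r.
  have [z0 pY] := top z zY zr; apply/negP => cp.
  have := zmin (parent z); rewrite pY cp => /(_ isT).
  by have [_ ->] := parentP z0; rewrite ltnn.
rewrite (bigD1 z) //= tz big1 ?addr0 // => v /andP[vY vz].
case tv: (tops v) => //; case/orP: (leq_total (rank v) (rank z)) => rle.
  by rewrite (uniqT z v) ?eqxx in vz.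
by rewrite (uniqT v z) ?eqxx in vz.
Qed.

Definition score Y r : R :=
  \sum_(v in Y) node_gain v - \sum_(v in Y | v != r) (pcost v + edge_gain v).

Lemma objectiveE Y r : topped I Y r -> objective I Y = \sum_u penalty I u - score Y r.
Proof.
move=> tp; have [rY _] := tp; have Y0 : Y != set0 by apply/set0Pn; exists r.
have sumC (P : pred 'I_n) : \sum_(u | P u) penalty I u = \sum_u penalty I u * (P u)%:R.
  by rewrite big_mkcond; apply: eq_bigr => u _; case: (P u); rewrite ?mulr1 ?mulr0.
rewrite /objective (setup_costE tp) /score big_split /=.
have -> : total_penalty I Y = \sum_u penalty I u -
    \sum_u penalty I u * ([exists y in Y, covers u y]%:R).
  rewrite /total_penalty -sumrB; apply: eq_bigr => u _; rewrite /node_penalty dist_setP //.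
  by case: ifP => _; rewrite ?mulr1 ?mulr0 ?subrr ?subr0.
under [X in _ - X]eq_bigr => u _ do rewrite (cover_count u tp) mulrBr !big_distrr /=.
rewrite sumrB exchange_big /= [X in _ - (_ - X)]exchange_big /=.
have -> : \sum_(v in Y) node_gain v = \sum_(v in Y) \sum_u penalty I u * (covers u v)%:R.
  by apply: eq_bigr => v _; rewrite /node_gain sumC.
have -> : \sum_(v in Y | v != r) edge_gain v = \sum_(v in Y | v != r)
    \sum_u penalty I u * (covers u v && covers u (parent v))%:R.
  by apply: eq_bigr => v _; rewrite /edge_gain sumC.
by lra.
Qed.

Lemma total_penalty1 v : total_penalty I [set v] = \sum_u penalty I u - node_gain v.
Proof.
rewrite /total_penalty /node_gain [X in _ - X]big_mkcond -sumrB; apply: eq_bigr => u _.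
rewrite /node_penalty dist_setP; last by apply/set0Pn; exists v; rewrite inE.
have -> : [exists y in [set v], covers u y] = covers u v.
  by apply/exists_inP/idP => [[y]|cv]; [rewrite inE => /eqP->|exists v; rewrite ?inE].
by case: ifP => _; rewrite ?subrr ?subr0.
Qed.

Section Dynamic.
Variable g : 'I_n -> R.
Let t w := g w - pcost w - edge_gain w.
Hypothesis gE : forall v, g v = node_gain v +
  \sum_(w | (w != rootv) && (parent w == v)) Num.max 0 (t w).

(** By [gE], the node gain of v is [g v] minus the positive branches at v. The value of a node of Y
    below the top then combines with the cost and gain of its edge into [t]. *)
Lemma scoreE Y r : topped I Y r -> score Y r = g r + \sum_(v in Y | v != r) t v -
  \sum_(w | (w != rootv) && (parent w \in Y)) Num.max 0 (t w).
Proof.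
move=> [rY _]; rewrite /score.
have -> : \sum_(v in Y) node_gain v = \sum_(v in Y) g v -
    \sum_(w | (w != rootv) && (parent w \in Y)) Num.max 0 (t w).
  have -> : \sum_(w | (w != rootv) && (parent w \in Y)) Num.max 0 (t w) =
     \sum_(v in Y) \sum_(w | (w != rootv) && (parent w == v)) Num.max 0 (t w).
    rewrite (exchange_big_dep (fun w => (w != rootv) && (parent w \in Y))) /=; last first.
      by move=> v w vY /andP[-> /eqP->].
    apply: eq_bigr => w /andP[w0 pY]; rewrite (eq_bigl (fun v => v == parent w)) ?big_pred1_eq //.
    by move=> v; rewrite w0 /= eq_sym; case: eqP => [->|]; rewrite ?pY ?andbF.
  by rewrite -sumrB; apply: eq_bigr => v _; rewrite gE; lra.
rewrite (bigD1 r rY) /=.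
have -> : \sum_(v in Y | v != r) t v =
    \sum_(v in Y | v != r) g v - \sum_(v in Y | v != r) (pcost v + edge_gain v).
  by rewrite -sumrB; apply: eq_bigr => v _; rewrite /t; lra.
by lra.
Qed.

Lemma split_kids Y r : topped I Y r ->
  \sum_(w | (w != rootv) && (parent w \in Y)) Num.max 0 (t w) =
  \sum_(v in Y | v != r) Num.max 0 (t v) +
  \sum_(w | [&& w \notin Y, w != rootv & parent w \in Y]) Num.max 0 (t w).
Proof.
move=> tp; rewrite (bigID (fun w => w \in Y)) /=; congr (_ + _); apply: eq_bigl => w.
  by rewrite andbC; case wY: (w \in Y) => //=; rewrite (topped_neq tp wY).
by rewrite andbC.
Qed.

(** A child kept in Y contributes [t], at most its positive part, and a child left out forfeits a
    nonnegative amount. So [g r] bounds every subtree with top r. *)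
Lemma score_le Y r : topped I Y r -> score Y r <= g r.
Proof.
move=> tp; rewrite (scoreE tp) (split_kids tp).
have : \sum_(v in Y | v != r) t v <= \sum_(v in Y | v != r) Num.max 0 (t v).
  by apply: ler_sum => v _; rewrite le_max lexx orbT.
have : 0 <= \sum_(w | [&& w \notin Y, w != rootv & parent w \in Y]) Num.max 0 (t w).
  by apply: sumr_ge0 => w _; rewrite le_max lexx.
by lra.
Qed.

(** The conditions on the kept and on the omitted children are those under which both losses in
    [score_le] vanish. *)
Lemma dynamic_optimal Y r : topped I Y r ->
  {in Y, forall v, v != r -> 0 <= t v} ->
  (forall v, v \notin Y -> v != rootv -> parent v \in Y -> t v <= 0) ->
  (forall v, g v <= g r) -> optimal_subtree I Y.
Proof.
move=> tp tge tle gmax; split; first exact: topped_subtree tp.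
move=> Z /subtree_topped[r' tp']; rewrite (objectiveE tp) (objectiveE tp').
suff -> : score Y r = g r by have := score_le tp'; have := gmax r'; lra.
rewrite (scoreE tp) (split_kids tp).
rewrite [X in _ - (X + _)](eq_bigr t); last by move=> v /andP[vY vr]; rewrite max_r // tge.
rewrite [X in _ - (_ + X)]big1; last by move=> v /and3P[vY v0 pY]; rewrite max_l // tle.
by lra.
Qed.

End Dynamic.
End Score.

(** * Items and the initial cluster tree *)

Section Items.
Variables (R : realType) (n : nat) (I : instance R n).
Notation rootv := (rootv I).
Notation parent := (parent I).
Notation rank := (rank I).
Notation anc := (anc I).
Notation depth := (depth I).

Definition nodeof (k : nat) : 'I_n := insubd rootv k.

Lemma nodeofK (v : 'I_n) : nodeof v = v.
Proof. by apply: val_inj; rewrite val_insubd ltn_ord. Qed.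

Lemma val_nodeof k : (k < n)%N -> nodeof k = k :> nat.
Proof. by move=> kn; rewrite val_insubd kn. Qed.

Definition pn (k : nat) : nat := parent (nodeof k).

(* Item v is a dummy copy of the parent of v, item n + v the edge above v, and
   item 2n + v the node v; hi and lo are the ends of an item. *)
Definition hi (k : nat) : 'I_n :=
  if (k < n)%N then parent (nodeof k) else
  if (k < 2 * n)%N then parent (nodeof (k - n)) else nodeof (k - 2 * n).

Definition lo (k : nat) : 'I_n :=
  if (k < n)%N then parent (nodeof k) else
  if (k < 2 * n)%N then nodeof (k - n) else nodeof (k - 2 * n).

Definition ipi (k : nat) : R := if (k < 2 * n)%N then 0 else penalty I (nodeof (k - 2 * n)).
Definition irho (k : nat) : R := if (k < 2 * n)%N then 0 else radius I (nodeof (k - 2 * n)).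

(** With the maximum over the ends, an edge item is within the radius of a node item exactly when
    both ends of the edge are, as [edge_gain] requires. *)
Definition idist (i j : nat) : R :=
  Num.max (Num.max (dist I (hi i) (hi j)) (dist I (hi i) (lo j)))
          (Num.max (dist I (lo i) (hi j)) (dist I (lo i) (lo j))).

(** Levels of width [4 * n], one for each rank of a node. Inside a level the dummies come first, in
    the order of their labels as in a chain of siblings, then the edge items, then the node
    items. *)
Definition irank (k : nat) : nat :=
  if (k < n)%N then (rank (nodeof k) * (4 * n) + k)%N else
  if (k < 2 * n)%N then (rank (nodeof (k - n)) * (4 * n) + 2 * n)%N
  else (rank (nodeof (k - 2 * n)) * (4 * n) + 3 * n)%N.

Lemma items_ind (P : nat -> Prop) : (forall v, (v < n)%N -> P v) ->
  (forall v, (v < n)%N -> P (n + v)%N) -> (forall v, (v < n)%N -> P (2 * n + v)%N) ->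
  forall k, (k < 3 * n)%N -> P k.
Proof.
move=> h1 h2 h3 k k3; have [kn|kn] := ltnP k n; first exact: h1.
have [k2|k2] := ltnP k (2 * n).
  by rewrite -(subnKC kn); apply: h2; clear -k2 kn; lia.
by rewrite -(subnKC k2); apply: h3; clear -k2 k3; lia.
Qed.

Let c1 v : (n + v < n)%N = false. Proof. by lia. Qed.
Let c2 v : (v < n)%N -> (n + v < 2 * n)%N. Proof. by lia. Qed.
Let c3 v : (2 * n + v < n)%N = false. Proof. by have := node_gt0 I; lia. Qed.
Let c4 v : (2 * n + v < 2 * n)%N = false. Proof. by lia. Qed.
Let c5 v : (n + v - n = v)%N. Proof. by lia. Qed.
Let c6 v : (2 * n + v - 2 * n = v)%N. Proof. by lia. Qed.

Lemma hiD v : (v < n)%N -> hi v = parent (nodeof v). Proof. by rewrite /hi => ->. Qed.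
Lemma loD v : (v < n)%N -> lo v = parent (nodeof v). Proof. by rewrite /lo => ->. Qed.
Lemma hiE v : (v < n)%N -> hi (n + v) = parent (nodeof v).
Proof. by move=> vn; rewrite /hi c1 c2 // c5. Qed.
Lemma loE v : (v < n)%N -> lo (n + v) = nodeof v.
Proof. by move=> vn; rewrite /lo c1 c2 // c5. Qed.
Lemma hiN v : hi (2 * n + v) = nodeof v. Proof. by rewrite /hi c3 c4 c6. Qed.
Lemma loN v : lo (2 * n + v) = nodeof v. Proof. by rewrite /lo c3 c4 c6. Qed.
Lemma irankD v : (v < n)%N -> irank v = (rank (nodeof v) * (4 * n) + v)%N.
Proof. by rewrite /irank => ->. Qed.
Lemma irankE v : (v < n)%N -> irank (n + v) = (rank (nodeof v) * (4 * n) + 2 * n)%N.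
Proof. by move=> vn; rewrite /irank c1 c2 // c5. Qed.
Lemma irankN v : irank (2 * n + v) = (rank (nodeof v) * (4 * n) + 3 * n)%N.
Proof. by rewrite /irank c3 c4 c6. Qed.
Lemma ipiN v : ipi (2 * n + v) = penalty I (nodeof v). Proof. by rewrite /ipi c4 c6. Qed.
Lemma irhoN v : irho (2 * n + v) = radius I (nodeof v). Proof. by rewrite /irho c4 c6. Qed.

Lemma anc_hi_lo k : anc (hi k) (lo k).
Proof.
rewrite /hi /lo; case: ifP => _; first exact: anc_refl.
by case: ifP => _; [apply: anc_parent|apply: anc_refl].
Qed.

Lemma idist_sym i j : idist i j = idist j i.
Proof.
rewrite /idist; rewrite !(tree_dist_sym I (hi i)) !(tree_dist_sym I (lo i)).
by rewrite maxACA.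
Qed.

Lemma max4 (a b c d m : R) : a <= m -> b <= m -> c <= m -> d <= m ->
  [\/ a = m, b = m, c = m | d = m] -> Num.max (Num.max a b) (Num.max c d) = m.
Proof.
move=> am bm cm dm h; apply/eqP; rewrite eq_le !ge_max am bm cm dm /= !le_max.
by case: h => ->; rewrite lexx ?orbT.
Qed.

(** Siblings form a chain of dummies in increasing order of labels: a dummy hangs below that of the
    preceding sibling or, for the first child, below the node item of the parent. Each dummy carries
    the edge item of its own node, which carries the node item. Item 0, the dummy of the root, is
    the root of the cluster tree. *)
Record cluster_parent (par : nat -> nat) : Prop := {
  cp_root : par 0%N = 0%N;
  cp_edge : forall v, (v < n)%N -> par (n + v)%N = v;
  cp_node : forall v, (v < n)%N -> par (2 * n + v)%N = (n + v)%N;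
  cp_dummy : forall w, (0 < w < n)%N ->
    (exists u, [/\ (0 < u < w)%N, pn u = pn w, par w = u &
       forall z, (u < z < w)%N -> pn z <> pn w]) \/
    (par w = (2 * n + pn w)%N /\ forall z, (0 < z < w)%N -> pn z <> pn w) }.

Section Initial.
Variable par : nat -> nat.
Hypothesis cp : cluster_parent par.

Let pnK v : (v < n)%N -> parent (nodeof v) = nodeof (pn v).
Proof. by move=> vn; rewrite /pn nodeofK. Qed.

Let pn_lt v : (pn v < n)%N. Proof. exact: ltn_ord. Qed.

(* i lies at the dummy of w, or below w *)
Let side (w : 'I_n) i := (lo i = parent w \/ anc w (lo i)) /\ (hi i = parent w \/ anc w (hi i)).

(** What lies below a cluster, in terms of the tree: below a dummy C, its own branch and those of
    the later siblings in the chain. *)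
Let under C i :=
  if (C < n)%N then (C == 0%N) \/
    exists w', [/\ (C <= w')%N, (w' < n)%N, pn w' = pn C & side (nodeof w') i]
  else if (C < 2 * n)%N then i = C \/ anc (nodeof (C - n)) (hi i)
  else anc (nodeof (C - 2 * n)) (hi i).

Let underE v i : (v < n)%N -> under (n + v) i = (i = (n + v)%N \/ anc (nodeof v) (hi i)).
Proof. by move=> vn; rewrite /under c1 c2 // c5. Qed.
Let underN v i : under (2 * n + v) i = anc (nodeof v) (hi i).
Proof. by rewrite /under c3 c4 c6. Qed.

Let par_lt k : (k < 3 * n)%N -> (par k < 3 * n)%N.
Proof.
move: k; apply: items_ind => v vn.
- have [->|v0] := posnP v; first by rewrite (cp_root cp); have := node_gt0 I; clear; lia.
  have vr : (0 < v < n)%N by rewrite v0.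
  have [[u [ub _ -> _]]|[-> _]] := cp_dummy cp vr; first by clear -ub vn; lia.
  by have := pn_lt v; clear; lia.
- by rewrite (cp_edge cp) //; clear -vn; lia.
- by rewrite (cp_node cp) //; clear -vn; lia.
Qed.

Let under_iter m i : (i < 3 * n)%N -> under (iter m par i) i /\ (iter m par i < 3 * n)%N.
Proof.
move=> iK; elim: m => [|m [IH lt]] /=.
  split=> //; move: i iK; apply: items_ind => v vn.
  - rewrite /under vn; have [->|v0] := eqVneq v 0%N; [by left|right; exists v].
    by rewrite /side hiD // loD //; split=> //; split; left.
  - by rewrite underE //; left.
  - by rewrite underN hiN anc_refl.
split; last exact: par_lt.
move: (iter m par i) lt IH; apply: items_ind => v vn.
- rewrite {1}/under vn; have [->|v0] := posnP v.
    by rewrite (cp_root cp) /under => _; have := node_gt0 I => ->; left.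
  case=> [//|[w' [vw wn pw [sl sh]]]].
  have vr : (0 < v < n)%N by rewrite v0.
  have [[u [/andP[u0 uv] pu -> _]]|[-> _]] := cp_dummy cp vr.
    rewrite /under (ltn_trans uv vn); right; exists w'.
    by rewrite pw pu (leq_trans (ltnW uv) vw).
  rewrite underN -pnK // pnK // -pw -pnK //; case: sh => [->|h]; first exact: anc_refl.
  exact: anc_trans (anc_parent I _) h.
- rewrite underE // (cp_edge cp) // => h; rewrite /under vn.
  have [->|v0] := eqVneq v 0%N; [by left|right; exists v; split=> //].
  case: h => [->|h]; first by rewrite /side loE // hiE //; split; [right; apply: anc_refl|left].
  by split; right=> //; apply: anc_trans h (anc_hi_lo i).
- by rewrite underN (cp_node cp) // underE //; right.
Qed.

Let below a b : (a < 3 * n)%N -> (b < 3 * n)%N -> above par a b -> a != b -> anc (lo a) (hi b).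
Proof.
move=> aK bK [m e] ne; have [+ _] := under_iter m bK; rewrite {m}e.
move: a aK ne; apply: items_ind => v vn ne.
- rewrite /under vn loD //; have [-> _|v0] := posnP v.
    have -> : nodeof 0 = rootv by apply: val_inj; rewrite /= val_nodeof ?(node_gt0 I).
    by rewrite parent_root root_anc.
  case=> [//|[w' [vw wn pw [_ sh]]]].
  rewrite pnK // -pw -pnK //; case: sh => [->|h]; first exact: anc_refl.
  exact: anc_trans (anc_parent I _) h.
- by rewrite underE // loE //; case=> // e; rewrite e eqxx in ne.
- by rewrite underN loN.
Qed.

(** Vertical distances are differences of depths, so the farthest ends are the upper end of a and
    the lower end of b. *)
Let idist_below a b : anc (lo a) (hi b) -> idist a b = - depth (hi a) + depth (lo b).
Proof.
move=> h; have ha := anc_hi_lo a; have hb := anc_hi_lo b.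
rewrite /idist (dist_anc (anc_trans ha h)) (dist_anc (anc_trans ha (anc_trans h hb))).
rewrite (dist_anc h) (dist_anc (anc_trans h hb)).
have := le_depth ha; have := le_depth hb => d1 d2.
by apply: max4; [lra|lra|lra|lra|apply: Or42; lra].
Qed.

(** On sibling branches the farthest ends are both lower ends; [side] lets an end coincide with the
    common parent. *)
Let idist_side (v w : 'I_n) a b : v != rootv -> w != rootv -> v != w -> parent v = parent w ->
  side v a -> side w b -> idist a b = depth (lo a) + depth (lo b) - 2 * depth (parent v).
Proof.
move=> v0 w0 vw pvw [la ha] [lb hb].
have dE y z : y = parent v \/ anc v y -> z = parent w \/ anc w z ->
    dist I y z = depth y + depth z - 2 * depth (parent v).
  move=> [->|vy] [->|wz].
  - by rewrite -pvw dist_anc ?anc_refl //; lra.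
  - rewrite dist_anc; first by lra.
    by rewrite pvw; apply: anc_trans (anc_parent I w) wz.
  - rewrite (tree_dist_sym I) -pvw dist_anc; first by lra.
    exact: anc_trans (anc_parent I v) vy.
  - exact: (dist_branch v0 w0 vw pvw vy wz).
rewrite /idist !dE //.
have := le_depth (anc_hi_lo a); have := le_depth (anc_hi_lo b) => d1 d2.
by apply: max4; [lra|lra|lra|lra|apply: Or44; lra].
Qed.

(** A dummy has one successor in its chain and a node one first child: of two dummies with the same
    parent, the smaller would contradict the choice of the parent of the larger. *)
Let dummy_inj w w' : (0 < w < n)%N -> (0 < w' < n)%N -> par w = par w' -> w = w'.
Proof.
wlog lt : w w' / (w < w')%N => [hw|].
  have [/hw|/hw h|//] := ltngtP w w'; first by apply.
  by move=> wn wn' e; apply/esym/h.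
move=> wn wn' e; case: (cp_dummy cp wn') => [[u [ub pu pe no]]|[pe no]].
  case: (cp_dummy cp wn) => [[u' [ub' pu' pe' _]]|[pe' _]]; last first.
    by rewrite e pe in pe'; move: ub wn' pe'; clear; lia.
  have uu : u' = u by rewrite -pe' -pe e.
  case: (no w); last by rewrite -pu' uu.
  by move: ub' lt; rewrite uu; clear; lia.
case: (cp_dummy cp wn) => [[u' [ub' pu' pe' _]]|[pe' _]].
  by rewrite e pe in pe'; move: ub' wn pe'; clear; lia.
case: (no w); first by move: wn lt; clear; lia.
by move: pe'; rewrite e pe => /addnI.
Qed.

(** The edge item [n + k] can be a child of dummy k only; besides it there is at most one child, the
    next dummy of a chain or the node item of an edge. This is what the dummies are for. *)
Let nkids2 k : (k < 3 * n)%N -> (nkids (3 * n) id par k <= 2)%N.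
Proof.
move=> kK; rewrite /nkids.
have unq : uniq (kids (3 * n) id par k) by rewrite filter_uniq ?lives_uniq.
have mem c : c \in kids (3 * n) id par k -> [/\ (c < 3 * n)%N, c != 0%N & par c = k].
  by rewrite mem_filter mem_lives => /andP[/andP[c0 /eqP pc] /andP[cK _]].
have dn w : (0 < w < n)%N -> par w = k -> (k < n)%N \/ (2 * n <= k)%N.
  move=> wr; case: (cp_dummy cp wr) => [[u [ub _ -> _]]|[-> _]] <-; last by right; rewrite leq_addr.
  by left; move: ub wr; clear; lia.
have kindP c : c \in kids (3 * n) id par k ->
    [\/ c = (n + k)%N, (0 < c < n)%N /\ par c = k |
        (n <= k < 2 * n)%N /\ c = (2 * n + (k - n))%N].
  move=> /mem[cK c0 pc]; move: c cK c0 pc; apply: items_ind => v vn c0 pc.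
  - by apply: Or32; rewrite lt0n c0.
  - by apply: Or31; rewrite -pc (cp_edge cp).
  - apply: Or33; rewrite -pc (cp_node cp) //; split; last by rewrite addKn.
    by clear -vn; lia.
set x := (n + k)%N.
have eqs y z : y \in kids (3 * n) id par k -> z \in kids (3 * n) id par k ->
    y != x -> z != x -> y = z.
  move=> /kindP[->|[yr py]|[kr ->]] /kindP[->|[zr pz]|[kr' ->]];
    rewrite /x ?eqxx // => _ _.
  - by apply: dummy_inj; rewrite // py.
  - by case: (dn _ yr py); move: kr'; clear; lia.
  - by case: (dn _ zr pz); move: kr; clear; lia.
have [/hasP[z0 z0s z0n]|/hasPn none] := boolP (has (predC1 x) (kids (3 * n) id par k)).
  apply: (@uniq_leq_size _ _ [:: x; z0]) => // c cs; rewrite !inE.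
  by have [//|cx /=] := eqVneq c x; apply/eqP; apply: eqs.
apply: leq_trans (_ : 1 <= 2)%N => //; apply: (@uniq_leq_size _ _ [:: x]) => // c cs.
by have := none c cs; rewrite !inE negbK.
Qed.

(** The invariant for singleton clusters, with upper key the depth of the lower end and lower key
    minus the depth of the upper end. In its own cluster an item meets only itself, and as radii may
    be negative, a node need not cover itself. *)
Lemma initial_contraction acc :
  (forall v, (v < n)%N -> [/\ acc v = 0, acc (n + v)%N = 0 &
     acc (2 * n + v)%N = if 0 <= radius I (nodeof v) then penalty I (nodeof v) else 0]) ->
  contraction_inv (3 * n) idist (fun k => depth (lo k)) (fun k => depth (hi k)) ipi irho irank
    id par (fun k => - depth (hi k)) acc.
Proof.
move=> accE; have n0 := node_gt0 I.
have liveT k : (k < 3 * n)%N -> live (3 * n) id k by move=> kK; apply/liveP; exists k.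
have n0E : nodeof 0 = rootv by apply: val_inj; rewrite /= val_nodeof.
have nz v : (0 < v < n)%N -> nodeof v != rootv.
  move=> /andP[v0 vn]; apply/eqP => /(congr1 val); rewrite /= val_nodeof // => e.
  by rewrite e in v0.
split=> //.
- by apply: liveT; clear -n0; lia.
- exact: (cp_root cp).
- move=> k kK k0 _; split; [exact: par_lt|exact/liveT/par_lt|].
  move: k kK k0; apply: items_ind => v vn v0.
  + have vr : (0 < v < n)%N by rewrite lt0n v0.
    have [_ rv] := parentP (nz v vr); rewrite (irankD vn) rv.
    have [[u [ub pu -> _]]|[-> _]] := cp_dummy cp vr.
      have un : (0 < u < n)%N by move: ub vn; clear; lia.
      have [_ ru] := parentP (nz u un); have un' : (u < n)%N by case/andP: un.
      rewrite (irankD un') ru (pnK un') pu -pnK //.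
      by case/andP: ub => _; rewrite ltn_add2l.
    by rewrite irankN -pnK //; clear -n0; nia.
  + by rewrite (cp_edge cp) // (irankD vn) (irankE vn); clear -vn; lia.
  + by rewrite (cp_node cp) // irankN (irankE vn); clear -vn; lia.
- by move=> a b aK bK ab ne; apply: idist_below; apply: below.
(* The only siblings in the cluster tree are the edge item of a node v and the dummy that follows
   the one of v in its chain. The items below that dummy belong to branches of later siblings of
   v. *)
- have main v w a b : (v < n)%N -> (0 < w < n)%N -> par w = v -> (a < 3 * n)%N -> (b < 3 * n)%N ->
      above par (n + v)%N a -> above par w b ->
      idist a b = depth (lo a) + depth (lo b) - 2 * depth (parent (nodeof v)) /\
      parent (nodeof v) = parent (nodeof w).
    move=> vn wr pw aK bK [m ea] [m' eb].
    have [ua _] := under_iter m aK; have [ub _] := under_iter m' bK.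
    rewrite ea underE // in ua; rewrite eb /under in ub; case/andP: (wr) => w0 wn.
    rewrite wn in ub; case: ub => [/eqP e|[w' [ww wn' pw' sb]]]; first by rewrite e in w0.
    case: (cp_dummy cp wr) => [[u [ur pu pe _]]|[pe _]]; last by rewrite pw in pe; move: vn pe; clear; lia.
    have uv : u = v by rewrite -pe.
    rewrite {}uv {pe} in ur pu *.
    have vr : (0 < v < n)%N by move: ur vn; clear; lia.
    have wr' : (0 < w' < n)%N by move: ww wn' w0; clear; lia.
    have pe : parent (nodeof v) = parent (nodeof w) by rewrite !pnK // pu.
    have pe' : parent (nodeof v) = parent (nodeof w') by rewrite !pnK // pw' pu.
    split=> //; apply: (@idist_side (nodeof v) (nodeof w')) => //; try exact: nz.
    + apply/eqP => /(congr1 val); rewrite /= !val_nodeof // => e.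
      by move: ur ww; rewrite e; clear; lia.
    + case: ua => [->|h]; first by rewrite /side loE // hiE //; split; [right; apply: anc_refl|left].
      by split; right=> //; apply: anc_trans h (anc_hi_lo a).
  have dE w : (0 < w < n)%N -> (par w < n)%N \/ (2 * n <= par w)%N.
    move=> wr; case: (cp_dummy cp wr) => [[u [ub _ -> _]]|[-> _]]; last by right; rewrite leq_addr.
    by left; move: ub wr; clear; lia.
  move=> B B' a b BK BK' _ _ B0 B0' ne pe aK bK ha hb.
  move: B BK B0 ne pe ha; apply: items_ind => v vn v0; move: B' BK' B0' hb; apply: items_ind => w wn w0 hb.
  + move=> ne pe; have e : v = w by apply: dummy_inj; rewrite ?lt0n ?v0 ?w0.
    by rewrite e eqxx in ne.
  + rewrite (cp_edge cp) // => ne pe ha; have vr : (0 < v < n)%N by rewrite lt0n v0.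
    have [h p] := main w v b a wn vr pe bK aK hb ha.
    by rewrite idist_sym h (hiD vn) p [depth (lo b) + _]addrC.
  + rewrite (cp_node cp) // => _ pe; have := dE v; rewrite lt0n v0 vn pe => /(_ isT).
    by move=> h; exfalso; move: h wn; clear; lia.
  + rewrite (cp_edge cp) // => ne pe ha; have wr : (0 < w < n)%N by rewrite lt0n w0.
    have [h p] := main v w a b vn wr (esym pe) aK bK ha hb.
    by rewrite h (hiE vn).
  + by rewrite !(cp_edge cp) // => + e; rewrite e eqxx.
  + by rewrite (cp_edge cp) // (cp_node cp) // => _ e; exfalso; move: e vn; clear; lia.
  + rewrite (cp_node cp) // => _ pe; have := dE w; rewrite lt0n w0 wn -pe => /(_ isT).
    by move=> h; exfalso; move: h vn; clear; lia.
  + by rewrite (cp_edge cp) // (cp_node cp) // => _ e; exfalso; move: e wn; clear; lia.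
  + by rewrite !(cp_node cp) // => + /addnI e; rewrite e eqxx.
- move=> i iK; rewrite -big_filter filter_pred1_uniq ?iota_uniq ?mem_iota // big_seq1.
  move: i iK; apply: items_ind => v vn; have [a1 a2 a3] := accE v vn.
  + by rewrite a1 /ipi (_ : v < 2 * n)%N ?if_same //; clear -vn; lia.
  + by rewrite a2 /ipi c2 // if_same.
  + rewrite a3 ipiN irhoN /idist hiN loN dist_anc ?anc_refl // subrr.
    by rewrite !maxxx.
Qed.

End Initial.

(** Dummies and edges carry no penalty, so the node items are the only customers. *)
Lemma item_sum i : \sum_(j <- iota 0 (3 * n)) (if idist i j <= irho j then ipi j else 0) =
  \sum_u (if (dist I (hi i) u <= radius I u) && (dist I (lo i) u <= radius I u)
           then penalty I u else 0).
Proof.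
have -> : (3 * n = 2 * n + n)%N by lia.
rewrite iotaD big_cat /= big_seq big1 ?add0r; last first.
  move=> j; rewrite mem_iota add0n => /andP[_ j2]; rewrite /ipi j2 if_same //.
rewrite add0n -[X in iota X]addn0 iotaDl big_map -[n in iota _ n]subn0 -/(index_iota 0 n) big_mkord.
apply: eq_bigr => u _; rewrite irhoN ipiN nodeofK /idist hiN loN nodeofK !maxxx ge_max.
by [].
Qed.

Lemma item_sum_node v : (v < n)%N ->
  \sum_(j <- iota 0 (3 * n)) (if idist (2 * n + v) j <= irho j then ipi j else 0) =
  node_gain I (nodeof v).
Proof.
move=> vn; rewrite item_sum /node_gain [RHS]big_mkcond; apply: eq_bigr => u _.
by rewrite hiN loN andbb /covers (tree_dist_sym I).
Qed.

Lemma item_sum_edge v : (v < n)%N ->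
  \sum_(j <- iota 0 (3 * n)) (if idist (n + v) j <= irho j then ipi j else 0) =
  edge_gain I (nodeof v).
Proof.
move=> vn; rewrite item_sum /edge_gain [RHS]big_mkcond; apply: eq_bigr => u _.
by rewrite hiE // loE // andbC /covers !(tree_dist_sym I u).
Qed.

End Items.

(** * Rooting the tree by peeling leaves *)

Notation incr a i e := (CWSet a i (WAdd (WGet a i) e)).
Notation rincr a i e := (CRSet a i (RAdd (RGet a i) e)).

(** Word arrays 6 and 7 receive the degree and the sum of the neighbour labels, real array 3 the sum
    of the incident costs. At a node with one remaining neighbour, these sums are that neighbour and
    the cost of the edge to it; removing a node takes a subtraction at its neighbour. *)
Definition degrees_loop : cmd :=
  For 4 (WSub (var 0) w1)
   (39 <-- WGet 1 (var 4) ;; 40 <-- WGet 2 (var 4) ;;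
    incr 6 (var 39) w1 ;; incr 6 (var 40) w1 ;;
    incr 7 (var 39) (var 40) ;; incr 7 (var 40) (var 39) ;;
    rincr 3 (var 39) (RGet 0 (var 4)) ;; rincr 3 (var 40) (RGet 0 (var 4))).

Definition push (i : nat) : cmd := CWSet 8 (var 9) (var i) ;; 9 <-- WAdd (var 9) w1.

Definition leaves_loop : cmd :=
  For 4 (var 0) (CIf (TWeq (WGet 6 (var 4)) w1) (push 4) CSkip).

Definition peel_loop : cmd :=
  For 4 (var 0)
   (39 <-- WGet 8 (var 4) ;; 40 <-- WGet 7 (var 39) ;;
    CWSet 10 (var 39) (var 40) ;; CRSet 4 (var 39) (RGet 3 (var 39)) ;;
    CWSet 6 (var 40) (WSub (WGet 6 (var 40)) w1) ;;
    CWSet 7 (var 40) (WSub (WGet 7 (var 40)) (var 39)) ;;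
    CRSet 3 (var 40) (RSub (RGet 3 (var 40)) (RGet 4 (var 39))) ;;
    CIf (TWeq (WGet 6 (var 40)) w1) (push 40) CSkip).

(** Node 0 is given one more unit of degree, a phantom edge to a parent, so that it does not count
    as a leaf before all its children are removed. *)
Definition peel : cmd := degrees_loop ;; incr 6 w0 w1 ;; leaves_loop ;; peel_loop.

Section Peel.
Variables (R : realType) (n : nat) (I : instance R n) (es : seq ('I_n * 'I_n)) (W : nat).
Hypothesis el : edge_list I es.
Hypothesis nW : (20 * n * n + 100 < W)%N.
Implicit Types (s : state R).
Notation rootv := (rootv I).
Notation parent := (parent I).
Notation rank := (rank I).
Notation pcost := (pcost I).
Notation nodeof := (nodeof I).
Notation pn := (pn I).

Let n0 : (0 < n)%N := node_gt0 I.
Let nn : (n <= n * n)%N. Proof. by nia. Qed.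
Let wc1 : (1 %% W = 1)%N. Proof. by rewrite modn_small //; lia. Qed.
Let nW1 : (n < W)%N. Proof. by clear -nW nn; lia. Qed.

Definition inc (T : nmodType) v (x y : T) (e : 'I_n * 'I_n) : T :=
  (if val e.1 == v then x else 0) + (if val e.2 == v then y else 0).

Lemma inc_step (T : nmodType) (f : nat -> T) v x y (e : 'I_n * 'I_n) : (val e.1 == val e.2) = false ->
  (if v == val e.2 then f (val e.2) + y else if v == val e.1 then f (val e.1) + x else f v) =
  f v + inc v x y e.
Proof.
move=> ne; rewrite /inc; case: (v =P val e.2) => [->|n2]; first by rewrite ne eqxx add0r.
have -> : (val e.2 == v) = false by apply/eqP => h; case: n2.
rewrite addr0; case: (v =P val e.1) => [->|n1]; first by rewrite eqxx.
by have -> : (val e.1 == v) = false; [apply/eqP => h; case: n1|rewrite addr0].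
Qed.

Definition degrees_inv i s : Prop :=
  [/\ same_off [:: 4; 39; 40; 6; 7]%N [:: 3]%N (input I es) s,
      forall v, wmem s 6 v = (\sum_(e <- take i es) inc v 1 1 e)%N,
      forall v, wmem s 7 v = (\sum_(e <- take i es) inc v (val e.2) (val e.1) e)%N &
      forall v, rmem s 3 v = \sum_(e <- take i es) inc v (cost I e.1 e.2) (cost I e.1 e.2) e].

Lemma degrees_run : runs W degrees_loop (input I es) (n * 100) (degrees_inv n.-1).
Proof.
rewrite /degrees_loop; set body := (X in For _ _ X).
have szE := size_edges el; have [_ ae _] := el.
have n1W : (n.-1 < W)%N by clear -nW1; lia.
have H := @runs_for_lf R W 4 (WSub (var 0) w1) n.-1 body (input I es) degrees_inv n1W isT isT.
apply: runs_weaken (H _ _ _ _) _ _ => {H} //.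
- move=> k s x [sm h1 h2 h3]; split=> //.
  by apply: same_off_trans sm _; apply: same_off_upd.
- by move=> k s _ [sm _ _ _]; rewrite /= mod0n wc1 sm.1 //= subn1.
- move=> k s kn e4 [sm h1 h2 h3].
  have kE : (k < size es)%N by rewrite szE.
  pose o := rootv; pose e := nth (o, o) es k.
  have e1 : wmem s 1 k = e.1 by rewrite sm.1 //= (nth_map (o, o)).
  have e2 : wmem s 2 k = e.2 by rewrite sm.1 //= (nth_map (o, o)).
  have ec : rmem s 0 k = cost I e.1 e.2 by rewrite sm.2 //= (nth_map (o, o)).
  have ad : adj I e.1 e.2 by apply: ae; rewrite mem_nth.
  have ne : (val e.1 == val e.2) = false.
    by apply/negbTE; rewrite (inj_eq val_inj); apply: contraTneq ad => ->; rewrite (adj_irr I).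
  have tk : take k.+1 es = rcons (take k es) e by rewrite (take_nth (o, o)).
  have szt : size (take k es) = k by rewrite size_takel // ltnW.
  have b1 v : (\sum_(e <- take k es) inc v 1 1 e <= 2 * n)%N.
    apply: (@leq_trans (\sum_(e <- take k es) 2)); last first.
      by rewrite big_const_seq count_predT iter_addn_0 szt; clear -kn; lia.
    by apply: leq_sum => f _; rewrite /inc; do 2!case: ifP.
  have b2 v : (\sum_(e <- take k es) inc v (val e.2) (val e.1) e <= 2 * n * n)%N.
    apply: (@leq_trans (\sum_(e <- take k es) (2 * n))); last first.
      by rewrite big_const_seq count_predT iter_addn_0 szt; clear -kn; nia.
    apply: leq_sum => f _; rewrite /inc mul2n -addnn; apply: leq_add.
      by case: ifP => // _; apply/ltnW/ltn_ord.
    by case: ifP => // _; apply/ltnW/ltn_ord.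
  have a1 := ltn_ord e.1; have a2 := ltn_ord e.2.
  pose s2 := State (upd (upd (upd (upd (upd (upd (wmem s) 39 0 (val e.1)) 40 0 (val e.2))
     6 e.1 (wmem s 6 e.1 + 1)%N) 6 e.2 (wmem s 6 e.2 + 1)%N)
     7 e.1 (wmem s 7 e.1 + e.2)%N) 7 e.2 (wmem s 7 e.2 + e.1)%N)
     (upd (upd (rmem s) 3 e.1 (rmem s 3 e.1 + cost I e.1 e.2)) 3 e.2 (rmem s 3 e.2 + cost I e.1 e.2)).
  have -> : sexec W body s = s2.
    rewrite /= !mod0n e4 e1 e2 ec wc1 [(val e.2 == val e.1)]eq_sym ne /=.
    have m1 v : ((wmem s 6 v + 1) %% W = wmem s 6 v + 1)%N.
      by rewrite modn_small // h1; have := b1 v; clear -nW nn; lia.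
    have m2 v (x : 'I_n) : ((wmem s 7 v + x) %% W = wmem s 7 v + x)%N.
      by rewrite modn_small // h2; have := b2 v; have := ltn_ord x; clear -nW nn; lia.
    by rewrite !m1 !m2.
  split.
  + apply: same_off_trans sm _; split=> c j; rewrite /= !inE ?negb_or.
      by move=> /and5P[_ /negbTE-> /negbTE-> /negbTE-> /negbTE->].
    by move=> /negbTE->.
  + move=> v; rewrite tk -cats1 big_cat big_seq1 /= -h1.
    exact: (@inc_step nat (wmem s 6) v 1%N 1%N).
  + move=> v; rewrite tk -cats1 big_cat big_seq1 /= -h2.
    exact: (@inc_step nat (wmem s 7) v (val e.2) (val e.1)).
  + by move=> v; rewrite tk -cats1 big_cat big_seq1 /= -h3; apply: inc_step.
- by split=> [//|v|v|v]; rewrite take0 big_nil //=.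
- rewrite prednK // leq_mul2l /=; by rewrite orbT.
Qed.

Definition kid v (A : seq nat) (w : 'I_n) : bool :=
  [&& w != rootv, val (parent w) == v & val w \notin A].

(** Splits a sum accumulated at a node into the part of its parent and the part of its children. *)
Lemma inc_edges (T : nmodType) v (f : 'I_n -> 'I_n -> T) : (v < n)%N ->
  (forall x y, adj I x y -> inc v (f x y) (f y x) (x, y) = inc v (f y x) (f x y) (y, x)) ->
  \sum_(e <- es) inc v (f e.1 e.2) (f e.2 e.1) e =
  (if v == 0%N then 0 else f (nodeof v) (parent (nodeof v))) +
  \sum_(w | kid v [::] w) f (parent w) w.
Proof.
move=> vn fs.
have -> : \sum_(e <- es) inc v (f e.1 e.2) (f e.2 e.1) e =
    \sum_(e <- es) inc v (f e.1 e.2) (f e.2 e.1) (e.1, e.2) by apply: eq_bigr => -[].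
rewrite (sum_edges (f := fun x y => inc v (f x y) (f y x) (x, y)) el fs) /inc big_split /=.
congr (_ + _).
  rewrite -big_mkcondr /=; case: eqP => [v0|/eqP v0].
    rewrite big_pred0 // => w; apply/andP => -[w0 /eqP wv]; case/eqP: w0; apply: val_inj.
    by rewrite /= wv v0.
  rewrite (eq_bigl (fun w => w == nodeof v)) ?big_pred1_eq // => w.
  apply/andP/eqP => [[_ /eqP <-]|->]; first by rewrite nodeofK.
  rewrite /= val_nodeof // eqxx; split=> //; apply: contraNneq v0 => /(congr1 val) /=.
  by rewrite val_nodeof // => ->.
by rewrite -big_mkcondr /=; apply: eq_bigl => w; rewrite /kid in_nil andbT.
Qed.

(** [A] is the set of removed nodes. A remaining node still counts its parent and its remaining
    children; the root counts its phantom parent, with label 0 and cost 0. A node is in the queue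
    when it has no remaining child, and the last clause puts children before parents. *)
Definition peel_inv h s (Q : seq nat) : Prop :=
  let A := take h Q in
  [/\ same_off [:: 4; 39; 40; 6; 7; 8; 9; 10]%N [:: 3; 4]%N (input I es) s,
      [/\ wmem s 9 0 = size Q, uniq Q, {subset Q <= iota 0 n}, (h <= size Q)%N &
          forall j, (j < size Q)%N -> wmem s 8 j = nth 0%N Q j],
      forall v, (v < n)%N -> v \notin A ->
       [/\ wmem s 6 v = (1 + \sum_(w | kid v A w) 1)%N,
           wmem s 7 v = (pn v + \sum_(w | kid v A w) val w)%N &
           rmem s 3 v = pcost (nodeof v) + \sum_(w | kid v A w) pcost w],
      forall v, v \in A -> wmem s 10 v = pn v /\ rmem s 4 v = pcost (nodeof v) &
      (forall v, (v < n)%N -> (v \in Q) = ((\sum_(w | kid v A w) 1)%N == 0%N)) /\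
      (forall j (w : 'I_n), (j < size Q)%N -> w != rootv -> val (parent w) = nth 0%N Q j ->
         val w \in take j Q)].

Let no_kid v A (w : 'I_n) : (\sum_(w | kid v A w) 1)%N = 0%N -> kid v A w = false.
Proof.
move/eqP; rewrite sum_nat_eq0 => /forallP/(_ w).
by case: (kid v A w).
Qed.

Lemma leaves_run s : degrees_inv n.-1 s ->
  runs W leaves_loop (sexec W (incr 6 w0 w1) s) (n.+1 * 60) (fun s' => exists Q, peel_inv 0 s' Q).
Proof.
move=> [sm h1 h2 h3]; rewrite /leaves_loop; set body := (X in For _ _ X).
have szE := size_edges el; have tkE : take n.-1 es = es by rewrite take_oversize ?szE.
rewrite tkE in h1 h2 h3.
have p0 : pn 0 = 0%N.
  have -> : pn 0 = val (parent rootv) by rewrite /pn; congr (val (parent _)); apply: val_inj; rewrite /= val_nodeof.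
  by rewrite parent_root.
have g1 v : (v < n)%N -> wmem s 6 v = ((v != 0) + \sum_(w | kid v [::] w) 1)%N.
  move=> vn; rewrite h1 (@inc_edges nat v (fun _ _ => 1%N) vn) //.
    by case: (v == 0%N).
  by move=> x y _; rewrite /inc /= addrC.
have g2 v : (v < n)%N -> wmem s 7 v = (pn v + \sum_(w | kid v [::] w) val w)%N.
  move=> vn; rewrite h2 (@inc_edges nat v (fun _ y => val y) vn) //.
    by case: eqP => // ->; rewrite p0.
  by move=> x y _; rewrite /inc /= addrC.
have g3 v : (v < n)%N -> rmem s 3 v = pcost (nodeof v) + \sum_(w | kid v [::] w) pcost w.
  move=> vn; have [_ ae _] := el; rewrite h3.
  have -> : \sum_(e <- es) inc v (cost I e.1 e.2) (cost I e.1 e.2) e =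
      \sum_(e <- es) inc v (cost I e.1 e.2) (cost I e.2 e.1) e.
    by rewrite big_seq [RHS]big_seq; apply: eq_bigr => e ein; rewrite (cost_sym (ae e ein)).
  rewrite (@inc_edges R v (cost I) vn); last by move=> x y xy; rewrite /inc /= addrC.
  congr (_ + _).
    case: eqP => [->|/eqP v0].
      by rewrite /pcost; have -> : nodeof 0 == rootv by rewrite -val_eqE /= val_nodeof.
    rewrite /pcost; case: eqP => // e; move: v0; rewrite -(@val_nodeof _ _ I v) // e.
    by rewrite eqxx.
  apply: eq_bigr => w /and3P[w0 _ _]; rewrite /pcost (negbTE w0).
  by have [wp _] := parentP w0; rewrite (cost_sym wp).
have k0 v : (\sum_(w | kid v [::] w) 1 <= n)%N.
  by rewrite sum1_card; apply: leq_trans (max_card _) _; rewrite card_ord.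
set s1 := sexec W _ s.
have s1E : s1 = State (upd (wmem s) 6 0 (wmem s 6 0 + 1)%N) (rmem s).
  rewrite /s1 /= mod0n wc1 modn_small // g1 //; have := k0 0%N; clear -nW nn; lia.
have f1 v : (v < n)%N -> wmem s1 6 v = (1 + \sum_(w | kid v [::] w) 1)%N.
  move=> vn; rewrite s1E /= ; case: (v =P 0%N) => [->|/eqP v0]; first by rewrite g1 // addnC.
  by rewrite g1 // v0.
pose Inv k s' := [/\ same_off [:: 4; 8; 9]%N [::] s1 s' &
  let Q := [seq v <- iota 0 k | (\sum_(w | kid v [::] w) 1 == 0)%N] in
  wmem s' 9 0 = size Q /\ forall j, (j < size Q)%N -> wmem s' 8 j = nth 0%N Q j].
have H := @runs_for_lf R W 4 (var 0) n body s1 Inv nW1 isT isT.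
apply: runs_weaken (H _ _ _ _) _ _ => {H} //.
- move=> k s' x [sm' h]; split=> //.
  by apply: same_off_trans sm' _; apply: same_off_upd.
- by move=> k s' _ [sm' _]; rewrite /= mod0n sm'.1 // s1E /= sm.1.
- move=> k s' kn e4 [sm' [e9 e8]].
  have sif b x y : sexec W (CIf b x y) s' =
    if teval W s' b then sexec W x s' else sexec W y s' by [].
  have ioS : iota 0 k.+1 = rcons (iota 0 k) k by rewrite -addn1 iotaD cats1.
  have szQ : (size [seq v <- iota 0 k | (\sum_(w | kid v [::] w) 1 == 0)%N] <= k)%N.
    by rewrite size_filter -[X in (_ <= X)%N](size_iota 0) count_size.
  rewrite /body sif [teval _ _ _]/= !mod0n e4 wc1 sm'.1 // f1 // -eqn_leq.
  rewrite /Inv ioS filter_rcons -[X in _ == X]addn0 eqn_add2l; case: ifP => _ /=; last by split.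
  rewrite !mod0n e4 e9 wc1 modn_small; last by move: szQ kn nW1; clear -nW nn; lia.
  split.
    apply: same_off_trans sm' _; split=> // c j; rewrite /= !inE !negb_or => /and3P[_ /negbTE-> /negbTE->].
    by [].
  rewrite size_rcons addn1; split=> // j; rewrite ltnS leq_eqVlt nth_rcons.
  case: (j =P _) => [->|_] /=; first by rewrite ltnn ?eqxx.
  by move=> jl; rewrite jl e8.
- by split=> //; split=> //=; rewrite ?s1E /= ?sm.1.
- by rewrite leq_mul2l.
- move=> s' [sm' [e9 e8]]; exists [seq v <- iota 0 n | (\sum_(w | kid v [::] w) 1 == 0)%N].
  rewrite /peel_inv take0; split=> //.
  + apply: same_off_trans (_ : same_off _ _ (input I es) s1) _; last first.
      by apply: same_off_sub sm' => //; apply/allP.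
    apply: same_off_trans (_ : same_off _ _ (input I es) s) _.
      by apply: same_off_sub sm; apply/allP.
    by rewrite s1E; apply: same_off_upd.
  + by split=> //; [rewrite filter_uniq ?iota_uniq|move=> x; rewrite mem_filter => /andP[]].
  + move=> v vn _; rewrite !sm'.1 // sm'.2 // f1 //; split=> //; rewrite s1E /=.
      exact: g2.
    exact: g3.
  + split=> [v vn|j w jQ w0 e]; first by rewrite mem_filter mem_iota add0n vn leq0n !andbT.
    have := mem_nth 0%N jQ; rewrite mem_filter -e => /andP[/eqP/(@no_kid _ _ w) + _].
    by rewrite /kid w0 eqxx.
Qed.

Let kid_same (T : nmodType) (f : 'I_n -> T) u v A : (v < n)%N -> v = 0%N \/ u <> pn v ->
  \sum_(w | kid u A w) f w = \sum_(w | kid u (rcons A v) w) f w.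
Proof.
move=> vn h; apply: eq_bigl => w; rewrite /kid mem_rcons inE negb_or.
case w0: (w != rootv) => //=; case: eqP => //= pw; case: eqP => //= wv.
case: h => [v0|[]]; last by rewrite -pw /pn -wv nodeofK.
by case/eqP: w0; apply: val_inj; rewrite /= wv v0.
Qed.

Let kid_step (T : nmodType) (f : 'I_n -> T) v A : (v < n)%N -> v <> 0%N -> v \notin A ->
  \sum_(w | kid (pn v) A w) f w = f (nodeof v) + \sum_(w | kid (pn v) (rcons A v) w) f w.
Proof.
move=> vn v0 vA; rewrite (bigD1 (nodeof v)) /=.
  congr (_ + _); apply: eq_bigl => w; rewrite /kid mem_rcons inE negb_or.
  have -> : (w != nodeof v) = (val w != v) by rewrite -val_eqE /= val_nodeof.
  by rewrite -!andbA; do 2!congr (_ && _); rewrite andbC.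
rewrite /kid /pn eqxx /= val_nodeof // vA !andbT.
by apply/eqP => /(congr1 val); rewrite /= val_nodeof.
Qed.

Lemma peel_loop_run s Q0 : peel_inv 0 s Q0 ->
  runs W peel_loop s (n.+1 * 120) (fun s' => exists Q, peel_inv n s' Q).
Proof.
move=> pi0; rewrite /peel_loop; set body := (X in For _ _ X).
pose Inv k s' := exists Q, peel_inv k s' Q.
have H := @runs_for_lf R W 4 (var 0) n body s Inv nW1 isT isT.
apply: runs_weaken (H _ _ _ _) _ _ => {H} //; last 2 first.
- by exists Q0.
- by rewrite leq_mul2l.
- move=> k s' x [Q [sm h1 h2 h3 h4]]; exists Q; split=> //.
  by apply: same_off_trans sm _; apply: same_off_upd.
- by move=> k s' _ [Q [sm _ _ _ _]]; rewrite /= mod0n sm.1.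
move=> k s' kn e4 [Q [sm [e9 uQ subQ kQ e8] h2 h3 [h4 h5]]].
set A := take k Q in h2 h3 h4.
have Qn v : v \in Q -> (v < n)%N by move/subQ; rewrite mem_iota.
have szQ : (size Q <= n)%N by have := uniq_leq_size uQ subQ; rewrite size_iota.
(* The queue does not run dry: if all queued nodes were removed, an unqueued node of largest rank
   would have no remaining child and would have been queued. *)
have kQ' : (k < size Q)%N.
  rewrite ltn_neqAle kQ andbT; apply/eqP => ek.
  have AE : A = Q by rewrite /A ek take_size.
  case: (boolP [exists v : 'I_n, val v \notin Q]) => [/existsP[v0 v0Q]|]; last first.
    rewrite negb_exists => /forallP allQ.
    have : (size (iota 0 n) <= size Q)%N.
      apply: uniq_leq_size (iota_uniq _ _) _ => v; rewrite mem_iota /= add0n => vn.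
      by have := allQ (Ordinal vn); rewrite negbK.
    by rewrite size_iota -ek leqNgt kn.
  case: (@arg_maxnP _ v0 (fun v => val v \notin Q) rank v0Q) => v vQ vmax.
  move: vQ; rewrite h4 ?ltn_ord // sum_nat_eq0 => /negP[]; apply/forallP => w; apply/implyP.
  rewrite AE => /and3P[w0 /eqP pw wQ]; have [_ rw] := parentP w0.
  by have := vmax w wQ; rewrite rw (val_inj pw) /= ltnn.
set v := nth 0%N Q k.
have vQ : v \in Q by apply: mem_nth.
have vn := Qn v vQ.
have AvE : take k.+1 Q = rcons A v by rewrite (take_nth 0%N).
have vA : v \notin A by have := take_uniq k.+1 uQ; rewrite AvE rcons_uniq => /andP[].
have sub_A u : u \in A -> u \in Q by apply: mem_take.
have vk : (\sum_(w | kid v A w) 1)%N = 0%N by apply/eqP; rewrite -h4.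
have nk w : kid v A w = false by apply: no_kid.
have [v6 v7 v3] := h2 v vn vA.
rewrite vk addn0 in v6; rewrite big_pred0 ?addn0 // in v7; rewrite big_pred0 ?addr0 // in v3.
set p := pn v in v7.
have pn' : (p < n)%N by apply: ltn_ord.
have v8 : wmem s' 8 k = v by apply: e8.
have pA : v <> 0%N -> p \notin Q.
  by move=> v0; rewrite h4 // (@kid_step nat (fun=> 1%N) v A).
pose sB := State (upd (upd (upd (upd (upd (wmem s') 39 0 v) 40 0 p) 10 v p)
   6 p (wmem s' 6 p - 1)%N) 7 p (wmem s' 7 p - v)%N)
   (upd (upd (rmem s') 4 v (pcost (nodeof v))) 3 p (rmem s' 3 p - pcost (nodeof v))).
have p_root : v = 0%N -> p = 0%N.
  move=> v0; rewrite /p /pn v0; have -> : nodeof 0 = rootv by apply: val_inj; rewrite /= val_nodeof.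
  by rewrite parent_root.
pose pushed := (wmem s' 6 p - 1 == 1)%N.
pose Q' := if pushed then rcons Q p else Q.
have bodyE : sexec W body s' = if pushed then
    State (upd (upd (wmem sB) 8 (size Q) p) 9 0 (size Q).+1) (rmem sB) else sB.
  rewrite /= !mod0n e4 v8 v7 v3 eqxx /= wc1 -eqn_leq -/pushed.
  case: (pushed) => /=; rewrite ?eqxx //= e9 modn_small ?addn1 //.
  by move: szQ; clear -nW nn; lia.
have tk' : take k.+1 Q' = rcons A v.
  rewrite /Q'; case: ifP => _ //; rewrite -cats1 take_cat; case: ltnP => // le.
  have -> : k.+1 = size Q by apply/eqP; rewrite eqn_leq kQ'.
  by rewrite subnn take0 cats0 -AvE take_oversize.
have d6 : v <> 0%N -> (wmem s' 6 p - 1 = 1 + \sum_(w | kid p (rcons A v) w) 1)%N.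
  move=> v0; have pNA : p \notin A by apply: contra (pA v0); apply: sub_A.
  have [e6 _ _] := h2 p pn' pNA; rewrite e6.
  have ks : (\sum_(w | kid p A w) 1 = 1 + \sum_(w | kid p (rcons A v) w) 1)%N.
    by first [exact: (@kid_step nat (fun=> 1%N) v A) | rewrite (@kid_step nat (fun=> 1%N) v A)].
  by first [rewrite ks addKn | rewrite ks -addnBA].
(* The root is its own parent: its removal lowers its own count from 1 to 0, so it is not queued
   twice. *)
have push0 : v = 0%N -> pushed = false.
  move=> v0; have e60 : wmem s' 6 0 = wmem s' 6 v by rewrite v0.
  by rewrite /pushed (p_root v0) e60 v6.
have pushE : v <> 0%N -> pushed = ((\sum_(w | kid p (rcons A v) w) 1)%N == 0%N).
  by move=> v0; rewrite /pushed d6 // -[X in _ == X]addn0 eqn_add2l.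
exists Q'; rewrite /peel_inv tk'.
have memB a : wmem (sexec W body s') a = if pushed then
    (upd (upd (wmem sB) 8 (size Q) p) 9 0 (size Q).+1) a else wmem sB a.
  by rewrite bodyE; case: (pushed).
have rmemB : rmem (sexec W body s') = rmem sB by rewrite bodyE; case: (pushed).
split.
- apply: same_off_trans sm _; apply: same_off_sub (sexec_same W s' _) => //.
  + by apply/allP.
  + by apply/allP.
- split.
  + by rewrite memB /Q'; case: (pushed) => //=; rewrite size_rcons.
  + rewrite /Q'; case pE: (pushed) => //; rewrite rcons_uniq uQ andbT; apply: pA => v0.
    by rewrite push0 in pE.
  + rewrite /Q'; case: (pushed) => // x; rewrite mem_rcons inE => /predU1P[->|/subQ //].
    by rewrite mem_iota.
  + by rewrite /Q'; case: (pushed); rewrite ?size_rcons // ltnW.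
  + move=> j; rewrite memB /Q'; case: (pushed) => /=; last exact: e8.
    rewrite size_rcons ltnS leq_eqVlt nth_rcons; case: (j =P size Q) => [->|_] /=.
      by rewrite ltnn.
    by move=> jl; rewrite jl e8.
- move=> u un; rewrite mem_rcons inE negb_or => /andP[uv uA].
  have [u6 u7 u3] := h2 u un uA.
  have -> : wmem (sexec W body s') 6 u = wmem sB 6 u by rewrite memB; case: (pushed).
  have -> : wmem (sexec W body s') 7 u = wmem sB 7 u by rewrite memB; case: (pushed).
  rewrite rmemB /=; case: (u =P p) => [up|up].
    have v0 : v <> 0%N by move=> v0; case/eqP: uv; rewrite up p_root // v0.
    rewrite up in u7 u3 *; rewrite d6 //; split=> //.
      have ks : (\sum_(w | kid p A w) val w = v + \sum_(w | kid p (rcons A v) w) val w)%N.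
        by first [apply: etrans (@kid_step nat val v A vn v0 vA) _; apply: (congr2 addn) => //; rewrite /= val_nodeof
          | rewrite (@kid_step nat val v A) //= val_nodeof].
      by first [rewrite u7 ks addnCA addKn | rewrite u7 ks addKn | move: u7 ks; clear; lia].
    have ks := @kid_step R pcost v A vn v0 vA.
    by first [rewrite u3 ks [pcost (nodeof v) + _]addrC addrA addrK
      | rewrite u3 /p (@kid_step R pcost v A) // [pcost (nodeof v) + _]addrC addrA addrK].
  rewrite u6 u7 u3; have h : v = 0%N \/ u <> pn v by right.
  by rewrite (@kid_same nat _ u v A) // (@kid_same nat val u v A) // (@kid_same R _ u v A).
- move=> u; rewrite mem_rcons inE memB rmemB.
  have -> : (if pushed then upd (upd (wmem sB) 8 (size Q) p) 9 0 (size Q).+1 10%N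
      else wmem sB 10%N) u = wmem sB 10 u by case: (pushed).
  by rewrite /=; case: (u =P v) => [->|_ /= /h3].
split=> [u un|j w].
- rewrite /Q'; case: (v =P 0%N) => [v0|v0].
    by rewrite push0 // h4 // (@kid_same nat _ u v A) //; left.
  case: (u =P p) => [->|up].
    rewrite -pushE //; case: (pushed); first by rewrite mem_rcons mem_head.
    exact/negbTE/pA.
  rewrite (_ : (u \in if pushed then _ else _) = (u \in Q)); last first.
    by case: (pushed) => //; rewrite mem_rcons inE; case: eqP.
  by rewrite h4 // (@kid_same nat _ u v A) //; right.
- rewrite /Q'; case pE: (pushed); last exact: h5.
  rewrite size_rcons ltnS nth_rcons -cats1 leq_eqVlt => /predU1P[->|jl] w0; last first.
    by rewrite jl take_cat jl; apply: h5.
  rewrite ltnn eqxx take_size_cat // => pw.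
  have v0 : v <> 0%N by move=> v0; rewrite push0 in pE.
  move: pE; rewrite pushE // => /eqP/(@no_kid _ _ w); rewrite /kid w0 pw eqxx /=.
  by move/negbFE; rewrite mem_rcons inE => /predU1P[->|/sub_A].
Qed.

Lemma peel_run : runs W peel (input I es) (n.+1 * 300) (fun s => exists Q, peel_inv n s Q).
Proof.
apply: (@runs_weaken R W _ _ (n * 100 + (6 + (n.+1 * 60 + n.+1 * 120)))%N) => [||s h]; [|by clear; lia|exact: h].
apply: runs_seq; apply: runs_weaken degrees_run (leqnn _) _ => s d.
apply: runs_seq; apply: (@runs_loopfree R W (incr 6 w0 w1)) => //.
apply: runs_seq; apply: runs_weaken (leaves_run d) (leqnn _) _ => s1 [Q pi0].
exact: peel_loop_run pi0.
Qed.

End Peel.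

(** * Setting up the items and computing all gains *)

Definition depth_loop : cmd :=
  For 4 (var 0)
   (39 <-- WGet 8 (WSub (WSub (var 0) w1) (var 4)) ;;
    CRSet 5 (var 39) (RAdd (RGet 5 (WGet 10 (var 39))) (RGet 4 (var 39)))).

Notation wE := (WAdd (var 0) (var 4)).
Notation wN := (WAdd (var 0) (WAdd (var 0) (var 4))).
Notation rneg e := (RSub (ROfWord w0) e).

(** Array 11 holds, for each node, the item below which the dummy of its next child will hang: at
    first its node item, later the last dummy of its chain. *)
Definition items_words : cmd :=
  CWSet 11 (var 4) wN ;; CWSet 12 wE (var 4) ;; CWSet 12 wN wE.

(** The final test starts the accumulator of a node item with its own penalty only if its radius is
    nonnegative. The other items keep the initial value 0 for penalty, radius and accumulator. *)
Definition items_reals : cmd :=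
  CRSet 6 (var 4) (RGet 5 (WGet 10 (var 4))) ;; CRSet 6 wE (RGet 5 (var 4)) ;;
  CRSet 6 wN (RGet 5 (var 4)) ;;
  CRSet 8 (var 4) (RGet 5 (WGet 10 (var 4))) ;; CRSet 8 wE (RGet 5 (WGet 10 (var 4))) ;;
  CRSet 8 wN (RGet 5 (var 4)) ;;
  CRSet 7 (var 4) (rneg (RGet 5 (WGet 10 (var 4)))) ;;
  CRSet 7 wE (rneg (RGet 5 (WGet 10 (var 4)))) ;;
  CRSet 7 wN (rneg (RGet 5 (var 4))) ;;
  CRSet 9 wN (RGet 1 (var 4)) ;; CRSet 10 wN (RGet 2 (var 4)) ;;
  CIf (TRle (ROfWord w0) (RGet 2 (var 4))) (CRSet 11 wN (RGet 1 (var 4))) CSkip.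

Definition items_loop : cmd := For 4 (var 0) (items_words ;; items_reals).

(** The counter is shifted by one because the root has no siblings. Taking the nodes by increasing
    label links each dummy to the closest earlier sibling. *)
Definition siblings_loop : cmd :=
  For 4 (WSub (var 0) w1)
   (39 <-- WAdd (var 4) w1 ;; 40 <-- WGet 10 (var 39) ;;
    CWSet 12 (var 39) (WGet 11 (var 40)) ;; CWSet 11 (var 40) (var 39)).

Definition lists_loop : cmd :=
  For 4 (var 33)
   (CWSet 18 (var 4) (var 4) ;; CWSet 19 (var 4) (var 4) ;; CWSet 20 (var 4) (var 4) ;;
    CWSet 21 (var 4) (var 4) ;; CWSet 16 (var 4) (var 4) ;; CWSet 17 (var 4) w1).

Definition gains : cmd :=
  peel ;; depth_loop ;; items_loop ;; siblings_loop ;;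
  33 <-- WAdd (var 0) (WAdd (var 0) (var 0)) ;; 31 <-- var 33 ;;
  lists_loop ;; contract.

Lemma contraction_inv_fun (R : realType) K delta (dep tdep pi rho dep2 tdep2 pi2 rho2 : nat -> R) rk
    rep par kb kb2 acc :
  contraction_inv K delta dep tdep pi rho rk rep par kb acc ->
  (forall i, (i < K)%N -> [/\ dep2 i = dep i, tdep2 i = tdep i, pi2 i = pi i, rho2 i = rho i & kb2 i = kb i]) ->
  contraction_inv K delta dep2 tdep2 pi2 rho2 rk rep par kb2 acc.
Proof.
move=> [h1 h2 h3 h4 h5 h6 h7 h8] eqs; split=> //.
- move=> a b aK bK ab ne; have [_ _ _ _ ->] := eqs a aK; have [-> _ _ _ _] := eqs b bK.
  exact: h6.
- move=> B B' a b BK BK' lB lB' B0 B0' ne pe aK bK ha hb.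
  have [-> _ _ _ _] := eqs a aK; have [-> _ _ _ _] := eqs b bK; have [_ -> _ _ _] := eqs B BK.
  exact: (h7 B B').
- move=> i iK; rewrite h8 // big_seq_cond [RHS]big_seq_cond; apply: eq_bigr => j.
  by rewrite mem_iota /= add0n => /andP[jK _]; have [_ _ -> -> _] := eqs j jK.
Qed.

Section Gains.
Variables (R : realType) (n : nat) (I : instance R n) (es : seq ('I_n * 'I_n)) (W : nat).
Hypothesis el : edge_list I es.
Hypothesis nW : (20 * n * n + 100 < W)%N.
Implicit Types (s : state R).
Notation rootv := (rootv I).
Notation parent := (parent I).
Notation pcost := (pcost I).
Notation nodeof := (nodeof I).
Notation pn := (pn I).
Notation dp v := (depth I (nodeof v)).

Let n0 : (0 < n)%N := node_gt0 I.
Let nn : (n <= n * n)%N. Proof. by nia. Qed.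
Let wc1 : (1 %% W = 1)%N. Proof. by rewrite modn_small //; lia. Qed.
Let nW1 : (n < W)%N. Proof. by clear -nW nn; lia. Qed.
Let n3W : (3 * n < W)%N. Proof. by clear -nW nn; lia. Qed.
Let node0 : nodeof 0 = rootv. Proof. by apply: val_inj; rewrite /= val_nodeof. Qed.
Let pn_lt v : (pn v < n)%N. Proof. exact: ltn_ord. Qed.

(** What the later passes need of the peeling: parents, costs of parent edges, and an order of the
    nodes with children before parents. Read backwards, it serves the top-down passes. *)
Definition tree_inv s (Q : seq nat) : Prop :=
  [/\ [/\ wmem s 0 0 = n, uniq Q, size Q = n, forall v, (v \in Q) = (v < n)%N &
          forall j, (j < n)%N -> wmem s 8 j = nth 0%N Q j],
      forall v, (v < n)%N -> wmem s 10 v = pn v,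
      forall v, (v < n)%N -> rmem s 4 v = pcost (nodeof v) &
      forall w, (0 < w < n)%N -> (index w Q < index (pn w) Q)%N].

Lemma peel_tree s Q : peel_inv I es n s Q -> tree_inv s Q.
Proof.
move=> [sm [e9 uQ subQ nQ e8] _ h3 [_ h5]].
have szQ : size Q = n.
  by apply/eqP; rewrite eqn_leq nQ andbT; have := uniq_leq_size uQ subQ; rewrite size_iota.
have memQ v : (v \in Q) = (v < n)%N.
  have [e _] := uniq_min_size (s2 := Q) (s1 := Q) uQ (fun _ h => h) (leqnn _).
  have h := @uniq_min_size _ Q (iota 0 n) uQ subQ.
  by rewrite size_iota szQ leqnn in h; have [_ ->] := h isT; rewrite mem_iota.
have tk : take n Q = Q by rewrite take_oversize // szQ.
split; first by split=> //; [rewrite sm.1|move=> j jn; apply: e8; rewrite szQ].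
- by move=> v vn; have [] := h3 v; rewrite ?tk ?memQ.
- by move=> v vn; have [] := h3 v; rewrite ?tk ?memQ.
move=> w /andP[w0 wn].
have wr : nodeof w != rootv.
  by apply/eqP => /(congr1 val); rewrite /= val_nodeof // => e; rewrite e in w0.
have pQ : pn w \in Q by rewrite memQ pn_lt.
have jQ : (index (pn w) Q < size Q)%N by rewrite index_mem.
have := h5 (index (pn w) Q) (nodeof w) jQ wr; rewrite nth_index //= val_nodeof // => /(_ erefl).
by move=> /index_ltn.
Qed.

Lemma depth_run s Q : tree_inv s Q -> (forall v, rmem s 5 v = 0) ->
  runs W depth_loop s (n.+1 * 60) (fun s' => forall v, (v < n)%N -> rmem s' 5 v = dp v).
Proof.
move=> [[e0 uQ szQ memQ e8] e10 e4 ord] z5; rewrite /depth_loop; set body := (X in For _ _ X).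
pose Inv k s' := same_off [:: 4; 39]%N [:: 5]%N s s' /\
  (forall v, (v < n)%N -> rmem s' 5 v = if (n - k <= index v Q)%N then dp v else 0).
have H := @runs_for_lf R W 4 (var 0) n body s Inv nW1 isT isT.
apply: runs_weaken (H _ _ _ _) _ _ => {H} //.
- by move=> k s' x [sm h]; split=> //; apply: same_off_trans sm _; apply: same_off_upd.
- by move=> k s' _ [sm _]; rewrite /= mod0n sm.1.
- move=> k s' kn v4 [sm h].
  pose j := (n - 1 - k)%N; have jn : (j < n)%N by rewrite /j; clear -kn; lia.
  pose v := nth 0%N Q j.
  have vn : (v < n)%N by rewrite -memQ mem_nth // szQ.
  have iv : index v Q = j by rewrite index_uniq // szQ.
  have v8 : wmem s' 8 j = v by rewrite sm.1 // e8.
  have -> : sexec W body s' = State (upd (wmem s') 39 0 v)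
      (upd (rmem s') 5 v (rmem s' 5 (pn v) + pcost (nodeof v))).
    rewrite /= !mod0n v4 wc1 (sm.1 0%N) // e0 -/j v8 (sm.1 10%N) // e10 //.
    by rewrite (sm.2 4%N) // e4.
  split.
    apply: same_off_trans sm _; split=> c i; rewrite /= !inE ?negb_or.
      by move=> /andP[_ /negbTE ->].
    by move=> /negbTE ->.
  move=> u un; rewrite /=; case: (u =P v) => [->|uv].
    have -> : (n - k.+1 <= index v Q)%N by rewrite iv /j; clear; lia.
    rewrite depth_parent; congr (_ + _).
    (* The root reads its own entry, which is still the initial 0. *)
    have [v0|v0] := posnP v.
      rewrite /pn v0 node0 parent_root h //=.
      have -> : index 0%N Q = j by have := iv; rewrite v0.
      rewrite depth_root ifF //; apply/negbTE; rewrite -ltnNge /j; clear -kn; lia.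
    rewrite h ?pn_lt // nodeofK ifT //; have := ord v; rewrite v0 vn iv => /(_ isT).
    by rewrite /j; clear -kn; lia.
  rewrite h //; congr (if _ then _ else _).
  have : index u Q != j.
    apply/eqP => e; case: uv; rewrite /v -e nth_index // memQ //.
  by rewrite /j; move: (index u Q) => x; clear -kn; move=> h; apply/idP/idP; lia.
- split=> // v vn; rewrite z5 subn0 ifF //; apply/negbTE; rewrite -ltnNge.
  by rewrite -szQ index_mem memQ.
- by rewrite leq_mul2l.
- by move=> s' [_ h] v vn; rewrite h // subnn.
Qed.

Definition items_inv k s s' : Prop :=
  [/\ same_off [:: 4; 11; 12]%N [:: 6; 7; 8; 9; 10; 11]%N s s',
   forall v, (v < k)%N -> wmem s' 11 v = (2 * n + v)%N,
   forall v, (v < n)%N -> (v < k)%N -> wmem s' 12 (n + v)%N = v /\ wmem s' 12 (2 * n + v)%N = (n + v)%N,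
   forall v, (v < n)%N -> wmem s' 12 v = 0%N &
   [/\ forall v, (v < n)%N -> (v < k)%N -> [/\ rmem s' 6 v = dp (pn v), rmem s' 6 (n + v)%N = dp v & rmem s' 6 (2 * n + v)%N = dp v],
       forall v, (v < n)%N -> (v < k)%N -> [/\ rmem s' 8 v = dp (pn v), rmem s' 8 (n + v)%N = dp (pn v) & rmem s' 8 (2 * n + v)%N = dp v],
       forall v, (v < n)%N -> (v < k)%N -> [/\ rmem s' 7 v = - dp (pn v), rmem s' 7 (n + v)%N = - dp (pn v) & rmem s' 7 (2 * n + v)%N = - dp v],
       (forall i, rmem s' 9 i = if (2 * n <= i < 2 * n + k)%N then penalty I (nodeof (i - 2 * n)) else 0) /\
       (forall i, rmem s' 10 i = if (2 * n <= i < 2 * n + k)%N then radius I (nodeof (i - 2 * n)) else 0) &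
       forall i, rmem s' 11 i = if (2 * n <= i < 2 * n + k)%N && (0 <= radius I (nodeof (i - 2 * n)))
          then penalty I (nodeof (i - 2 * n)) else 0]].

Lemma items_run s Q : tree_inv s Q -> (forall v, (v < n)%N -> rmem s 5 v = dp v) ->
  same_off [:: 4; 39; 40; 6; 7; 8; 9; 10]%N [:: 3; 4; 5]%N (input I es) s ->
  runs W items_loop s (n.+1 * 250) (items_inv n s).
Proof.
move=> [[e0 uQ szQ memQ e8] e10 e4 ord] e5 sm0; rewrite /items_loop; set body := (X in For _ _ X).
have r1 v : (v < n)%N -> rmem s 1 v = penalty I (nodeof v).
  move=> vn; rewrite sm0.2 //= (nth_map (nodeof 0)) ?size_enum_ord //.
  by congr penalty; apply: val_inj; rewrite /= nth_enum_ord // val_nodeof.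
have r2 v : (v < n)%N -> rmem s 2 v = radius I (nodeof v).
  move=> vn; rewrite sm0.2 //= (nth_map (nodeof 0)) ?size_enum_ord //.
  by congr radius; apply: val_inj; rewrite /= nth_enum_ord // val_nodeof.
have H := @runs_for_lf R W 4 (var 0) n body s (fun k s' => items_inv k s s') nW1 isT isT.
apply: runs_weaken (H _ _ _ _) _ _ => {H} //.
- move=> k s' x [sm h1 h2 h3 h4]; split=> //.
  by apply: same_off_trans sm _; apply: same_off_upd.
- by move=> k s' _ [sm _ _ _ _]; rewrite /= mod0n sm.1.
- move=> k s' kn v4 [sm h11 h12 h12' [h6 h8 h7 [h9 h10] hacc]].
  have mE : ((n + k) %% W = n + k)%N by rewrite modn_small //; clear -kn n3W; lia.
  have mN : ((n + (n + k)) %% W = 2 * n + k)%N.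
    by rewrite modn_small; clear -kn n3W; lia.
  pose N := (2 * n + k)%N.
  pose cond := 0 <= radius I (nodeof k).
  have bE : sexec W body s' = State
     (upd (upd (upd (wmem s') 11 k N) 12 (n + k) k) 12 N (n + k)%N)
     (let m := upd (upd (upd (upd (upd (upd (upd (upd (upd (upd (upd (rmem s')
       6 k (dp (pn k))) 6 (n + k) (dp k)) 6 N (dp k)) 8 k (dp (pn k))) 8 (n + k) (dp (pn k))) 8 N (dp k))
       7 k (- dp (pn k))) 7 (n + k) (- dp (pn k))) 7 N (- dp k)) 9 N (penalty I (nodeof k))) 10 N (radius I (nodeof k)) in
      if cond then upd m 11 N (penalty I (nodeof k)) else m).
    rewrite /= !mod0n v4 (sm.1 0%N) // e0 mE mN (sm.1 10%N) // e10 //.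
    rewrite !(sm.2 5%N) // !e5 ?pn_lt // !(sm.2 1%N) // !(sm.2 2%N) // r1 // r2 // !sub0r -/cond.
    by case: (cond).
  rewrite bE; set m := (let m := _ in _).
  have ltS v : (v < k.+1)%N -> v <> k -> (v < k)%N by clear; lia.
  have mc a i : a != 11%N -> m a i = (upd (upd (upd (upd (upd (upd (upd (upd (upd (upd (upd (rmem s')
       6 k (dp (pn k))) 6 (n + k) (dp k)) 6 N (dp k)) 8 k (dp (pn k))) 8 (n + k) (dp (pn k))) 8 N (dp k))
       7 k (- dp (pn k))) 7 (n + k) (- dp (pn k))) 7 N (- dp k)) 9 N (penalty I (nodeof k))) 10 N (radius I (nodeof k))) a i.
    by move=> an; rewrite /m /=; case: (cond) => //=; rewrite (negbTE an).
  have x1 v : (v < n)%N -> (v == n + k)%N = false by clear; lia.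
  have x2 v : (v < n)%N -> (v == N)%N = false by rewrite /N; clear -n0; lia.
  have x3 v : (n + v == k)%N = false by clear -kn; lia.
  have x4 v : (v < n)%N -> (n + v == N)%N = false by rewrite /N; clear; lia.
  have x5 v : (2 * n + v == k)%N = false by clear -kn; lia.
  have x6 v : (2 * n + v == n + k)%N = false by clear -kn; lia.
  have x7 v : (2 * n + v == N)%N = (v == k) by rewrite /N eqn_add2l.
  have x8 v : (n + v == n + k)%N = (v == k) by rewrite eqn_add2l.
  have x9 i : (2 * n <= i < 2 * n + k.+1)%N = (i == N) || (2 * n <= i < 2 * n + k)%N.
    by rewrite /N; clear; lia.
  have x10 : (N - 2 * n = k)%N by rewrite /N addKn.
  split.
  + apply: same_off_trans sm _; split=> c i.
      by rewrite /= !inE !negb_or => /and3P[_ /negbTE-> /negbTE->].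
    rewrite !inE !negb_or => /and5P[/negbTE q6 /negbTE q7 /negbTE q8 /negbTE q9 /andP[/negbTE q10 q11]].
    by rewrite /= mc //= q6 q7 q8 q9 q10.
  + by move=> v vk /=; case: eqP => [->|/(ltS v vk)/h11].
  + move=> v vn vk /=; rewrite x7 x4 // x8 x6; case: eqP => [->|/(ltS v vk)/(h12 v vn)] //.
  + by move=> v vn /=; rewrite x1 // x2 // h12'.
  split.
  + move=> v vn vk; rewrite /= !mc //= x1 // x2 // x3 x4 // x5 x6 x7 x8.
    by case: eqP => [->|/(ltS v vk)/(h6 v vn)].
  + move=> v vn vk; rewrite /= !mc //= x1 // x2 // x3 x4 // x5 x6 x7 x8.
    by case: eqP => [->|/(ltS v vk)/(h8 v vn)].
  + move=> v vn vk; rewrite /= !mc //= x1 // x2 // x3 x4 // x5 x6 x7 x8.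
    by case: eqP => [->|/(ltS v vk)/(h7 v vn)].
  + by split=> i; rewrite /= mc //= x9; case: eqP => [->|_] /=; rewrite ?x10.
  + move=> i; rewrite x9 /= /m /=; case cE: (cond) => /=; last first.
      rewrite hacc; case: (i =P N) => [->|//]; by rewrite x10 /= -/cond cE andbF.
    by case: (i =P N) => [->|_] /=; rewrite ?x10 -?/cond ?cE.
- split=> //.
  + by move=> v vn; rewrite sm0.1.
  + split=> //; first split.
    * by move=> i; rewrite sm0.2 //= addn0; case: ifP => // /andP[a b]; move: (leq_ltn_trans a b); rewrite ltnn.
    * by move=> i; rewrite sm0.2 //= addn0; case: ifP => // /andP[a b]; move: (leq_ltn_trans a b); rewrite ltnn.
    * by move=> i; rewrite sm0.2 //= addn0; case: ifP => // /andP[/andP[a b]]; move: (leq_ltn_trans a b); rewrite ltnn.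
- by rewrite leq_mul2l.
Qed.

Definition last_child s q k : Prop :=
  (exists u, [/\ (0 < u <= k)%N, pn u = q, wmem s 11 q = u &
     forall z, (u < z <= k)%N -> pn z <> q]) \/
  (wmem s 11 q = (2 * n + q)%N /\ forall z, (0 < z <= k)%N -> pn z <> q).

Lemma siblings_run s : wmem s 0 0 = n -> (forall v, (v < n)%N -> wmem s 10 v = pn v) ->
  (forall v, (v < n)%N -> wmem s 11 v = (2 * n + v)%N) ->
  (forall v, (v < n)%N -> wmem s 12 (n + v)%N = v /\ wmem s 12 (2 * n + v)%N = (n + v)%N) ->
  wmem s 12 0 = 0%N ->
  runs W siblings_loop s (n * 60) (fun s' => cluster_parent I (wmem s' 12)).
Proof.
move=> e0 e10 e11 e12 z12; rewrite /siblings_loop; set body := (X in For _ _ X).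
pose Inv k s' := [/\ same_off [:: 4; 39; 40; 11; 12]%N [::] s s',
  forall q, (q < n)%N -> last_child s' q k,
  forall w, (0 < w <= k)%N ->
    (exists u, [/\ (0 < u < w)%N, pn u = pn w, wmem s' 12 w = u &
       forall z, (u < z < w)%N -> pn z <> pn w]) \/
    (wmem s' 12 w = (2 * n + pn w)%N /\ forall z, (0 < z < w)%N -> pn z <> pn w) &
  wmem s' 12 0 = 0%N /\ forall i, (n <= i)%N -> wmem s' 12 i = wmem s 12 i].
have n1W : (n.-1 < W)%N by clear -nW1; lia.
have H := @runs_for_lf R W 4 (WSub (var 0) w1) n.-1 body s Inv n1W isT isT.
apply: runs_weaken (H _ _ _ _) _ _ => {H} //.
- by move=> k s' x [sm h1 h2 h3]; split=> //; apply: same_off_trans sm _; apply: same_off_upd.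
- by move=> k s' _ [sm _ _ _]; rewrite /= mod0n wc1 sm.1 // e0 subn1.
- move=> k s' kn v4 [sm h1 h2 [h3 h4]].
  have k1n : (k.+1 < n)%N by clear -kn; lia.
  set q := pn k.+1.
  have m1 : ((k + 1) %% W = k.+1)%N by rewrite modn_small ?addn1 //; clear -k1n nW1; lia.
  have -> : sexec W body s' = State (upd (upd (upd (upd (wmem s') 39 0 k.+1) 40 0 q)
      12 k.+1 (wmem s' 11 q)) 11 q k.+1) (rmem s').
    by rewrite /= !mod0n v4 wc1 m1 (sm.1 10%N) // e10.
  split.
  + apply: same_off_trans sm _; split=> // c i; rewrite /= !inE !negb_or.
    by move=> /and5P[_ /negbTE-> /negbTE-> /negbTE-> /negbTE->].
  + move=> q' qn; rewrite /last_child /=; case: (q' =P q) => [->|qq].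
      left; exists k.+1; split=> //; first by rewrite leqnn.
      by move=> z; clear; lia.
    case: (h1 q' qn) => [[u [ub pu eu nz]]|[eu nz]]; [left; exists u|right]; split=> //.
    * by move: ub; clear; lia.
    * move=> z; have [-> _|zk zb] := eqVneq z k.+1; first by move=> e; case: qq.
      by apply: nz; move: zk zb; clear; lia.
    * move=> z; have [-> _|zk zb] := eqVneq z k.+1; first by move=> e; case: qq.
      by apply: nz; move: zk zb; clear; lia.
  + move=> w wb; rewrite /=; have [->|wk] := eqVneq w k.+1.
      by have [[u [ub pu -> nz]]|[-> nz]] := h1 q (pn_lt _); [left; exists u|right]; split.
    by apply: h2; move: wk wb; clear; lia.
  + by split=> [//|i ni] /=; rewrite ifF ?h4 //; clear -ni k1n; lia.
- split=> //.
  + by move=> q qn; right; split; [rewrite e11|move=> z; clear; lia].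
  + by move=> w; clear; lia.
- by rewrite prednK // leq_mul2l orbT.
- move=> s' [sm h1 h2 [h3 h4]]; split=> //.
  + by move=> v vn; rewrite h4 ?leq_addr //; have [] := e12 v vn.
  + by move=> v vn; rewrite h4; [have [] := e12 v vn|clear; lia].
  + by move=> w wb; apply: h2; move: wb; clear; lia.
Qed.

Lemma lists_run s : wmem s 33 0 = (3 * n)%N ->
  runs W lists_loop s ((3 * n).+1 * 60)
   (fun s' => forall k, (k < 3 * n)%N -> [/\ wmem s' 18 k = k, wmem s' 19 k = k, wmem s' 20 k = k,
      wmem s' 21 k = k & wmem s' 16 k = k /\ wmem s' 17 k = 1%N]).
Proof.
move=> e33; rewrite /lists_loop; set body := (X in For _ _ X).
pose Inv k s' := wmem s' 33 0 = (3 * n)%N /\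
  forall c, (c < k)%N -> [/\ wmem s' 18 c = c, wmem s' 19 c = c, wmem s' 20 c = c,
      wmem s' 21 c = c & wmem s' 16 c = c /\ wmem s' 17 c = 1%N].
have H := @runs_for_lf R W 4 (var 33) (3 * n)%N body s Inv n3W isT isT.
apply: runs_weaken (H _ _ _ _) _ _ => {H} //.
- by move=> k s' _ [e _]; rewrite /= mod0n.
- move=> k s' kn v4 [e h]; split=> // c; rewrite ltnS leq_eqVlt /= !mod0n v4 wc1.
  by case: (c =P k) => [->|_ /= /h].
- by rewrite leq_mul2l.
- by move=> s' [].
Qed.

Definition gains_time (N : nat) : nat :=
  (1000 * N.+1 + (rounds (3 * N)).+1 * (4900 * (3 * N).+1))%N.

Lemma gains_run :
  runs W gains (input I es) (gains_time n)
    (fun s => [/\ exists Q, tree_inv s Q, forall j, wmem s 3 j = 0%N, wmem s 0 0 = n &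
       forall v, (v < n)%N -> rmem s 11 (2 * n + v)%N = node_gain I (nodeof v) /\
         rmem s 11 (n + v)%N = edge_gain I (nodeof v)]).
Proof.
apply: (@runs_weaken R W _ _ (n.+1 * 300 + (n.+1 * 60 + (n.+1 * 250 + (n * 60 + (10 + (4 +
  ((3 * n).+1 * 60 + (rounds (3 * n)).+1 * (4900 * (3 * n).+1))))))))%N) => [||s h]; [| |exact: h]; last first.
  by rewrite /gains_time; move: ((rounds _).+1 * _)%N => z; clear; lia.
apply: runs_seq; apply: runs_weaken (peel_run el nW) (leqnn _) _ => s1 [Q pi1].
have t1 := peel_tree pi1; have [sm1 _ _ _ _] := pi1.
have [[e0 uQ szQ memQ e8] e10 e4 ord] := t1.
apply: runs_seq; apply: runs_weaken (runs_frame (depth_run t1 _)) (leqnn _) _.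
  by move=> v; rewrite sm1.2.
move=> s2 [e5 sm2].
have t2 : tree_inv s2 Q.
  split=> //; first by split=> //; [rewrite sm2.1|move=> j jn; rewrite sm2.1 ?e8].
  - by move=> v vn; rewrite sm2.1 ?e10.
  - by move=> v vn; rewrite sm2.2 ?e4.
have sm02 : same_off [:: 4; 39; 40; 6; 7; 8; 9; 10]%N [:: 3; 4; 5]%N (input I es) s2.
  apply: same_off_trans (same_off_sub _ _ sm1) (same_off_sub _ _ sm2); by apply/allP.
apply: runs_seq; apply: runs_weaken (items_run t2 e5 sm02) (leqnn _) _.
move=> s3 [sm3 h11 h12 h12' [h6 h8 h7 [h9 h10] hacc]].
have p10 v : (v < n)%N -> wmem s3 10 v = pn v by move=> vn; rewrite sm3.1 // sm2.1 // e10.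
have e03 : wmem s3 0 0 = n by rewrite sm3.1 // sm2.1.
apply: runs_seq; apply: runs_weaken (runs_frame (siblings_run e03 p10 h11 _ _)) (leqnn _) _.
- by move=> v vn; apply: h12.
- exact: h12'.
move=> s4 [cp sm4].
have e04 : wmem s4 0 0 = n by rewrite sm4.1.
have m33 : ((n + (n + n) %% W) %% W = 3 * n)%N.
  by rewrite modnDmr modn_small; clear -n3W; lia.
apply: runs_seq; apply: runs_loopfree => //; set s5 := sexec _ _ _.
have s5E : s5 = State (upd (wmem s4) 33 0 (3 * n)%N) (rmem s4) by rewrite /s5 /= !mod0n e04 m33.
apply: runs_seq; apply: runs_loopfree => //; set s6 := sexec _ _ _.
have s6E : s6 = State (upd (upd (wmem s4) 33 0 (3 * n)%N) 31 0 (3 * n)%N) (rmem s4).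
  by rewrite /s6 s5E /= !mod0n.
have e336 : wmem s6 33 0 = (3 * n)%N by rewrite s6E.
apply: runs_seq; apply: runs_weaken (runs_frame (lists_run e336)) (leqnn _) _ => s7 [hl sm7].
pose K := (3 * n)%N.
have w12 : wmem s7 12 = wmem s4 12 by apply: funext => i; rewrite sm7.1 // s6E.
have rE a i : rmem s7 a i = rmem s3 a i by rewrite sm7.2 // s6E /= sm4.2.
have acc0 v : (v < n)%N -> [/\ rmem s7 11 v = 0, rmem s7 11 (n + v)%N = 0 &
     rmem s7 11 (2 * n + v)%N = if 0 <= radius I (nodeof v) then penalty I (nodeof v) else 0].
  move=> vn; rewrite !rE !hacc addKn.
  have -> : (2 * n <= v < 2 * n + n)%N = false by clear -vn; lia.
  have -> : (2 * n <= n + v < 2 * n + n)%N = false by clear -vn; lia.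
  by have -> : (2 * n <= 2 * n + v < 2 * n + n)%N by clear -vn; lia.
have ci0 := initial_contraction cp acc0.
have ci : contraction_inv K (idist I) (rmem s7 6) (rmem s7 8) (rmem s7 9) (rmem s7 10)
    (irank I) id (wmem s7 12) (rmem s7 7) (rmem s7 11).
  rewrite w12; apply: contraction_inv_fun ci0 _ => i iK.
  have -> : rmem s7 9 i = ipi I i.
    rewrite rE h9 /ipi; have -> : (2 * n <= i < 2 * n + n)%N = ~~ (i < 2 * n)%N by move: iK; rewrite /K; clear; lia.
    by case: (i < 2 * n)%N.
  have -> : rmem s7 10 i = irho I i.
    rewrite rE h10 /irho; have -> : (2 * n <= i < 2 * n + n)%N = ~~ (i < 2 * n)%N by move: iK; rewrite /K; clear; lia.
    by case: (i < 2 * n)%N.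
  rewrite !rE; move: i iK; apply: items_ind => v vn.
  - have [-> _ _] := h6 v vn vn; have [-> _ _] := h8 v vn vn; have [-> _ _] := h7 v vn vn.
    by rewrite loD // hiD // /pn nodeofK.
  - have [_ -> _] := h6 v vn vn; have [_ -> _] := h8 v vn vn; have [_ -> _] := h7 v vn vn.
    by rewrite loE // hiE // /pn nodeofK.
  - have [_ _ ->] := h6 v vn vn; have [_ _ ->] := h8 v vn vn; have [_ _ ->] := h7 v vn vn.
    by rewrite loN hiN.
have cl k : (k < K)%N -> cluster K id k = [:: k].
  by move=> kK; rewrite /cluster filter_pred1_uniq ?iota_uniq // mem_iota.
have lv : lives K id = iota 0 K.
  by rewrite /lives; apply/all_filterP/allP => k; rewrite mem_iota /= add0n => kK; rewrite /live cl.
have ri : round_inv K (idist I) (rmem s7 6) (rmem s7 8) (rmem s7 9) (rmem s7 10) (irank I) id s7.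
  split=> //.
  - by rewrite sm7.1 // s6E.
  - by move=> k kK; have [_ _ _ _ [_ ->]] := hl k kK; rewrite cl.
  - by move=> k kK _; have [_ _ _ _ [-> ->]] := hl k kK; rewrite addn1.
  - move=> k kK _ /=; have [l1 l2 l3 l4 [-> ->]] := hl k kK.
    by rewrite /seg /= l1 l2 l3 l4; split; rewrite /list_ok cl.
  - by rewrite sm7.1 // s6E /= lv size_iota.
have KW : (4 * K + 20 < W)%N by rewrite /K; clear -nW nn; lia.
have dsym i j : (i < K)%N -> (j < K)%N -> idist I i j = idist I j i by move=> _ _; apply: idist_sym.
apply: runs_weaken (runs_frame (contract_run dsym KW ri)) _ _.
  by rewrite lv size_iota.
move=> s8 [accF sm8].
have wE8 a i : a \in [:: 0; 8; 10; 3]%N -> wmem s8 a i = wmem s2 a i.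
  by rewrite !inE => /or4P[]/eqP->; rewrite sm8.1 // sm7.1 // s6E /= sm4.1 // sm3.1.
have [[t0 tu ts tm t8] t10 t4 tord] := t2.
split.
- exists Q; split=> //.
  + by split=> //; [rewrite wE8|move=> j jn; rewrite wE8 ?t8].
  + by move=> v vn; rewrite wE8 ?t10.
  + by move=> v vn; rewrite sm8.2 // rE sm3.2 ?t4.
- by move=> j; rewrite wE8 // sm02.1.
- by rewrite wE8.
have sumE i : \sum_(j <- iota 0 K) (if idist I i j <= rmem s7 10 j then rmem s7 9 j else 0) =
    \sum_(j <- iota 0 K) (if idist I i j <= irho I j then ipi I j else 0).
  rewrite big_seq [RHS]big_seq; apply: eq_bigr => j; rewrite mem_iota /= add0n => jK.
  rewrite !rE h9 h10 /ipi /irho.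
  have -> : (2 * n <= j < 2 * n + n)%N = ~~ (j < 2 * n)%N by move: jK; rewrite /K; clear; lia.
  by case: (j < 2 * n)%N.
move=> v vn; rewrite !accF ?sumE; try by rewrite /K; clear -vn; lia.
by rewrite item_sum_node // item_sum_edge.
Qed.

End Gains.

(** * The two programs: dynamic programming and best location *)

Definition branch_gain : rexp :=
  RSub (RSub (RGet 13 (var 39)) (RGet 4 (var 39))) (RGet 11 (WAdd (var 0) (var 39))).

Definition start_loop : cmd := For 4 (var 0) (CRSet 13 (var 4) (RGet 11 wN)).

Definition branch_loop : cmd :=
  For 4 (var 0)
   (39 <-- WGet 8 (var 4) ;;
    CIf (TAnd (TWlt w0 (var 39)) (TNot (TRle branch_gain (ROfWord w0))))
      (CRSet 13 (WGet 10 (var 39)) (RAdd (RGet 13 (WGet 10 (var 39))) branch_gain)) CSkip).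

Definition argmax (f : wexp -> rexp) : cmd :=
  41 <-- w0 ;;
  For 4 (var 0) (CIf (TNot (TRle (f (var 4)) (f (var 41)))) (41 <-- var 4) CSkip).

(** Reads the peeling order backwards, so parents are decided before children. Marks spread only
    downwards from the node with the best value, hence no ancestor of it enters the subtree. *)
Definition mark_loop : cmd :=
  For 4 (var 0)
   (39 <-- WGet 8 (WSub (WSub (var 0) w1) (var 4)) ;;
    CIf (TAnd (TAnd (TWlt w0 (var 39)) (TWlt w0 (WGet 3 (WGet 10 (var 39)))))
              (TNot (TRle branch_gain (ROfWord w0))))
      (CWSet 3 (var 39) w1) CSkip).

Definition subtree_program : cmd :=
  gains ;; start_loop ;; branch_loop ;; argmax (RGet 13) ;;
  CWSet 3 (var 41) w1 ;; mark_loop.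

Definition location_program : cmd :=
  gains ;; argmax (fun e => RGet 11 (WAdd (var 0) (WAdd (var 0) e))) ;; CWSet 3 w0 (var 41).

Section Programs.
Variables (R : realType) (n : nat) (I : instance R n) (es : seq ('I_n * 'I_n)) (W : nat).
Hypothesis el : edge_list I es.
Hypothesis nW : (20 * n * n + 100 < W)%N.
Implicit Types (s : state R).
Notation rootv := (rootv I).
Notation parent := (parent I).
Notation pcost := (pcost I).
Notation nodeof := (nodeof I).
Notation pn := (pn I).
Notation tree_inv := (tree_inv I).

Let n0 : (0 < n)%N := node_gt0 I.
Let nn : (n <= n * n)%N. Proof. by nia. Qed.
Let wc1 : (1 %% W = 1)%N. Proof. by rewrite modn_small //; lia. Qed.
Let nW1 : (n < W)%N. Proof. by clear -nW nn; lia. Qed.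
Let n3W : (3 * n < W)%N. Proof. by clear -nW nn; lia. Qed.
Let pn_lt v : (pn v < n)%N. Proof. exact: ltn_ord. Qed.
Let nodeof_root v : (v < n)%N -> (nodeof v == rootv) = (v == 0%N).
Proof. by move=> vn; rewrite -val_eqE /= val_nodeof. Qed.

Lemma argmax_run f (F : nat -> R) s :
    wmem s 0 0 = n ->
    (forall s' e, same_off [:: 4; 41]%N [::] s s' -> (weval W s' e < n)%N ->
       reval W s' (f e) = F (weval W s' e)) ->
    (ctime (CIf (TNot (TRle (f (var 4)) (f (var 41)))) (41 <-- var 4) CSkip) <= 60)%N ->
  runs W (argmax f) s (n.+1 * 90)
    (fun s' => (wmem s' 41 0 < n)%N /\ forall v, (v < n)%N -> F v <= F (wmem s' 41 0)).
Proof.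
move=> e0 fE tm; rewrite /argmax; set body := (X in For _ _ X).
pose Inv k s' := [/\ same_off [:: 4; 41]%N [::] s s', (wmem s' 41 0 < n)%N &
  forall v, (v < k)%N -> F v <= F (wmem s' 41 0)].
apply: (@runs_weaken R W _ _ (3 + n.+1 * (22 + ctime body))%N) => [||s' h]; [| |exact: h]; last first.
  by move: tm; rewrite -/body; move: (ctime body) => c; clear -n0; nia.
apply: runs_seq; apply: runs_loopfree => //; set s1 := sexec _ _ _.
have s1E : s1 = State (upd (wmem s) 41 0 0%N) (rmem s) by rewrite /s1 /= mod0n.
have H := @runs_for_lf R W 4 (var 0) n body s1 Inv nW1 isT isT.
apply: runs_weaken (H _ _ _ _) _ _ => {H} //.
- by move=> k s' x [sm h1 h2]; split=> //; apply: same_off_trans sm _; apply: same_off_upd.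
- by move=> k s' _ [sm _ _]; rewrite /= mod0n sm.1.
- move=> k s' kn v4 [sm lt h].
  have sif b x y : sexec W (CIf b x y) s' =
    if teval W s' b then sexec W x s' else sexec W y s' by [].
  have w4 : weval W s' (var 4) = k by rewrite /= mod0n.
  have w41 : weval W s' (var 41) = wmem s' 41 0 by rewrite /= mod0n.
  have tst : teval W s' (TNot (TRle (f (var 4)) (f (var 41)))) = ~~ (F k <= F (wmem s' 41 0)).
    have tE a b : teval W s' (TNot (TRle a b)) = ~~ (reval W s' a <= reval W s' b) by [].
    by rewrite tE !fE ?w4 ?w41.
  rewrite /body sif tst; case: ifP => cmp.
    have -> : sexec W (41 <-- var 4) s' = State (upd (wmem s') 41 0 k) (rmem s').
      by rewrite /= !mod0n v4.
    split=> //=; first by apply: same_off_trans sm _; apply: same_off_upd.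
    move=> v; rewrite ltnS leq_eqVlt => /predU1P[->//|/h le].
    by apply: le_trans le _; move: cmp; rewrite -ltNge => /ltW.
  split=> // v; rewrite ltnS leq_eqVlt => /predU1P[->|/h //].
  by move/negbFE: cmp.
- by split=> //; rewrite s1E //; apply: same_off_upd.
- by move=> s' [_ lt h].
Qed.

Definition gained s v : R := rmem s 13 v - pcost (nodeof v) - edge_gain I (nodeof v).

Lemma gained_ext s s' v : rmem s 13 v = rmem s' 13 v -> gained s v = gained s' v.
Proof. by rewrite /gained => ->. Qed.

Definition edge_inv s : Prop := forall v, (v < n)%N -> rmem s 11 (n + v)%N = edge_gain I (nodeof v).

Let branch_gainE s Q v : tree_inv s Q -> edge_inv s -> (v < n)%N -> wmem s 39 0 = v ->
  reval W s branch_gain = gained s v.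
Proof.
move=> [[e0 _ _ _ _] _ e4 _] eE vn e39.
rewrite /= !mod0n e39 e0 modn_small; last by clear -vn n3W; lia.
by rewrite e4 // eE.
Qed.

Let tree_same s s' Q ws rs : tree_inv s Q -> same_off ws rs s s' ->
  all (fun a => a \notin ws) [:: 0; 8; 10]%N -> 4%N \notin rs -> tree_inv s' Q.
Proof.
move=> [[t0 tu ts tm t8] t10 t4 tord] sm /allP nws n4; split=> //.
- by split=> //; [rewrite sm.1 // nws|move=> j jn; rewrite sm.1 ?t8 // nws].
- by move=> v vn; rewrite sm.1 ?t10 // nws.
- by move=> v vn; rewrite sm.2 ?t4.
Qed.

Lemma start_run s : wmem s 0 0 = n ->
  runs W start_loop s (n.+1 * 50)
    (fun s' => forall v, (v < n)%N -> rmem s' 13 v = rmem s 11 (2 * n + v)%N).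
Proof.
move=> e0; rewrite /start_loop; set body := (X in For _ _ X).
pose Inv k s' := same_off [:: 4]%N [:: 13]%N s s' /\
  forall v, (v < k)%N -> rmem s' 13 v = rmem s 11 (2 * n + v)%N.
have H := @runs_for_lf R W 4 (var 0) n body s Inv nW1 isT isT.
apply: runs_weaken (H _ _ _ _) _ _ => {H} //.
- by move=> k s' x [sm h]; split=> //; apply: same_off_trans sm _; apply: same_off_upd.
- by move=> k s' _ [sm _]; rewrite /= mod0n sm.1.
- move=> k s' kn v4 [sm h].
  have mN : ((n + (n + k)) %% W = 2 * n + k)%N by rewrite modn_small; clear -kn n3W; lia.
  have mE : ((n + k) %% W = n + k)%N by rewrite modn_small //; clear -kn n3W; lia.
  have -> : sexec W body s' = State (wmem s') (upd (rmem s') 13 k (rmem s 11 (2 * n + k)%N)).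
    by rewrite /= !mod0n v4 (sm.1 0%N) // e0 mE mN (sm.2 11%N).
  split; first by apply: same_off_trans sm _; split=> // c i; rewrite /= inE => /negbTE ->.
  by move=> v; rewrite ltnS leq_eqVlt /=; case: (v =P k) => [->|_ /= /h].
- by rewrite leq_mul2l.
- by move=> s' [].
Qed.

Let kids_sum s v (P : pred 'I_n) : R :=
  \sum_(w : 'I_n | [&& w != rootv, val (parent w) == v & P w]) Num.max 0 (gained s w).

(** The sum on the right refers to the final memory. This is consistent because processing a node
    changes only the value of its parent, which comes later in the order: a value is final once its
    node has been reached. *)
Lemma branch_run s Q : tree_inv s Q -> edge_inv s ->
    (forall v, (v < n)%N -> rmem s 13 v = node_gain I (nodeof v)) ->
  runs W branch_loop s (n.+1 * 90)
    (fun s' => forall v, (v < n)%N -> rmem s' 13 v = node_gain I (nodeof v) + kids_sum s' v xpredT).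
Proof.
move=> ti eE e13; have [[e0 uQ szQ memQ e8] e10 e4 ord] := ti.
rewrite /branch_loop; set body := (X in For _ _ X).
pose Inv k s' := same_off [:: 4; 39]%N [:: 13]%N s s' /\
  forall v, (v < n)%N -> rmem s' 13 v = node_gain I (nodeof v) +
    kids_sum s' v (fun w => (index (val w) Q < k)%N).
have H := @runs_for_lf R W 4 (var 0) n body s Inv nW1 isT isT.
apply: runs_weaken (H _ _ _ _) _ _ => {H} //.
- by move=> k s' x [sm h]; split=> //; apply: same_off_trans sm _; apply: same_off_upd.
- by move=> k s' _ [sm _]; rewrite /= mod0n sm.1.
- move=> k s' kn v4 [sm h].
  pose v := nth 0%N Q k.
  have vn : (v < n)%N by rewrite -memQ mem_nth // szQ.
  have iv : index v Q = k by rewrite index_uniq // szQ.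
  pose sB := State (upd (wmem s') 39 0 v) (rmem s').
  have smB : same_off [:: 4; 39]%N [:: 13]%N s sB.
    by apply: same_off_trans sm _; apply: same_off_upd.
  have tiB : tree_inv sB Q by apply: tree_same ti smB _ _.
  have eB : edge_inv sB by move=> u un; rewrite smB.2 // eE.
  have gB : reval W sB branch_gain = gained s' v by rewrite (branch_gainE tiB eB vn).
  have sif c b x y : sexec W (39 <-- c ;; CIf b x y) s' =
    if teval W (sexec W (39 <-- c) s') b then sexec W x (sexec W (39 <-- c) s')
    else sexec W y (sexec W (39 <-- c) s') by [].
  have E39 : sexec W (39 <-- WGet 8 (var 4)) s' = sB by rewrite /= !mod0n v4 (sm.1 8%N) // e8.
  have tst : teval W sB (TAnd (TWlt w0 (var 39)) (TNot (TRle branch_gain (ROfWord w0)))) =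
      (v != 0%N) && (0 < gained s' v).
    have tE : teval W sB (TAnd (TWlt w0 (var 39)) (TNot (TRle branch_gain (ROfWord w0)))) =
      (~~ (weval W sB (var 39) <= weval W sB w0)%N) && ~~ (reval W sB branch_gain <= reval W sB (ROfWord w0)) by [].
    by rewrite tE gB /= !mod0n -ltnNge lt0n -ltNge.
  have idx (w : 'I_n) : (index (val w) Q < k.+1)%N = (val w == v) || (index (val w) Q < k)%N.
    rewrite ltnS leq_eqVlt; congr (_ || _); apply/eqP/eqP => [e|->//].
    by rewrite /v -e nth_index // memQ ltn_ord.
  rewrite /body sif E39 tst; case: ifP => [/andP[v0 tpos]|cond].
    have [p pE] : exists p, p = pn v by exists (pn v).
    have pltn : (p < n)%N by rewrite pE pn_lt.
    have ip : (k < index p Q)%N by have := ord v; rewrite -pE lt0n v0 vn iv => /(_ isT).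
    have E : sexec W (CRSet 13 (WGet 10 (var 39)) (RAdd (RGet 13 (WGet 10 (var 39))) branch_gain)) sB =
        State (wmem sB) (upd (rmem s') 13 p (rmem s' 13 p + gained s' v)).
      have -> : sexec W (CRSet 13 (WGet 10 (var 39)) (RAdd (RGet 13 (WGet 10 (var 39))) branch_gain)) sB =
        State (wmem sB) (upd (rmem sB) 13 (weval W sB (WGet 10 (var 39)))
           (rmem sB 13 (weval W sB (WGet 10 (var 39))) + reval W sB branch_gain)) by [].
      have -> : weval W sB (WGet 10 (var 39)) = p by rewrite /= !mod0n (sm.1 10%N) // e10 // pE.
      by rewrite gB.
    rewrite E; set s2 := State _ _; split.
      by apply: same_off_trans smB _; split=> // c i; rewrite /= inE => /negbTE ->.
    have r2 u : rmem s2 13 u = if u == p then rmem s' 13 p + gained s' v else rmem s' 13 u.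
      rewrite /s2; move: (gained s' v) => x; first [reflexivity | by rewrite /= /upd eqxx].
    clearbody s2.
    have r2p : rmem s2 13 p = rmem s' 13 p + gained s' v by rewrite r2 eqxx.
    have r2n u : u <> p -> rmem s2 13 u = rmem s' 13 u.
      by move=> /eqP/negbTE up; rewrite r2 up.
    have gs w : (index w Q <= k)%N -> gained s2 w = gained s' w.
      by move=> wk; apply/gained_ext/r2n => e; rewrite e leqNgt ip in wk.
    have sums u : kids_sum s2 u (fun w => (index (val w) Q < k.+1)%N) =
        \sum_(w : 'I_n | [&& w != rootv, val (parent w) == u & (index (val w) Q < k.+1)%N]) Num.max 0 (gained s' w).
      rewrite /kids_sum; apply: eq_bigr => w /and3P[_ _]; rewrite ltnS => wk.
      exact: (congr1 (Num.max 0) (gs (val w) wk)).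
    have nv : val (nodeof v) = v := @val_nodeof _ _ I v vn.
    move=> u un; rewrite sums; case: (u =P p) => [->|up].
      rewrite r2p (h p pltn) -addrA; apply: (congr1 (fun x => node_gain I (nodeof p) + x)).
      apply: etrans (addrC _ _) _; apply: esym.
      rewrite (bigD1 (nodeof v)); last first.
        apply/and3P; split.
        - by rewrite (nodeof_root vn).
        - by rewrite pE eqxx.
        - by rewrite nv iv.
      apply: (congr2 (@GRing.add R)).
        exact: etrans (congr1 (fun x => Num.max 0 (gained s' x)) nv) (max_r (ltW tpos)).
      rewrite /kids_sum; apply: eq_bigl => w.
      have -> : (w != nodeof v) = (val w != v) by rewrite -[X in _ = (_ != X)]nv val_eqE.
      have bl (a b x c : bool) : (x -> c = false) -> [&& a, b & x || c] && ~~ x = [&& a, b & c].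
        by case: a b x c => [] [] [] [] // /(_ isT).
      by rewrite idx; apply: bl => /eqP ->; rewrite iv ltnn.
    rewrite (r2n u up) (h u un); apply: (congr1 (fun x => node_gain I (nodeof u) + x)).
    rewrite /kids_sum; apply: eq_bigl => w; rewrite idx.
    have bl (a b x c : bool) : (x -> b = false) -> [&& a, b & c] = [&& a, b & x || c].
      by case: a b x c => [] [] [] [] // /(_ isT).
    apply: bl => /eqP wv; apply/negbTE/eqP => pw; case: up.
    by rewrite -pw pE /pn -wv nodeofK.
  split; first exact: smB.
  move=> u un; apply: etrans (h u un) _; apply: (congr1 (fun x => node_gain I (nodeof u) + x)).
  transitivity (\sum_(w : 'I_n | [&& w != rootv, val (parent w) == u & (index (val w) Q < k.+1)%N])
      Num.max 0 (gained s' w)); last first.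
    by rewrite /kids_sum; apply: eq_bigr => w _; apply: (congr1 (Num.max 0)); apply: gained_ext.
  rewrite /kids_sum big_mkcond [RHS]big_mkcond; apply: eq_bigr => w _; rewrite idx.
  case: (val w =P v) => [wv|_]; last by [].
  case: (boolP (w != rootv)) => [wr|_]; last by [].
  have vw : v != 0%N by rewrite -wv -(nodeof_root (ltn_ord w)) nodeofK.
  have m0 : Num.max 0 (gained s' w) = 0.
    by apply: max_l; move: cond; rewrite vw andTb -wv => /negbT; rewrite -leNgt.
  by rewrite m0 !if_same.
- split=> // v vn; rewrite e13 // /kids_sum big_pred0 ?addr0 // => w.
  by rewrite ltn0 !andbF.
- by rewrite leq_mul2l.
- move=> s' [_ h] v vn; rewrite (h v vn).
  first [apply: (congr1 (fun x => node_gain I (nodeof v) + x)) | congr (_ + _)].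
  apply: eq_bigl => w.
  have wn : (index (val w) Q < n)%N.
    have wQ : val w \in Q by rewrite memQ ltn_ord.
    by rewrite -index_mem szQ in wQ.
  by rewrite wn.
Qed.

Lemma mark_run s Q r : tree_inv s Q -> edge_inv s -> (r < n)%N ->
    (forall v, (v < n)%N -> wmem s 3 v = (v == r) :> nat) ->
  runs W mark_loop s (n.+1 * 100)
    (fun s' => forall v, (v < n)%N -> (wmem s' 3 v != 0%N) =
       (v == r) || [&& v != 0%N, wmem s' 3 (pn v) != 0%N & 0 < gained s v]).
Proof.
move=> ti eE rn e3; have [[e0 uQ szQ memQ e8] e10 e4 ord] := ti.
rewrite /mark_loop; set body := (X in For _ _ X).
pose Inv k s' := same_off [:: 4; 39; 3]%N [::] s s' /\
  forall v, (v < n)%N -> (wmem s' 3 v != 0%N) = (v == r) ||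
     [&& (n - k <= index v Q)%N, v != 0%N, wmem s' 3 (pn v) != 0%N & 0 < gained s v].
have H := @runs_for_lf R W 4 (var 0) n body s Inv nW1 isT isT.
apply: runs_weaken (H _ _ _ _) _ _ => {H} //.
- by move=> k s' x [sm h]; split=> //; apply: same_off_trans sm _; apply: same_off_upd.
- by move=> k s' _ [sm _]; rewrite /= mod0n sm.1.
- move=> k s' kn v4 [sm h].
  pose j := (n - 1 - k)%N; have jn : (j < n)%N by rewrite /j; clear -kn; lia.
  pose v := nth 0%N Q j.
  have vn : (v < n)%N by rewrite -memQ mem_nth // szQ.
  have iv : index v Q = j by rewrite index_uniq // szQ.
  pose sB := State (upd (wmem s') 39 0 v) (rmem s').
  have smB : same_off [:: 4; 39; 3]%N [::] s sB.
    by apply: same_off_trans sm _; apply: same_off_upd.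
  have tiB : tree_inv sB Q by apply: tree_same ti smB _ _.
  have eB : edge_inv sB by move=> u un; rewrite smB.2 // eE.
  have gB : reval W sB branch_gain = gained s v.
    by rewrite (branch_gainE tiB eB vn) // /gained smB.2.
  have sif c b x y : sexec W (39 <-- c ;; CIf b x y) s' =
    if teval W (sexec W (39 <-- c) s') b then sexec W x (sexec W (39 <-- c) s')
    else sexec W y (sexec W (39 <-- c) s') by [].
  have E39 : sexec W (39 <-- WGet 8 (WSub (WSub (var 0) w1) (var 4))) s' = sB.
    by rewrite /= !mod0n v4 wc1 (sm.1 0%N) // e0 -/j (sm.1 8%N) // e8.
  pose b := TAnd (TAnd (TWlt w0 (var 39)) (TWlt w0 (WGet 3 (WGet 10 (var 39)))))
              (TNot (TRle branch_gain (ROfWord w0))).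
  have tst : teval W sB b = [&& v != 0%N, wmem s' 3 (pn v) != 0%N & 0 < gained s v].
    have tE : teval W sB b = (~~ (weval W sB (var 39) <= weval W sB w0)%N &&
       ~~ (weval W sB (WGet 3 (WGet 10 (var 39))) <= weval W sB w0)%N) &&
       ~~ (reval W sB branch_gain <= reval W sB (ROfWord w0)) by [].
    by rewrite tE gB /= !mod0n -!ltnNge !lt0n -ltNge (sm.1 10%N) // e10 // andbA.
  rewrite /body sif E39 -/b tst.
  have nj : (n - k <= j)%N = false by rewrite /j; clear -kn; lia.
  have nj' : (n - k.+1 <= j)%N by rewrite /j; clear -kn; lia.
  have old : (wmem s' 3 v != 0%N) = (v == r) by rewrite h // iv nj orbF.
  have nidx u : (u < n)%N -> u <> v -> (n - k.+1 <= index u Q)%N = (n - k <= index u Q)%N.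
    move=> un uv; have : index u Q != j by apply/eqP => e; case: uv; rewrite /v -e nth_index // memQ.
    by rewrite /j; move: (index u Q) => x; clear -kn; move=> hx; apply/idP/idP; lia.
  have pnv u : (u < n)%N -> u != 0%N -> (n - k <= index u Q)%N -> pn u != v.
    move=> un u0 iu; apply/eqP => e; have := ord u; rewrite lt0n u0 un e iv => /(_ isT).
    by move: iu; rewrite /j; clear -kn; lia.
  (* Neither this write nor later ones reach the parent of a node already treated, so earlier
     decisions stay valid. *)
  have pvv : v != 0%N -> pn v != v.
    by move=> v0; apply/eqP => e; have := ord v; rewrite lt0n v0 vn e ltnn => /(_ isT).
  case: ifP => cond.
    have -> : sexec W (CWSet 3 (var 39) w1) sB = State (upd (wmem sB) 3 v 1%N) (rmem s').
      by rewrite /= !mod0n wc1.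
    split; first by apply: same_off_trans smB _; apply: same_off_upd.
    move=> u un /=; case: (u =P v) => [->|uv].
      case/and3P: cond => v0 pv tv; rewrite iv nj' v0 tv (negbTE (pvv v0)) pv /=.
      by rewrite orbT.
    rewrite (h u un) (nidx u un uv).
    case iu: (n - k <= index u Q)%N; last by [].
    case u0: (u != 0%N); last by [].
    by rewrite (negbTE (pnv u un u0 iu)).
  split; first exact: smB.
  move=> u un /=; case: (u =P v) => [->|uv]; last by rewrite (h u un) (nidx u un uv).
  by rewrite old iv nj' /= cond orbF.
- split=> // v vn; rewrite e3 // subn0; have -> : (n <= index v Q)%N = false.
    by apply/negbTE; rewrite -ltnNge -szQ index_mem memQ.
  by rewrite orbF; case: (v == r).
- by rewrite leq_mul2l.
- by move=> s' [_ h] v vn; rewrite h // subnn.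
Qed.

Lemma subtree_run :
  runs W subtree_program (input I es) (gains_time n + 400 * n.+1) (outputs_optimal_subtree I).
Proof.
apply: (@runs_weaken R W _ _ (gains_time n + (n.+1 * 50 + (n.+1 * 90 + (n.+1 * 90 + (4 + n.+1 * 100)))))%N) =>
  [||s h]; [|by move: (gains_time n) => g; clear; lia|exact: h].
apply: runs_seq; apply: runs_weaken (gains_run el nW) (leqnn _) _ => s1 [[Q t1] z3 e0 acc].
apply: runs_seq; apply: runs_weaken (runs_frame (start_run e0)) (leqnn _) _ => s2 [e13 sm2].
have t2 : tree_inv s2 Q by apply: tree_same t1 sm2 _ _.
have g2 v : (v < n)%N -> rmem s2 13 v = node_gain I (nodeof v).
  by move=> vn; rewrite e13 //; have [] := acc v vn.
have eE2 : edge_inv s2 by move=> v vn; rewrite sm2.2 //; have [] := acc v vn.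
apply: runs_seq; apply: runs_weaken (runs_frame (branch_run t2 eE2 g2)) (leqnn _) _ => s3 [g3 sm3].
have t3 : tree_inv s3 Q by apply: tree_same t2 sm3 _ _.
have eE3 : edge_inv s3 by move=> v vn; rewrite sm3.2 ?eE2.
have e03 : wmem s3 0 0 = n by case: t3 => -[].
apply: runs_seq.
apply: runs_weaken (runs_frame (@argmax_run (RGet 13) (rmem s3 13) s3 e03 _ _)) (leqnn _) _ => //.
  by move=> s' e sm _; rewrite /= sm.2.
move=> s4 [[rn rmax] sm4]; set r := wmem s4 41 0 in rn rmax.
apply: runs_seq; apply: runs_loopfree => //; set s5 := sexec _ _ _.
have s5E : s5 = State (upd (wmem s4) 3 r 1%N) (rmem s4) by rewrite /s5 /= !mod0n wc1.
have sm5 : same_off [:: 4; 41; 3]%N [::] s3 s5.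
  apply: same_off_trans (same_off_sub _ _ sm4) _; try by apply/allP.
  by rewrite s5E; apply: same_off_upd.
have t5 : tree_inv s5 Q by apply: tree_same t3 sm5 _ _.
have eE5 : edge_inv s5 by move=> v vn; rewrite sm5.2 ?eE3.
have e35 v : (v < n)%N -> wmem s5 3 v = (v == r) :> nat.
  by move=> vn; rewrite s5E /=; case: eqP => // _; rewrite sm4.1 // sm3.1 // sm2.1.
apply: runs_weaken (mark_run t5 eE5 rn e35) (leqnn _) _ => s6 mk.
rewrite /outputs_optimal_subtree; set Y := finset _.
have inY (v : 'I_n) : (v \in Y) = (wmem s6 3 v != 0%N) by rewrite inE.
pose g (v : 'I_n) := rmem s3 13 v.
have gE (v : 'I_n) : gained s5 v = g v - pcost v - edge_gain I v.
  by rewrite /gained nodeofK sm5.2.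
have vr0 (v : 'I_n) : (v != rootv) = (val v != 0%N) by rewrite -(nodeof_root (ltn_ord v)) nodeofK.
have inYE (v : 'I_n) : (v \in Y) = (val v == r) ||
    [&& v != rootv, parent v \in Y & 0 < g v - pcost v - edge_gain I v].
  by rewrite !inY mk ?ltn_ord // gE vr0 /pn nodeofK.
apply: (@dynamic_optimal R n I g _ Y (nodeof r)).
- move=> v; rewrite /g g3 ?ltn_ord // nodeofK; congr (_ + _).
  rewrite /kids_sum; apply: eq_big => [w|w _]; first by rewrite andbT -val_eqE.
  by rewrite /gained nodeofK.
- split; first by rewrite inYE /= (@val_nodeof _ _ I r rn) eqxx.
  move=> v vY vr; move: vY; rewrite inYE => /orP[/eqP e|/and3P[-> -> _]] //.
  by rewrite -e nodeofK eqxx in vr.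
- move=> v vY vr; move: vY; rewrite inYE => /orP[/eqP e|/and3P[_ _ /ltW]] //.
  by rewrite -e nodeofK eqxx in vr.
- by move=> v; rewrite inYE => /norP[_ nv] v0 pY; move: nv; rewrite v0 pY /= -leNgt.
- by move=> v; rewrite /g (@val_nodeof _ _ I r rn); exact: rmax _ (ltn_ord v).
Qed.

Lemma location_run :
  runs W location_program (input I es) (gains_time n + 400 * n.+1) (outputs_optimal_location I).
Proof.
apply: (@runs_weaken R W _ _ (gains_time n + (n.+1 * 90 + 4))%N) =>
  [||s h]; [|by move: (gains_time n) => g; clear; lia|exact: h].
apply: runs_seq; apply: runs_weaken (gains_run el nW) (leqnn _) _ => s1 [_ _ e0 acc].
apply: runs_seq.
apply: runs_weaken (@argmax_run _ (fun v => rmem s1 11 (2 * n + v)%N) s1 e0 _ _) (leqnn _) _ => //.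
  move=> s' e sm; rewrite /= !mod0n sm.2 // !sm.1 // e0; move: (weval W s' e) => x xn.
  congr rmem; rewrite !modn_small; clear -xn n3W; lia.
move=> s2 [rn rmax]; apply: runs_loopfree => //.
exists (nodeof (wmem s2 41 0)); first by rewrite /= !mod0n val_nodeof.
move=> w; rewrite !total_penalty1.
have := rmax w (ltn_ord w); have [-> _] := acc _ (ltn_ord w); have [-> _] := acc _ rn.
by rewrite nodeofK; lra.
Qed.

End Programs.

(** * Arithmetic of the time bound and of the word size *)

Lemma time_bound n : (2 <= n)%N ->
  (gains_time n + 400 * n.+1 <= 4800 * 1000 * nlogn n)%N.
Proof.
move=> n2; have n0 : (0 < n)%N by lia.
rewrite /gains_time /nlogn; set L := trunc_log 2 n.
have L1 : (1 <= L)%N.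
  by apply: trunc_log_max.
(* Because [3 * n < 4 * n]; the [48 * (L + 2) + 97] rounds counted below are then at most [241 * L],
   as L is positive. *)
have lt : (trunc_log 2 (3 * n) <= L + 2)%N.
  rewrite leqNgt; apply/negP => h.
  have p3 : (0 < 3 * n)%N by lia.
  have /andP[_ ub] := trunc_log_bounds (isT : (1 < 2)%N) n0.
  have /andP[lb _] := trunc_log_bounds (isT : (1 < 2)%N) p3.
  have := leq_pexp2l (isT : (0 < 2)%N) h; move: ub lb; rewrite -/L addn2 !expnS.
  by move: (2 ^ L)%N (2 ^ trunc_log 2 (3 * n))%N => x y; clear; lia.
have p3 : (0 < 3 * n)%N by lia.
have r : ((rounds (3 * n)).+1 <= 241 * L)%N by have := rounds_le p3; move: lt L1; clear; lia.
have k : (4900 * (3 * n).+1 <= 4900 * 4 * n)%N by lia.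
have := leq_mul r k; move: ((rounds _).+1 * _)%N => z.
have : (n <= n * L)%N by rewrite leq_pmulr.
have -> : (241 * L * (4900 * 4 * n) = 241 * 4900 * 4 * (n * L))%N by nia.
by move: (n * L)%N => m; clear -n2; lia.
Qed.

(** The quadratic requirement comes from sums of neighbour labels, bounded by [2 * n * n]. Two of
    the eight factors [n + 2] give the square, and the other six, at least [3 ^ 6 = 729] together,
    absorb the constants. *)
Lemma word_bound n W : (0 < n)%N -> ((n + 2) ^ 8 <= W)%N -> (20 * n * n + 100 < W)%N.
Proof.
move=> n0; apply: leq_trans.
have -> : ((n + 2) ^ 8 = (n + 2) ^ 2 * (n + 2) ^ 6)%N by rewrite -expnD.
have h : (729 <= (n + 2) ^ 6)%N by rewrite (@leq_trans (3 ^ 6)) // leq_exp2r //; lia.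
have := leq_mul (leqnn ((n + 2) ^ 2)%N) h; apply: leq_trans.
by rewrite expnS expn1; nia.
Qed.

Theorem theorem2 (R : realType) :
  (exists c : cmd, solves_in_time (@outputs_optimal_subtree R) c nlogn) /\
  (exists c : cmd, solves_in_time (@outputs_optimal_location R) c nlogn).
Proof.
split; [exists subtree_program|exists location_program];
  (* The threshold is 2 because [nlogn 1] is 0. *)
  exists 8, (4800 * 1000)%N, 2 => n I es W el hW;
  have nW := word_bound (node_gt0 I) hW.
  have [t [s [ex le_t out]]] := subtree_run el nW.
  by exists t, s; split=> // /time_bound; apply: leq_trans.
have [t [s [ex le_t out]]] := location_run el nW.
by exists t, s; split=> // /time_bound; apply: leq_trans.
Qed.
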